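(* Let $C$ be a ribbon of genus $g$ on $\mathbb P^1$ and let $L$ be a line bundle of degree $2n$ on $C$, where $1\le n\le g-2$. Then $h^0(C,L)\le n+1$. Equality holds if and only if $C$ is a hyperelliptic ribbon and $L$ is isomorphic to the pullback of $\mathscr O_{\mathbb P^1}(n)$ from $C_{red}\cong\mathbb P^1$ to $C$ (that is, $L\cong\pi^*\mathscr O_{\mathbb P^1}(n)$, where $\pi:C\to\mathbb P^1$ is the map splitting the inclusion $\mathbb P^1\hookrightarrow C$).
   Context: Work over an algebraically closed field of characteristic $0$. A ribbon on $\mathbb P^1$ is a scheme $C$ with an isomorphism $\mathbb P^1\to C_{red}$ such that the ideal sheaf $\mathscr L$ of $\mathbb P^1$ in $C$ satisfies $\mathscr L^2=0$ and is (as a sheaf on $\mathbb P^1$) a line bundle. Its genus is $g=1-\chi(\mathscr O_C)$; equivalently $\mathscr L\cong\mathscr O_{\mathbb P^1}(-g-1)$. The ribbon $C$ is called hyperelliptic (or split) if there is a morphism $\pi:C\to\mathbb P^1$ restricting to the identity on $\mathbb P^1\cong C_{red}$. The degree of a line bundle $L$ on $C$ is $\deg L=\chi(L)-\chi(\mathscr O_C)$; if $L|_{\mathbb P^1}\cong\mathscr O_{\mathbb P^1}(n)$ then $\deg L=2n$. *)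

(* Defs.v *)
From HB Require Import structures.
From mathcomp Require Import all_boot all_order all_algebra.
From mathcomp Require Import all_classical.
From mathcomp Require Import topology_structure.

Set Implicit Arguments.
Unset Strict Implicit.
Unset Printing Implicit Defensive.

Import GRing.Theory.

Local Open Scope classical_set_scope.
Local Open Scope ring_scope.

Record opens (X : topologicalType) := Opens {
  oset :> set X;
  osetP : open oset
}.

Definition oT (X : topologicalType) : opens X := Opens openT.

(* Both axioms of a sheaf at once.  Compatibility of the [s i] is tested on
   every open set contained in [W i] and in [W j], hence on [W i `&` W j].
   [I] may be empty, which forces the sections over [set0] to be a singleton:
   this is why rings below are [comPzRingType]s (with [0 = 1] allowed). *)
Definition gluing (X : topologicalType) (F : opens X -> Type)
    (res : forall U V : opens X, V `<=` U -> F U -> F V) : Prop :=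
  forall (U : opens X) (I : Type) (W : I -> opens X)
    (WU : forall i, W i `<=` U) (s : forall i, F (W i)),
    U `<=` \bigcup_i W i ->
    (forall i j (V : opens X) (Vi : V `<=` W i) (Vj : V `<=` W j),
       res (W i) V Vi (s i) = res (W j) V Vj (s j)) ->
    exists! t : F U, forall i, res U (W i) (WU i) t = s i.

(* Commutative [k]-algebras are commutative rings with a ring morphism from
   [k] ([comAlgType k] would exclude the zero ring). *)
Record algSheaf (k : fieldType) (X : topologicalType) := AlgSheaf {
  sec :> opens X -> comPzRingType;
  ares : forall U V : opens X, V `<=` U -> {rmorphism sec U -> sec V};
  scal : forall U : opens X, {rmorphism k -> sec U};
  ares_id : forall (U : opens X) (UU : U `<=` U) a, ares UU a = a;
  ares_comp : forall (U V W : opens X) (VU : V `<=` U) (WV : W `<=` V)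
    (WU : W `<=` U) a, ares WV (ares VU a) = ares WU a;
  ares_scal : forall (U V : opens X) (VU : V `<=` U) c,
    ares VU (scal U c) = scal V c;
  algSheaf_glue : gluing (fun U V VU => @ares U V VU)
}.

Arguments ares {k X a U V} VU : rename.

Record algHom (k : fieldType) (X : topologicalType) (A B : algSheaf k X) :=
  AlgHom {
  ahom :> forall U : opens X, {rmorphism A U -> B U};
  ahom_res : forall (U V : opens X) (VU : V `<=` U) a,
    ahom V (ares VU a) = ares VU (ahom U a);
  ahom_scal : forall (U : opens X) c, ahom U (scal A U c) = scal B U c
}.

Record modSheaf (k : fieldType) (X : topologicalType) (A : algSheaf k X) :=
  ModSheaf {
  msec :> forall U : opens X, lmodType (A U);
  mres : forall U V : opens X, V `<=` U -> {additive msec U -> msec V};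
  mresZ : forall (U V : opens X) (VU : V `<=` U) (a : A U) (m : msec U),
    mres VU (a *: m) = ares VU a *: mres VU m;
  mres_id : forall (U : opens X) (UU : U `<=` U) m, mres UU m = m;
  mres_comp : forall (U V W : opens X) (VU : V `<=` U) (WV : W `<=` V)
    (WU : W `<=` U) m, mres WV (mres VU m) = mres WU m;
  modSheaf_glue : gluing (fun U V VU => @mres U V VU)
}.

Arguments mres {k X A m U V} VU : rename.

Section Modules.
Variables (k : fieldType) (X : topologicalType).

Section RegularModule.
Variable A : algSheaf k X.

Definition regMod_sec (U : opens X) : lmodType (A U) := (A U)^o.

Definition regMod_res (U V : opens X) (VU : V `<=` U) :
  {additive regMod_sec U -> regMod_sec V} := ares VU.

Lemma regMod_resZ (U V : opens X) (VU : V `<=` U) (a : A U)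
  (m : regMod_sec U) : regMod_res VU (a *: m) = ares VU a *: regMod_res VU m.
Proof. exact: rmorphM. Qed.

Definition regMod : modSheaf A :=
  @ModSheaf k X A regMod_sec regMod_res regMod_resZ
    (@ares_id k X A) (@ares_comp k X A) (@algSheaf_glue k X A).

End RegularModule.

(* A homomorphism from the restriction of [A] to [U] is [a |-> a *: e] for a
   unique section [e] over [U], the image of [1]. *)
Definition free_generator (A : algSheaf k X) (L : modSheaf A) (U : opens X)
    (e : L U) : Prop :=
  forall (V : opens X) (VU : V `<=` U),
    bijective (fun a : A V => a *: mres VU e).

Definition line_bundle (A : algSheaf k X) (L : modSheaf A) : Prop :=
  forall x : X, exists (U : opens X) (e : L U), oset U x /\ free_generator e.

(* For [f : A -> B], a morphism of [A]-modules from [M] to [N] regarded as an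
   [A]-module through [f]. *)
Record modHom (A B : algSheaf k X) (f : algHom A B)
    (M : modSheaf A) (N : modSheaf B) := ModHom {
  mhom :> forall U : opens X, {additive M U -> N U};
  mhomZ : forall (U : opens X) (a : A U) (m : M U),
    mhom U (a *: m) = f U a *: mhom U m;
  mhom_res : forall (U V : opens X) (VU : V `<=` U) m,
    mhom V (mres VU m) = mres VU (mhom U m)
}.

Section IdHom.
Variable A : algSheaf k X.

Definition idHom_fun (U : opens X) : {rmorphism A U -> A U} := idfun.

Definition idHom : algHom A A :=
  @AlgHom k X A A idHom_fun (fun _ _ _ _ => erefl) (fun _ _ => erefl).

End IdHom.

(* [f : A -> B] is a morphism of ringed spaces [(X, B) -> (X, A)] which is the
   identity on [X].  [N] together with [eta] is the inverse image of the
   [A]-module [M]: the left adjoint of restriction of scalars, i.e. the sheaf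
   tensor product of [M] and [B] over [A]. *)
Definition is_pullback (A B : algSheaf k X) (f : algHom A B)
    (M : modSheaf A) (N : modSheaf B) : Prop :=
  exists eta : modHom f M N,
  forall (P : modSheaf B) (u : modHom f M P),
  exists2 v : modHom (idHom B) N P,
    (forall (U : opens X) (m : M U), v U (eta U m) = u U m) &
    forall v' : modHom (idHom B) N P,
      (forall (U : opens X) (m : M U), v' U (eta U m) = u U m) ->
      forall (U : opens X) (t : N U), v' U t = v U t.

(* [d] is the dimension over [k] of [M U / S], for a [k]-subspace [S]. *)
Definition dim_mod (A : algSheaf k X) (M : modSheaf A) (U : opens X)
    (S : set (M U)) (d : nat) : Prop :=
  exists v : 'I_d -> M U, forall m : M U,
  exists! c : 'rV[k]_d, S (m - \sum_(i < d) scal A U (c 0 i) *: v i).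

Definition dim_H0 (A : algSheaf k X) (M : modSheaf A) (d : nat) : Prop :=
  dim_mod (U := oT X) [set (0 : M (oT X))] d.

End Modules.

Arguments regMod {k X} A.
Arguments idHom {k X} A.

(* Closed points only: [Some a] is [1 : a] and [None] is [0 : 1].  Taking
   closed points identifies the open sets, hence the sheaves, of the scheme
   with those of this space. *)
Definition P1 (k : Type) : Type := option k.

HB.instance Definition _ (k : choiceType) := Choice.on (P1 k).

Section P1topology.
Variable k : choiceType.

Definition zariski : set (set (P1 k)) :=
  [set U | U = set0 \/ finite_set (~` U)].

Lemma zariskiT : zariski setT.
Proof. by right; rewrite setCT; exact: finite_set0. Qed.

Lemma zariskiI : setI_closed zariski.
Proof.
move=> U V [->|fU]; first by left; rewrite set0I.
case=> [->|fV]; first by left; rewrite setI0.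
by right; rewrite setCI finite_setU.
Qed.

Lemma zariski_bigU (I : Type) (f : I -> set (P1 k)) :
  (forall i, zariski (f i)) -> zariski (\bigcup_i f i).
Proof.
move=> zf; have [[i [x fix_]]|h] := pselect (exists i, f i !=set0).
  right; case: (zf i) => [fi0|]; first by rewrite fi0 in fix_.
  by apply: sub_finite_set => y nfy fiy; apply: nfy; exists i.
left; rewrite -subset0 => x [i _ fix_]; apply: h.
by exists i, x.
Qed.

HB.instance Definition _ := isOpenTopological.Build (P1 k)
  zariskiT zariskiI zariski_bigU.

Lemma open_P1E (U : set (P1 k)) : open U <-> zariski U.
Proof. by []. Qed.

Lemma open_off (S : set (P1 k)) : finite_set S -> open (~` S).
Proof. by move=> fS; right; rewrite setCK. Qed.

Definition off (x : P1 k) : opens (P1 k) := Opens (open_off (finite_set1 x)).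
Definition off2 (x y : P1 k) : opens (P1 k) :=
  Opens (open_off (finite_set2 x y)).

Lemma off2_subl (x y : P1 k) : off2 x y `<=` off x.
Proof. by move=> z nz zx; apply: nz; left. Qed.

Lemma off2_subr (x y : P1 k) : off2 x y `<=` off y.
Proof. by move=> z nz zy; apply: nz; right. Qed.

End P1topology.

Section Twist.
Variable k : fieldType.

Definition hcoord (x : P1 k) : k * k := if x is Some a then (1, a) else (0, 1).

(* The binary form of degree [d] with coefficients [p`_0, ..., p`_d]. *)
Definition form (d : nat) (p : {poly k}) (v : k * k) : k :=
  \sum_(i < d.+1) p`_i * v.1 ^+ (d - i) * v.2 ^+ i.

Definition quotient_of_forms (n d : nat) (F G : {poly k}) (x : P1 k) (c : k) :=
  form d G (hcoord x) != 0 /\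
  c = form (d + n) F (hcoord x) / form d G (hcoord x).

(* A section of O(n) over [U], as a function on the set of the nonzero vectors
   lying above [U] which is homogeneous of degree [n] and locally a quotient
   of forms; it is recorded by its values at the vectors [hcoord x]. *)
Definition regular (n : nat) (U : set (P1 k)) (s : set_type U -> k) : Prop :=
  forall x : set_type U, exists (V : opens (P1 k)) (d : nat) (F G : {poly k}),
    oset V (val x) /\
    forall y : set_type U, oset V (val y) -> quotient_of_forms n d F G (val y) (s y).


Definition regular_pred (n : nat) (U : set (P1 k)) : pred (set_type U -> k) :=
  [pred s | `[< regular n s >]].

Lemma formE (d : nat) (p : {poly k}) (x : P1 k) :
  form d p (hcoord x) =
    if x is Some a then (take_poly d.+1 p).[a] else p`_d.
Proof.
rewrite /form; case: x => [a|] /=.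
  rewrite (horner_coef_wide _ (size_take_poly _ _)).
  by apply: eq_bigr => i _; rewrite coef_take_poly ltn_ord expr1n mulr1.
rewrite big_ord_recr /= big1 ?add0r ?subnn ?expr0 ?mulr1 ?expr1n ?mulr1 //.
by move=> i _; rewrite expr0n subn_eq0 leqNgt ltn_ord /= mulr0 mul0r.
Qed.

Lemma formD (d : nat) (p q : {poly k}) (v : k * k) :
  form d (p + q) v = form d p v + form d q v.
Proof.
by rewrite /form -big_split; apply: eq_bigr => i _; rewrite coefD !mulrDl.
Qed.

Lemma formZ (d : nat) (c : k) (p : {poly k}) (v : k * k) :
  form d (c *: p) v = c * form d p v.
Proof.
by rewrite /form mulr_sumr; apply: eq_bigr => i _; rewrite coefZ !mulrA.
Qed.

Lemma formM (c d e : nat) (p q : {poly k}) (x : P1 k) : c = (d + e)%N ->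
  form c (take_poly d.+1 p * take_poly e.+1 q) (hcoord x) =
  form d p (hcoord x) * form e q (hcoord x).
Proof.
move=> ->; rewrite !formE; case: x => [a|].
  rewrite take_poly_id ?hornerM //.
  apply: leq_trans (size_polyMleq _ _) _.
  have := leq_add (size_take_poly d.+1 p) (size_take_poly e.+1 q).
  by rewrite addSn addnS; case: (_ + _)%N.
rewrite coefM (bigD1 (Ordinal (leq_addr e d : (d < (d + e).+1)%N))) //=.
rewrite !coef_take_poly !ltnS leqnn addKn leqnn big1 ?addr0 // => i ni.
rewrite !coef_take_poly !ltnS; case: leqP => [le_id|]; last by rewrite mul0r.
have [le_di|] := leqP (d + e - i) e; last by rewrite mulr0.
case/negP: ni; apply/eqP/val_inj/eqP; rewrite /= eqn_leq le_id /=.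
by move: le_di; rewrite leq_subLR leq_add2r.
Qed.

Lemma form_one (x : P1 k) : form 0 1 (hcoord x) = 1.
Proof. by rewrite /form big_ord1 coef1 !mulr1. Qed.

Section RegularClosed.
Variable U : set (P1 k).

Lemma regular_cst (c : k) : @regular 0 U (fun=> c).
Proof.
move=> x; exists (oT _), 0%N, c%:P, 1; split=> // y _.
rewrite /quotient_of_forms -alg_polyC formZ addn0 !form_one.
by rewrite oner_neq0 mulr1 divr1.
Qed.

Lemma regular0 (n : nat) : @regular n U 0.
Proof.
move=> x; exists (oT _), 0%N, 0, 1; split=> // y _.
rewrite /quotient_of_forms form_one oner_neq0; split=> //.
by rewrite divr1 -(scale0r 0) formZ mul0r.
Qed.

Lemma regularN (n : nat) (s : set_type U -> k) : regular n s -> regular n (- s).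
Proof.
move=> rs x; have [V [d [F [G [Vx h]]]]] := rs x.
exists V, d, (-1 *: F), G; split=> // y Vy; have [Gy sy] := h y Vy.
by split=> //; rewrite formZ mulN1r mulNr -sy.
Qed.

Lemma regularD (n : nat) (s t : set_type U -> k) :
  regular n s -> regular n t -> regular n (s + t).
Proof.
move=> rs rt x; have [V [d [F [G [Vx h]]]]] := rs x.
have [W [e [H [K [Wx h']]]]] := rt x.
exists (Opens (openI (osetP V) (osetP W))), (d + e)%N,
  (take_poly (d + n).+1 F * take_poly e.+1 K +
   take_poly d.+1 G * take_poly (e + n).+1 H),
  (take_poly d.+1 G * take_poly e.+1 K).
split=> // y [Vy Wy]; have [Gy sy] := h y Vy; have [Ky ty] := h' y Wy.
rewrite /quotient_of_forms (formM _ _ _ erefl) mulf_neq0 //; split=> //.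
rewrite formD (formM _ _ _ (addnAC _ _ _)) (formM _ _ _ (esym (addnA _ _ _))).
by rewrite -[LHS]/(s y + t y) sy ty addf_div // [form (e + n) _ _ * _]mulrC.
Qed.

Lemma regularM (m n : nat) (s t : set_type U -> k) :
  regular m s -> regular n t -> regular (m + n) (s * t).
Proof.
move=> rs rt x; have [V [d [F [G [Vx h]]]]] := rs x.
have [W [e [H [K [Wx h']]]]] := rt x.
exists (Opens (openI (osetP V) (osetP W))), (d + e)%N,
  (take_poly (d + m).+1 F * take_poly (e + n).+1 H),
  (take_poly d.+1 G * take_poly e.+1 K).
split=> // y [Vy Wy]; have [Gy sy] := h y Vy; have [Ky ty] := h' y Wy.
rewrite /quotient_of_forms (formM _ _ _ erefl) mulf_neq0 //; split=> //.
by rewrite (formM _ _ _ (addnACA _ _ _ _)) -[LHS]/(s y * t y) sy ty mulf_div.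
Qed.

Fact regular_zmod_closed (n : nat) : zmod_closed (@regular_pred n U).
Proof.
split; first by apply/asboolP; exact: regular0.
by move=> s t /asboolP rs /asboolP rt; apply/asboolP/regularD/regularN.
Qed.

Fact regular_subring_closed : subring_closed (@regular_pred 0 U).
Proof.
split; first by apply/asboolP; exact: regular_cst.
  exact: (regular_zmod_closed 0).2.
by move=> s t /asboolP rs /asboolP rt; apply/asboolP; exact: (regularM rs rt).
Qed.

HB.instance Definition _ (n : nat) := GRing.isZmodClosed.Build _
  (@regular_pred n U) (regular_zmod_closed n).
HB.instance Definition _ := GRing.isSubringClosed.Build _
  (@regular_pred 0 U) regular_subring_closed.

Record O_sec (n : nat) :=
  OSec { O_val :> set_type U -> k; O_valP : regular_pred n O_val }.

HB.instance Definition _ (n : nat) := [isSub for @O_val n].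
HB.instance Definition _ (n : nat) := [Choice of O_sec n by <:].
HB.instance Definition _ (n : nat) :=
  [SubChoice_isSubZmodule of O_sec n by <:].
HB.instance Definition _ :=
  GRing.SubZmodule_isSubPzRing.Build _ _ (O_sec 0) (subringClosedP _).
HB.instance Definition _ :=
  GRing.SubPzRing_isSubComPzRing.Build _ _ (O_sec 0).

Lemma O_sec_eq (n : nat) (s t : O_sec n) : (forall x, s x = t x) -> s = t.
Proof. by move=> st; apply: val_inj; apply: funext. Qed.

Lemma O_regular (n : nat) (s : O_sec n) : regular n s.
Proof. exact: asboolW (O_valP s). Qed.

Definition O_scale (n : nat) (a : O_sec 0) (s : O_sec n) : O_sec n :=
  OSec (asboolT (regularM (O_regular a) (O_regular s))).

Lemma O_scaleA (n : nat) (a b : O_sec 0) (s : O_sec n) :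
  O_scale a (O_scale b s) = O_scale (a * b) s.
Proof. by apply: O_sec_eq => x; exact: mulrA. Qed.

Lemma O_scale1 (n : nat) : left_id 1 (@O_scale n).
Proof. by move=> s; apply: O_sec_eq => x; exact: mul1r. Qed.

Lemma O_scaleDr (n : nat) : right_distributive (@O_scale n) +%R.
Proof. by move=> a s t; apply: O_sec_eq => x; exact: mulrDr. Qed.

Lemma O_scaleDl (n : nat) (s : O_sec n) :
  {morph (@O_scale n)^~ s : a b / a + b}.
Proof. by move=> a b; apply: O_sec_eq => x; exact: mulrDl. Qed.

HB.instance Definition _ (n : nat) := GRing.Zmodule_isLmodule.Build
  (O_sec 0) (O_sec n) (@O_scaleA n) (@O_scale1 n) (@O_scaleDr n) (@O_scaleDl n).

Definition O_cst (c : k) : O_sec 0 := OSec (asboolT (regular_cst c)).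

Fact O_cst_zmod : zmod_morphism O_cst.
Proof. by move=> a b; apply: O_sec_eq. Qed.
Fact O_cst_monoid : monoid_morphism O_cst.
Proof. by split=> [|a b]; apply: O_sec_eq. Qed.
HB.instance Definition _ := GRing.isZmodMorphism.Build _ _ _ O_cst_zmod.
HB.instance Definition _ := GRing.isMonoidMorphism.Build _ _ _ O_cst_monoid.

End RegularClosed.

Section Restriction.
Variables (U V : set (P1 k)) (VU : V `<=` U).

Definition set_incl (y : set_type V) : set_type U :=
  SigSub (mem_set (VU (set_valP y))).

Fact O_res_subproof (n : nat) (s : O_sec U n) :
  regular n (fun y : set_type V => s (set_incl y)).
Proof.
move=> x; have [W [d [F [G [Wx h]]]]] := O_regular s (set_incl x).
by exists W, d, F, G; split=> // y; exact: (h (set_incl y)).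
Qed.

Definition O_res (n : nat) (s : O_sec U n) : O_sec V n :=
  OSec (asboolT (O_res_subproof s)).

Fact O_res_zmod (n : nat) : zmod_morphism (@O_res n).
Proof. by move=> s t; apply: O_sec_eq. Qed.
Fact O_res_monoid : monoid_morphism (@O_res 0).
Proof. by split=> [|s t]; apply: O_sec_eq. Qed.
HB.instance Definition _ (n : nat) :=
  GRing.isZmodMorphism.Build _ _ (@O_res n) (@O_res_zmod n).
HB.instance Definition _ :=
  GRing.isMonoidMorphism.Build _ _ (@O_res 0) O_res_monoid.

Lemma O_resZ (n : nat) (a : O_sec U 0) (s : O_sec U n) :
  O_res (a *: s) = O_res a *: O_res s.
Proof. by apply: O_sec_eq. Qed.

End Restriction.

Lemma O_res_id (n : nat) (U : set (P1 k)) (UU : U `<=` U) (s : O_sec U n) :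
  O_res UU s = s.
Proof. by apply: O_sec_eq => x; congr (s _); apply: val_inj. Qed.

Lemma O_res_comp (n : nat) (U V W : set (P1 k)) (VU : V `<=` U) (WV : W `<=` V)
  (WU : W `<=` U) (s : O_sec U n) : O_res WV (O_res VU s) = O_res WU s.
Proof. by apply: O_sec_eq => x; congr (s _); apply: val_inj. Qed.

Lemma O_glue (n : nat) :
  @gluing (P1 k) (fun U => O_sec U n) (fun U V VU => @O_res U V VU n).
Proof.
move=> U I W WU s cov comp.
have ex (x : set_type U) : exists i : I, oset (W i) (val x).
  by have [i _ Wx] := cov _ (set_valP x); exists i.
pose i_ x := projT1 (cid (ex x)).
have Wi x : oset (W (i_ x)) (val x) := projT2 (cid (ex x)).
pose t (x : set_type U) : k := s (i_ x) (SigSub (mem_set (Wi x))).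
have tE i (y : set_type (W i)) : t (set_incl (WU i) y) = s i y.
  rewrite /t; set x := set_incl _ y.
  pose V := Opens (openI (osetP (W (i_ x))) (osetP (W i))).
  have Vy : oset V (val y) by split; [exact: (Wi x)|exact: set_valP].
  have := comp _ _ V (@subIsetl _ _ _) (@subIsetr _ _ _).
  move=> /(congr1 (fun f : O_sec V n => f (SigSub (mem_set Vy)))) /= e.
  transitivity (s (i_ x) (set_incl (@subIsetl _ (W (i_ x)) (W i))
    (SigSub (mem_set Vy)))); first by congr (O_val _ _); exact: val_inj.
  by rewrite [LHS]e; congr (O_val _ _); exact: val_inj.
have rt : regular n t.
  move=> x; have [V [d [F [G [Vx h]]]]] :=
    O_regular (s (i_ x)) (SigSub (mem_set (Wi x))).
  exists (Opens (openI (osetP V) (osetP (W (i_ x))))), d, F, G.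
  split=> [|y [Vy Wy]]; first by split=> //; exact: Wi.
  have := h (SigSub (mem_set Wy)) Vy; rewrite -tE.
  by rewrite (_ : set_incl _ _ = y) //; apply: val_inj.
exists (OSec (asboolT rt)); split=> [i|t' t'E].
  by apply: O_sec_eq => y; exact: tE.
apply: O_sec_eq => x /=; rewrite /t -t'E.
by congr (t' _); apply: val_inj.
Qed.

Definition O_ring (U : opens (P1 k)) : comPzRingType := O_sec U 0.
Definition O_ring_res (U V : opens (P1 k)) (VU : V `<=` U) :
  {rmorphism O_ring U -> O_ring V} := @O_res U V VU 0.
Definition O_ring_cst (U : opens (P1 k)) : {rmorphism k -> O_ring U} := O_cst U.

Lemma O_ring_cst_res (U V : opens (P1 k)) (VU : V `<=` U) c :
  O_ring_res VU (O_ring_cst U c) = O_ring_cst V c.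
Proof. exact: O_sec_eq. Qed.

Definition O_P1 : algSheaf k (P1 k) :=
  @AlgSheaf k (P1 k) O_ring O_ring_res O_ring_cst (@O_res_id 0) (@O_res_comp 0)
    O_ring_cst_res (@O_glue 0).

Definition twist_mod (n : nat) (U : opens (P1 k)) : lmodType (O_P1 U) :=
  O_sec U n.
Definition twist_res (n : nat) (U V : opens (P1 k)) (VU : V `<=` U) :
  {additive twist_mod n U -> twist_mod n V} := @O_res U V VU n.

Definition twist (n : nat) : modSheaf O_P1 :=
  @ModSheaf k (P1 k) O_P1 (twist_mod n) (@twist_res n)
    (fun U V VU => @O_resZ U V VU n) (@O_res_id n) (@O_res_comp n) (@O_glue n).

End Twist.

Section EulerCharacteristic.
Variables (k : fieldType) (A : algSheaf k (P1 k)) (M : modSheaf A).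

(* Cech cohomology of the covering by [x0 <> 0] and [x1 <> 0].  These open sets
   are affine in P^1, hence also in every ribbon, so that for coherent sheaves
   this is sheaf cohomology, and the cohomology in degree >= 2 is zero. *)
Definition cech_coboundary : set (M (off2 None (Some 0))) :=
  [set m | exists (a : M (off None)) (b : M (off (Some 0))),
     m = mres (@off2_subr _ None (Some 0)) b
       - mres (@off2_subl _ None (Some 0)) a].

Definition dim_H1 (d : nat) : Prop := dim_mod cech_coboundary d.

Definition euler_char (c : int) : Prop :=
  exists h0 h1 : nat, [/\ dim_H0 M h0, dim_H1 h1 & c = h0%:Z - h1%:Z].

End EulerCharacteristic.

(* The structure sheaf of a ribbon on P^1 together with the exact sequence
   0 -> ideal -> O_C -> O_P1 -> 0.  Since the ideal is nilpotent, C and P^1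
   have the same underlying space.  The ringed space so obtained is
   automatically a scheme: it is a square-zero extension of a scheme by a
   quasi-coherent sheaf.  The condition that the ideal has square zero is
   equivalent to its being an O_P1-module compatibly with [rib_incl]; it is
   nevertheless listed. *)
Record ribbon (k : fieldType) := Ribbon {
  rib_O :> algSheaf k (P1 k);
  rib_red : algHom rib_O (O_P1 k);
  rib_red_surj : forall (U : opens (P1 k)) (b : O_P1 k U) (x : P1 k),
    oset U x -> exists (V : opens (P1 k)) (VU : V `<=` U) (a : rib_O V),
      oset V x /\ rib_red V a = ares VU b;
  rib_ideal : modSheaf (O_P1 k);
  rib_incl : forall U : opens (P1 k), {additive rib_ideal U -> rib_O U};
  rib_incl_res : forall (U V : opens (P1 k)) (VU : V `<=` U) m,
    rib_incl V (mres VU m) = ares VU (rib_incl U m);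
  rib_inclZ : forall (U : opens (P1 k)) (a : rib_O U) (m : rib_ideal U),
    rib_incl U (rib_red U a *: m) = a * rib_incl U m;
  rib_incl_inj : forall U : opens (P1 k), injective (rib_incl U);
  rib_exact : forall (U : opens (P1 k)) (a : rib_O U),
    rib_red U a = 0 <-> exists m, rib_incl U m = a;
  rib_sqr0 : forall (U : opens (P1 k)) (m m' : rib_ideal U),
    rib_incl U m * rib_incl U m' = 0;
  rib_ideal_line : line_bundle rib_ideal
}.

Section RibbonNotions.
Variables (k : fieldType) (C : ribbon k).

Definition has_genus (g : int) : Prop := euler_char (regMod C) (1 - g).

Definition has_degree (L : modSheaf C) (e : int) : Prop :=
  exists2 c : int * int,
    euler_char L c.1 /\ euler_char (regMod C) c.2 & e = c.1 - c.2.

(* [pi : O_P1 -> O_C] is the comorphism of a morphism C -> P^1 that restricts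
   to the identity of P^1. *)
Definition is_splitting (pi : algHom (O_P1 k) C) : Prop :=
  forall (U : opens (P1 k)) (b : O_P1 k U), rib_red C U (pi U b) = b.

Definition hyperelliptic : Prop :=
  exists pi : algHom (O_P1 k) C, is_splitting pi.

End RibbonNotions.

(* Main.v *)
(* Let x0, x1 be the homogeneous coordinates and t = x1/x0, and let [I] be the
   ideal of P^1 in C.  Every line bundle on C is trivial on the two charts, and
   C is there isomorphic to the split ribbon, so that L is given by transition
   functions; a window of Laurent monomials computes its Euler characteristic.
   The genus then gives I = O(-g-1), and the degree shows that L restricts to
   O(n) on P^1.  As n - g - 1 < 0, the kernel of L -> O(n) has no global
   sections, hence h^0(L) <= n + 1, and equality means that every monomial
   x0^(n-i) x1^i lifts to a section s_i of L.

   In that case T = s_1/s_0 and U = s_(n-1)/s_n lift t and 1/t to the two charts,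
   and s_i = T^i (1 + E_i) s_0 with E_i in I.  The chart x0 <> 0 bounds the pole
   of E_i at t = 0.  On the chart x1 <> 0, E_i is an affine function of i up to
   terms of bounded degree, because s_i is close to U^(n-i) s_n.  The two bounds
   exclude each other on the second differences of E_i exactly when n <= g - 2,
   so these vanish.  Since E_0 = E_1 = 0, it follows that s_i = T^i s_0 and
   T U = 1, so that T defines a splitting under which L is the pullback of O(n).

   Conversely, if L = pi^* O(n), then L -> O(n) splits the unit O(n) -> L, which
   is therefore injective on global sections. *)

From HB Require Import structures.
From mathcomp Require Import all_boot all_order all_algebra.
From mathcomp Require Import all_classical.
From mathcomp Require Import topology_structure.
From mathcomp Require Import ring zify.
Require Import Defs.

Set Implicit Arguments.
Unset Strict Implicit.
Unset Printing Implicit Defensive.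

Import Order.TTheory GRing.Theory.

Local Open Scope classical_set_scope.
Local Open Scope ring_scope.

(** The obstacle is that C has no canonical splitting over the overlap of the charts. A lift [T0] of
    t gives a ring embedding [lft] of O into C there, and a generator of I turns every element into
    two Laurent series: its reduction and its ideal coordinate [epart]. These detect extension to
    the chart x0 <> 0, where [T0] lives, but not to x1 <> 0, whose own lift of 1/t may differ from
    1/T0 by an ideal element with any poles.

    For Euler characteristics the discrepancy is confined by a bound [d]. The window is cut deep
    enough to lie beyond it, and its size cancels from the count, which leaves p + 2q + 2 for the
    exponents p, q of the transition functions of I and L.

    For equality, [T0] is taken to be s_1/s_0 itself. Since I has square zero, [epart] is a
    derivation, so it takes U^m to m u^(m-1) epart(U), where u = 1/t: this factor m is the source of
    the affine dependence on i.

    Triviality on a chart rests on the finiteness of the complement of an open set: generators and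
    lifts are extended across one missing point at a time, by partial fractions. *)

Definition oI (X : topologicalType) (U V : opens X) : opens X :=
  Opens (openI (osetP U) (osetP V)).

Lemma oIl (X : topologicalType) (U V : opens X) : oI U V `<=` U.
Proof. exact: subIsetl. Qed.

Lemma oIr (X : topologicalType) (U V : opens X) : oI U V `<=` V.
Proof. exact: subIsetr. Qed.

Lemma oIS (X : topologicalType) (U V W : opens X) :
  W `<=` U -> W `<=` V -> W `<=` oI U V.
Proof. by move=> WU WV x Wx; split; [exact: WU|exact: WV]. Qed.

Lemma opens_eq (X : topologicalType) (U V : opens X) :
  U `<=` V -> V `<=` U -> U = V.
Proof.
move=> UV VU; have: oset U = oset V by apply/seteqP.
case: U V {UV VU} => [U oU] [V oV] /= e; case: _ / e oV => oV.
by congr Opens; exact: Prop_irrelevance.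
Qed.

Ltac opens_subset :=
  let x := fresh "x" in let h := fresh "h" in
  intros x h;
  repeat match goal with
  | H : oset (oI _ _) _ |- _ => case: H => ? ?
  | H : setI _ _ _ |- _ => case: H => ? ?
  end;
  repeat match goal with
  | |- oset (oI _ _) _ => split
  | |- setI _ _ _ => split
  end;
  solve [assumption |
    match goal with
    | H : subset _ ?B |- ?B _ => apply: H; assumption
    | H : subset ?B ?C, H' : subset _ ?B |- ?C _ => apply: H; apply: H'; assumption
    | H : subset ?B ?C, H' : subset ?B' ?B, H'' : subset _ ?B' |- ?C _ =>
        apply: H; apply: H'; apply: H''; assumption
    end].

#[local] Hint Extern 0 (subset _ _) => opens_subset : core.

(** * Sheaves of modules and their generators *)

Section Restriction.
Variables (k : fieldType) (X : topologicalType) (A : algSheaf k X).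

(* The restriction maps, extended by zero when there is no inclusion; this
   keeps inclusion proofs out of the terms. *)
Definition rs (M : modSheaf A) (U V : opens X) (m : M U) : M V :=
  if pselect (V `<=` U) is left VU then mres VU m else 0.

Definition ra (U V : opens X) (a : A U) : A V :=
  if pselect (V `<=` U) is left VU then ares VU a else 0.

Arguments rs {M U} V m.
Arguments ra {U} V a.

Lemma raE (U V : opens X) (VU : V `<=` U) (a : A U) : ares VU a = ra V a.
Proof.
by rewrite /ra; case: pselect => // VU'; rewrite (Prop_irrelevance VU VU').
Qed.

Fact ra_zmod (U V : opens X) : zmod_morphism (@ra U V).
Proof.
by move=> a b; rewrite /ra; case: pselect => [VU|_]; rewrite ?rmorphB ?subr0.
Qed.
HB.instance Definition _ (U V : opens X) :=
  GRing.isZmodMorphism.Build _ _ (@ra U V) (@ra_zmod U V).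

Lemma raM (U V : opens X) : {morph @ra U V : a b / a * b}.
Proof.
by move=> a b; rewrite /ra; case: pselect => [VU|_]; rewrite ?rmorphM ?mulr0.
Qed.

Lemma ra1 (U V : opens X) : V `<=` U -> @ra U V 1 = 1.
Proof. by move=> VU; rewrite -(raE VU) rmorph1. Qed.

Lemma raXn (U V : opens X) (a : A U) n :
  V `<=` U -> ra V (a ^+ n) = ra V a ^+ n.
Proof. by move=> VU; rewrite -!(raE VU) rmorphXn. Qed.

Lemma ra_scal (U V : opens X) c : V `<=` U -> ra V (scal A U c) = scal A V c.
Proof. by move=> VU; rewrite -(raE VU) ares_scal. Qed.

Lemma ra_id (U : opens X) (a : A U) : ra U a = a.
Proof. by rewrite -(raE (@subset_refl _ U)) ares_id. Qed.

Lemma ra_ra (U V W : opens X) (a : A U) :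
  W `<=` V -> V `<=` U -> ra W (ra V a) = ra W a.
Proof.
by move=> WV VU; rewrite -(raE WV) -(raE VU) (ares_comp _ _ (subset_trans WV VU)) raE.
Qed.

Section Module.
Variable M : modSheaf A.

Lemma rsE (U V : opens X) (VU : V `<=` U) (m : M U) : mres VU m = rs V m.
Proof.
by rewrite /rs; case: pselect => // VU'; rewrite (Prop_irrelevance VU VU').
Qed.

Fact rs_zmod (U V : opens X) : zmod_morphism (@rs M U V).
Proof.
by move=> a b; rewrite /rs; case: pselect => [VU|_]; rewrite ?raddfB ?subr0.
Qed.
HB.instance Definition _ (U V : opens X) :=
  GRing.isZmodMorphism.Build _ _ (@rs M U V) (@rs_zmod U V).

Lemma rsZ (U V : opens X) (a : A U) (m : M U) : rs V (a *: m) = ra V a *: rs V m.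
Proof.
by rewrite /rs /ra; case: pselect => [VU|_]; rewrite ?mresZ ?scaler0.
Qed.

Lemma rs_id (U : opens X) (m : M U) : rs U m = m.
Proof. by rewrite -(rsE (@subset_refl _ U)) mres_id. Qed.

Lemma rs_rs (U V W : opens X) (m : M U) :
  W `<=` V -> V `<=` U -> rs W (rs V m) = rs W m.
Proof.
by move=> WV VU; rewrite -(rsE WV) -(rsE VU) (mres_comp _ _ (subset_trans WV VU)) rsE.
Qed.

Lemma glue (U : opens X) (I : Type) (W : I -> opens X) (s : forall i, M (W i)) :
  (forall i, W i `<=` U) -> U `<=` \bigcup_i W i ->
  (forall i j, rs (oI (W i) (W j)) (s i) = rs (oI (W i) (W j)) (s j)) ->
  exists t : M U, forall i, rs (W i) t = s i.
Proof.
move=> WU cov comp.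
case: (modSheaf_glue WU (s := s) cov) => [i j V Vi Vj|t [tE _]].
  have VI := oIS Vi Vj.
  by rewrite !rsE -(rs_rs _ VI (@oIl _ _ _)) comp (rs_rs _ VI (@oIr _ _ _)).
by exists t => i; rewrite -tE rsE.
Qed.

(** This is the uniqueness half of gluing, applied to the family of all opens on which [t] and [t']
    have the same restriction. *)
Lemma sep (U : opens X) (t t' : M U) :
  (forall x, oset U x -> exists V : opens X,
     [/\ V `<=` U, oset V x & rs V t = rs V t']) -> t = t'.
Proof.
move=> h; pose I := {V : opens X | V `<=` U /\ rs V t = rs V t'}.
pose W (i : I) := projT1 i.
have WU i : W i `<=` U by case: (projT2 i).
case: (modSheaf_glue WU (s := fun i => rs (W i) t)) => [x Ux|i j V Vi Vj|t0 [_ u]].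
- have [V [VU Vx e]] := h x Ux.
  by exists (exist _ V (conj VU e)).
- by rewrite !rsE !rs_rs.
- rewrite -(u t); last by move=> i; rewrite rsE.
  by apply: u => i; rewrite rsE; case: (projT2 i).
Qed.

Lemma glue2 (U V W : opens X) (s : M V) (t : M W) :
  V `<=` U -> W `<=` U -> (forall x, oset U x -> oset V x \/ oset W x) ->
  rs (oI V W) s = rs (oI V W) t ->
  exists m : M U, rs V m = s /\ rs W m = t.
Proof.
move=> VU WU cov e.
pose Z (b : bool) := if b then V else W.
pose z (b : bool) : M (Z b) := if b return M (Z b) then s else t.
have [|||m mE] := @glue U bool Z z; last by exists m; split; [exact: (mE true)|exact: (mE false)].
- by case.
- by move=> x /cov[]; [exists true|exists false].
- case; case => //=.
  by have -> : oI W V = oI V W by exact: opens_eq.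
Qed.

Lemma sep2 (U V W : opens X) (s t : M U) :
  V `<=` U -> W `<=` U -> (forall x, oset U x -> oset V x \/ oset W x) ->
  rs V s = rs V t -> rs W s = rs W t -> s = t.
Proof.
move=> VU WU cov eV eW; apply: sep => x /cov[] h; [by exists V|by exists W].
Qed.

Lemma sep_empty (U : opens X) (s t : M U) : U `<=` set0 -> s = t.
Proof. by move=> U0; apply: sep => x /U0. Qed.

End Module.

Lemma ra_rs (U V : opens X) (a : A U) : ra V a = rs (M := regMod A) V a.
Proof. by []. Qed.

Lemma glue2_alg (U V W : opens X) (s : A V) (t : A W) :
  V `<=` U -> W `<=` U -> (forall x, oset U x -> oset V x \/ oset W x) ->
  ra (oI V W) s = ra (oI V W) t ->
  exists m : A U, ra V m = s /\ ra W m = t.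
Proof. exact: (@glue2 (regMod A)). Qed.

Lemma glue_alg (U : opens X) (I : Type) (W : I -> opens X) (s : forall i, A (W i)) :
  (forall i, W i `<=` U) -> U `<=` \bigcup_i W i ->
  (forall i j, ra (oI (W i) (W j)) (s i) = ra (oI (W i) (W j)) (s j)) ->
  exists t : A U, forall i, ra (W i) t = s i.
Proof. exact: (@glue (regMod A)). Qed.

Lemma sep_alg (U : opens X) (t t' : A U) :
  (forall x, oset U x -> exists V : opens X,
     [/\ V `<=` U, oset V x & ra V t = ra V t']) -> t = t'.
Proof. exact: (@sep (regMod A)). Qed.

Lemma sep_empty_alg (U : opens X) (s t : A U) : U `<=` set0 -> s = t.
Proof. exact: (@sep_empty (regMod A)). Qed.

Section Generator.
Variable M : modSheaf A.

(** Coordinates with respect to [e] are easier to glue and compare than inverse maps; choice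
    recovers the inverse. *)
Lemma genP (U : opens X) (e : M U) : free_generator e <->
  forall V : opens X, V `<=` U -> forall m : M V, exists! a : A V, m = a *: rs V e.
Proof.
split=> [g V VU m|h V VU].
  have [f fK Kf] := g V VU; exists (f m); split; first by rewrite -rsE Kf.
  by move=> a ->; rewrite -rsE fK.
pose f m := projT1 (cid (h V VU m)).
have fP m : m = f m *: rs V e by rewrite /f; case: cid => a [].
exists f => [a|m]; last by rewrite rsE -fP.
have [b [_ u]] := h V VU (a *: mres VU e).
by rewrite -[RHS]u ?rsE // -(u (f _)) ?rsE.
Qed.

Lemma gen_rs (U V : opens X) (e : M U) :
  V `<=` U -> free_generator e -> free_generator (rs V e).
Proof.
move=> VU /genP h; apply/genP => W WV m; rewrite rs_rs //.
by apply: h; exact: subset_trans VU.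
Qed.

Lemma gen_ex (U V : opens X) (e : M U) (m : M V) :
  free_generator e -> V `<=` U -> exists a : A V, m = a *: rs V e.
Proof. by move=> /genP h VU; have [a []] := h V VU m; exists a. Qed.

Lemma gen_inj (U V : opens X) (e : M U) (a b : A V) :
  free_generator e -> V `<=` U -> a *: rs V e = b *: rs V e -> a = b.
Proof.
move=> /genP h VU E; have [c [_ u]] := h V VU (a *: rs V e).
by rewrite -(u a) // -(u b).
Qed.

Lemma gen_eq0 (U V : opens X) (e : M U) (a : A V) :
  free_generator e -> V `<=` U -> a *: rs V e = 0 -> a = 0.
Proof. by move=> g VU e0; apply: (gen_inj g VU); rewrite scale0r. Qed.

Lemma gen_unit (U : opens X) (e : M U) (a b : A U) :
  a * b = 1 -> free_generator e -> free_generator (a *: e).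
Proof.
move=> ab1 g; apply/genP => V VU m; rewrite rsZ.
have ab : ra V a * ra V b = 1 by rewrite -raM ab1 ra1.
have [c cE] := gen_ex m g VU.
exists (c * ra V b); split; first by rewrite scalerA -mulrA (mulrC _ (ra V a)) ab mulr1.
move=> d; rewrite cE scalerA => /(gen_inj g VU) ->.
by rewrite -mulrA ab mulr1.
Qed.

(** Coordinates with respect to a generator are unique, so the local coordinates of [m] agree on
    overlaps and glue. *)
Lemma gen_local (U : opens X) (e : M U) :
  (forall x, oset U x -> exists V : opens X,
     [/\ V `<=` U, oset V x & free_generator (rs V e)]) -> free_generator e.
Proof.
move=> h; apply/genP => V VU m.
pose I := {W : opens X | W `<=` V /\ free_generator (rs W e)}.
pose W (i : I) := projT1 i.
have WV i : W i `<=` V by case: (projT2 i).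
have WU i : W i `<=` U by exact: subset_trans VU.
have Wg i : free_generator (rs (W i) e) by case: (projT2 i).
have cov : V `<=` \bigcup_i W i.
  move=> x Vx; have [Z [ZU Zx gZ]] := h x (VU x Vx).
  have ZV : oI Z V `<=` V by exact: oIr.
  have gZV : free_generator (rs (oI Z V) e).
    by rewrite -(rs_rs _ (@oIl _ Z V) ZU); exact: gen_rs gZ.
  by exists (exist _ (oI Z V) (conj ZV gZV)).
have ex i : {a : A (W i) | rs (W i) m = a *: rs (W i) e}.
  by apply: cid; have := gen_ex (rs (W i) m) (Wg i) (@subset_refl _ _); rewrite rs_id.
have uniq (a b : A V) : a *: rs V e = b *: rs V e -> a = b.
  move=> E; apply: sep_alg => x /cov [i _ Wx]; exists (W i); split=> //.
  apply: (gen_inj (Wg i) (@subset_refl _ _)).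
  by have := congr1 (rs (W i)) E; rewrite !rsZ !rs_rs // rs_id.
have [||i j|a aE] := @glue_alg V I W (fun i => projT1 (ex i)); [exact: WV|exact: cov| |].
  set Z := oI _ _.
  have Zi : Z `<=` W i by exact: oIl.
  have Zj : Z `<=` W j by exact: oIr.
  apply: (gen_inj (Wg i) Zi).
  have := projT2 (ex i); have := projT2 (ex j); move=> /(congr1 (rs Z)) + /(congr1 (rs Z)).
  rewrite !rsZ !rs_rs //; first by move=> <- <-.
have aE' : m = a *: rs V e.
  apply: sep => x /cov [i _ Wx]; exists (W i); split=> //.
  by rewrite rsZ rs_rs // aE; exact: (projT2 (ex i)).
by exists a; split=> // b; rewrite {1}aE'; exact: uniq.
Qed.

End Generator.
End Restriction.

Arguments rs {k X A M U} V m.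
Arguments ra {k X A U} V a.

(** * Charts of the projective line *)

Section Evaluation.
Variables (k : fieldType) (n : nat).

(** Extending by zero off [U] makes sections over different opens functions on one type, so that
    restriction needs no transport between subtypes. *)
Definition ev (U : set (P1 k)) (s : O_sec U n) (x : P1 k) : k :=
  if pselect (U x) is left Ux then s (SigSub (mem_set Ux)) else 0.

Lemma evE (U : set (P1 k)) (s : O_sec U n) (x : set_type U) : ev s (val x) = s x.
Proof.
rewrite /ev; case: pselect => [Ux|]; last by case; exact: set_valP.
by congr (s _); exact: val_inj.
Qed.

Lemma ev_ext (U : set (P1 k)) (s t : O_sec U n) :
  (forall x, U x -> ev s x = ev t x) -> s = t.
Proof. by move=> h; apply: O_sec_eq => x; rewrite -!evE h //; exact: set_valP. Qed.

Fact ev_zmod (U : set (P1 k)) x : zmod_morphism (fun s : O_sec U n => ev s x).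
Proof. by move=> s t; rewrite /ev; case: pselect => // _; rewrite subr0. Qed.

Lemma evD (U : set (P1 k)) (s t : O_sec U n) x : ev (s + t) x = ev s x + ev t x.
Proof. by rewrite /ev; case: pselect => // _; rewrite addr0. Qed.

Lemma evB (U : set (P1 k)) (s t : O_sec U n) x : ev (s - t) x = ev s x - ev t x.
Proof. exact: ev_zmod. Qed.

Lemma ev0 (U : set (P1 k)) x : ev (0 : O_sec U n) x = 0.
Proof. by rewrite /ev; case: pselect. Qed.

Lemma evZ (U : set (P1 k)) (a : O_sec U 0) (s : O_sec U n) x :
  ev (a *: s) x = (if pselect (U x) is left Ux then a (SigSub (mem_set Ux)) else 0) * ev s x.
Proof. by rewrite /ev; case: pselect => // _; rewrite mulr0. Qed.

Lemma ev_O_res (U V : set (P1 k)) (VU : V `<=` U) (s : O_sec U n) x :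
  V x -> ev (O_res VU s) x = ev s x.
Proof.
move=> Vx; rewrite /ev; case: pselect => // Vx'; case: pselect => [Ux|nUx].
  by congr (s _); exact: val_inj.
by case: nUx; exact: VU.
Qed.

End Evaluation.

Section Structure.
Variable k : fieldType.
Notation O := (O_P1 k).

Definition evO (U : opens (P1 k)) (b : O U) (x : P1 k) : k := @ev k 0 U b x.

Section Ring.
Variable U : opens (P1 k).

Lemma evO_ext (s t : O U) : (forall x, oset U x -> evO s x = evO t x) -> s = t.
Proof. exact: ev_ext. Qed.

Lemma evOD (s t : O U) x : evO (s + t) x = evO s x + evO t x.
Proof. exact: evD. Qed.

Lemma evOB (s t : O U) x : evO (s - t) x = evO s x - evO t x.
Proof. exact: evB. Qed.

Lemma evO0 x : evO (0 : O U) x = 0.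
Proof. exact: ev0. Qed.

Lemma evOM (s t : O U) x : evO (s * t) x = evO s x * evO t x.
Proof. by rewrite /evO /ev; case: pselect => // _; rewrite mul0r. Qed.

Lemma evO1 x : oset U x -> evO (1 : O U) x = 1.
Proof. by rewrite /evO /ev; case: pselect. Qed.

Lemma evO_scal c x : oset U x -> evO (scal O U c) x = c.
Proof. by rewrite /evO /ev; case: pselect. Qed.

Lemma evOX (s : O U) m x : oset U x -> evO (s ^+ m) x = evO s x ^+ m.
Proof.
by move=> Ux; elim: m => [|m IH]; rewrite ?expr0 ?evO1 // !exprS evOM IH.
Qed.

End Ring.

Lemma evO_ra (U V : opens (P1 k)) (s : O U) x :
  V `<=` U -> oset V x -> evO (ra V s) x = evO s x.
Proof. by move=> VU Vx; rewrite -(raE VU); exact: ev_O_res. Qed.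

Lemma evT_rs n (U V : opens (P1 k)) (s : twist k n U) x :
  V `<=` U -> oset V x -> @ev k n V (rs V s) x = @ev k n U s x.
Proof. by move=> VU Vx; rewrite -(rsE VU); exact: ev_O_res. Qed.

Lemma evTZ n (U : opens (P1 k)) (a : O U) (s : twist k n U) x :
  @ev k n U (a *: s) x = evO a x * @ev k n U s x.
Proof. exact: evZ. Qed.

End Structure.

(* An affine chart of P^1.  In the coordinate [a], the vector [hcoord (cpt a)]
   is [cu a] times the vector whose [d]-forms are the polynomials [crev d p]. *)
Record chart (k : fieldType) := Chart {
  cD : opens (P1 k);
  cpt : k -> P1 k;
  cpt_inj : injective cpt;
  cDE : forall x, oset cD x <-> exists a, x = cpt a;
  cu : k -> k;
  cu_neq0 : forall a, cu a != 0;
  crev : nat -> {poly k} -> {poly k};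
  crev_form : forall d p a,
    form d p (hcoord (cpt a)) = (crev d p).[a] * cu a ^+ d;
  crevK : forall d p, crev d (crev d p) = take_poly d.+1 p
}.

Section Charts.
Variable k : fieldType.

Lemma off0E (x : P1 k) : oset (off None) x <-> exists a, x = Some a.
Proof.
split; first by case: x => [a _|]; [exists a|case].
by case=> a ->.
Qed.

Fact chart0_form d p (a : k) :
  form d p (hcoord (Some a)) = (take_poly d.+1 p).[a] * 1 ^+ d.
Proof. by rewrite formE expr1n mulr1. Qed.

Fact cpt0_inj : injective (fun a : k => Some a : P1 k).
Proof. by move=> a b []. Qed.

Definition chart0 : chart k := Chart cpt0_inj off0E
  (fun=> oner_neq0 k) chart0_form
  (fun d p => take_poly_id (size_take_poly d.+1 p)).

Definition cpt1 (a : k) : P1 k := if a == 0 then None else Some a^-1.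

Fact cpt1_inj : injective cpt1.
Proof.
move=> a b; rewrite /cpt1; case: eqP => [->|_]; case: eqP => [->|_] //.
by move=> [] /invr_inj.
Qed.

Lemma off1E (x : P1 k) : oset (off (Some 0)) x <-> exists a, x = cpt1 a.
Proof.
split=> [|[a ->] e]; last first.
  have {}e : cpt1 a = Some 0 by [].
  move: e; rewrite /cpt1; case: eqP => // /eqP a0 [e].
  by move/negP: a0; apply; rewrite -invr_eq0 e.
case: x => [a|] h; last by exists 0; rewrite /cpt1 eqxx.
have a0 : a != 0 by apply/eqP => a0; apply: h; rewrite a0.
by exists a^-1; rewrite /cpt1 invr_eq0 (negbTE a0) invrK.
Qed.

(** The reciprocal polynomial in degree [d]: it dehomogenizes at x1 = 1 the form that [p]
    dehomogenizes at x0 = 1. *)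
Definition rev_form (d : nat) (p : {poly k}) : {poly k} :=
  \poly_(i < d.+1) p`_(d - i).

(** The factor by which [hcoord (cpt1 a)] differs from the vector (a, 1); at a = 0 both are (0,
    1). *)
Definition cu1 (a : k) : k := if a == 0 then 1 else a^-1.

Fact cu1_neq0 a : cu1 a != 0.
Proof.
by rewrite /cu1; case: ifPn => [_|a0]; rewrite ?oner_neq0 ?invr_neq0.
Qed.

Fact rev_form_form d p a :
  form d p (hcoord (cpt1 a)) = (rev_form d p).[a] * cu1 a ^+ d.
Proof.
rewrite formE /cpt1 /cu1; case: eqP => [->|/eqP a0].
  by rewrite expr1n mulr1 horner_coef0 coef_poly subn0.
rewrite (horner_coef_wide _ (size_take_poly _ _)) horner_poly mulr_suml.
rewrite (reindex_inj rev_ord_inj) /=; apply: eq_bigr => i _.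
have id : (i <= d)%N by rewrite -ltnS.
rewrite coef_take_poly subSS ltnS leq_subr -mulrA; congr (_ * _).
have -> : a^-1 ^+ d = a^-1 ^+ i * a^-1 ^+ (d - i) by rewrite -exprD subnKC.
by rewrite mulrA -exprMn divff // expr1n mul1r.
Qed.

Fact rev_formK d p : rev_form d (rev_form d p) = take_poly d.+1 p.
Proof.
apply/polyP => i; rewrite !coef_poly !ltnS; case: ifP => // id.
by rewrite leq_subr subKn.
Qed.

Definition chart1 : chart k :=
  Chart cpt1_inj off1E cu1_neq0 rev_form_form rev_formK.

Lemma cover_charts (x : P1 k) : oset (cD chart0) x \/ oset (cD chart1) x.
Proof. by case: x => [a|]; [left|right]. Qed.

End Charts.

Section Cofinite.
Variables (k : closedFieldType).
Implicit Types (chi : chart k) (U V W : opens (P1 k)).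

(** A nonempty open set misses finitely many points; [p] is the product of the linear factors at
    those in the chart. *)
Lemma cofinite_chart chi U : oset U !=set0 ->
  exists2 p : {poly k}, p != 0 & forall a, p.[a] != 0 -> oset U (cpt chi a).
Proof.
move=> [x Ux]; case: (osetP U) => [U0|fU]; first by rewrite U0 in Ux.
have /finite_seqP[r rE] : finite_set (cpt chi @^-1` (~` U)).
  by apply: finite_preimage fU => a b _ _; exact: cpt_inj.
exists (\prod_(z <- r) ('X - z%:P)).
  by rewrite monic_neq0 // monic_prod_XsubC.
move=> a; rewrite -rootE root_prod_XsubC => ra; apply: contrapT => nU.
have : (cpt chi @^-1` (~` U)) a by [].
by rewrite rE /= => /negPn; rewrite ra.
Qed.

Lemma poly_open_eq0 chi U (p : {poly k}) : oset U !=set0 ->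
  (forall a, oset U (cpt chi a) -> p.[a] = 0) -> p = 0.
Proof.
move=> /(cofinite_chart chi)[q q0 qU] p0; apply/eqP; case: eqVneq => // pn0.
have /closed_nonrootP[x] : p * q != 0 by rewrite mulf_neq0.
rewrite rootE hornerM mulf_eq0 negb_or => /andP[px /qU /p0 e].
by rewrite e eqxx in px.
Qed.

Lemma poly_open_eq chi U (p q : {poly k}) : oset U !=set0 ->
  (forall a, oset U (cpt chi a) -> p.[a] = q.[a]) -> p = q.
Proof.
move=> U0 pq; apply/eqP; rewrite -subr_eq0; apply/eqP.
by apply: (@poly_open_eq0 chi U) => // a Ua; rewrite hornerD hornerN pq // subrr.
Qed.

(** Irreducibility of P^1: a nonzero product of polynomials has a point where it does not vanish. *)
Lemma meet_opens U V : oset U !=set0 -> oset V !=set0 -> oset (oI U V) !=set0.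
Proof.
move=> /(cofinite_chart (chart0 k))[p p0 pU].
move=> /(cofinite_chart (chart0 k))[q q0 qV].
have /closed_nonrootP[x] : p * q != 0 by rewrite mulf_neq0.
rewrite rootE hornerM mulf_eq0 negb_or => /andP[/pU ? /qV ?].
by exists (cpt (chart0 k) x).
Qed.

Lemma chart_neq0 chi : oset (cD chi) !=set0.
Proof. by exists (cpt chi 0); apply/cDE; exists 0. Qed.

Lemma cD_cpt chi a : oset (cD chi) (cpt chi a).
Proof. by apply/cDE; exists a. Qed.

Lemma local_frac n U (s : O_sec U n) chi a : oset U (cpt chi a) ->
  exists (V : opens (P1 k)) (F G : {poly k}), oset V (cpt chi a) /\
  forall b, oset U (cpt chi b) -> oset V (cpt chi b) ->
    G.[b] != 0 /\ ev s (cpt chi b) = F.[b] / G.[b] * cu chi b ^+ n.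
Proof.
move=> Ua; have [V [d [F [G [Va h]]]]] := O_regular s (SigSub (mem_set Ua)).
exists V, (crev chi (d + n) F), (crev chi d G); split=> // b Ub Vb.
have := h (SigSub (mem_set Ub)) Vb; rewrite /quotient_of_forms -evE /=.
rewrite !crev_form mulf_eq0 negb_or => -[/andP[G0 _] ->]; split=> //.
have cd := expf_neq0 d (cu_neq0 chi b).
by rewrite exprD; field; rewrite G0 cd.
Qed.

Lemma mk_section n U (f : P1 k -> k) :
  (forall x, oset U x -> exists chi a (V : opens (P1 k)) (F G : {poly k}),
    [/\ x = cpt chi a, oset V x & forall b, oset U (cpt chi b) ->
      oset V (cpt chi b) ->
      G.[b] != 0 /\ f (cpt chi b) = F.[b] / G.[b] * cu chi b ^+ n]) ->
  exists s : O_sec U n, forall x, oset U x -> ev s x = f x.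
Proof.
move=> h.
have rf : @regular k n U (fun x => f (val x)).
  move=> x; have [chi [a [V [F [G [xE Vx hV]]]]]] := h (val x) (set_valP x).
  (* A degree this large makes the truncations in [crevK] leave [F] and [G] unchanged. *)
  pose d := maxn (size F) (size G).
  exists (oI V (cD chi)), d, (crev chi (d + n) F), (crev chi d G).
  split; first by split=> //; rewrite xE; exact: cD_cpt.
  move=> y [Vy /cDE[b yE]]; have Uy := set_valP y.
  rewrite /quotient_of_forms.
  rewrite yE in Vy Uy *; have [G0 ->] := hV b Uy Vy.
  rewrite !crev_form !crevK !take_poly_id; last 2 first.
  - by apply: leqW; apply: leq_trans (leq_addr _ _); exact: leq_maxl.
  - by apply: leqW; exact: leq_maxr.
  have cd := expf_neq0 d (cu_neq0 chi b).
  rewrite mulf_neq0 //; split=> //; rewrite exprD.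
  by field; rewrite G0 cd.
by exists (OSec (asboolT rf)) => x Ux; rewrite /ev; case: pselect.
Qed.

(** A local fraction at one point, put in lowest terms F/G, serves everywhere. Any other local
    fraction F'/G' agrees with it on a nonempty open set, so F G' = F' G as polynomials; coprimality
    then forbids G to vanish where G' does not. *)
Lemma global_frac n U (s : O_sec U n) chi : U `<=` cD chi -> oset U !=set0 ->
  exists F G : {poly k}, coprimep F G /\
  forall b, oset U (cpt chi b) ->
    G.[b] != 0 /\ ev s (cpt chi b) = F.[b] / G.[b] * cu chi b ^+ n.
Proof.
move=> UD U0; have [x Ux] := U0; have /cDE[a xE] := UD x Ux; rewrite xE in Ux.
have [V [F [G [Va h]]]] := local_frac s Ux.
have [G0 _] := h _ Ux Va.
have Gn0 : G != 0 by apply: contraNneq G0 => ->; rewrite horner0.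
set g := gcdp F G; have gn0 : g != 0 by rewrite gcdp_eq0 negb_and Gn0 orbT.
have FE : F = (F %/ g) * g by rewrite divpK // dvdp_gcdl.
have GE : G = (G %/ g) * g by rewrite divpK // dvdp_gcdr.
exists (F %/ g), (G %/ g).
have cop : coprimep (F %/ g) (G %/ g) by rewrite coprimep_div_gcd // Gn0 orbT.
split=> // b Ub; have [W [F' [G' [Wb h']]]] := local_frac s Ub.
have e : F %/ g * G' = F' * (G %/ g).
  apply: (mulIf gn0); rewrite mulrAC -FE -mulrA -GE.
  apply: (@poly_open_eq chi (oI (oI U V) W)).
    apply: meet_opens; last by exists (cpt chi b).
    by apply: meet_opens => //; exists (cpt chi a).
  move=> c [[Uc Vc] Wc]; have [Gc sE] := h c Uc Vc; have [Gc' sE'] := h' c Uc Wc.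
  have := esym sE; rewrite sE' => /(mulIf (expf_neq0 n (cu_neq0 chi c))) /eqP.
  by rewrite eqr_div // !hornerM => /eqP.
have [Gb' ->] := h' b Ub Wb.
have eb := congr1 (fun p => p.[b]) e; rewrite /= !hornerM in eb.
have Gb : (G %/ g).[b] != 0.
  apply/negP => /eqP Gb0; move: eb; rewrite Gb0 mulr0 => /eqP.
  rewrite mulf_eq0 (negbTE Gb') orbF => Fb.
  by have := coprimep_root cop Fb; rewrite Gb0 eqxx.
split=> //; congr (_ * _); apply/eqP; rewrite eqr_div //; apply/eqP.
by rewrite eb.
Qed.

Lemma mk_frac chi U (F G : {poly k}) : U `<=` cD chi ->
  (forall b, oset U (cpt chi b) -> G.[b] != 0) ->
  exists s : O_P1 k U, forall b, oset U (cpt chi b) ->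
    evO s (cpt chi b) = F.[b] / G.[b].
Proof.
move=> UD G0.
have ex x : {a | oset U x -> x = cpt chi a}.
  apply: cid; case: (pselect (oset U x)) => [Ux|nUx]; last by exists 0.
  by have /cDE[a ->] := UD _ Ux; exists a.
pose f x := F.[projT1 (ex x)] / G.[projT1 (ex x)].
have fE b : oset U (cpt chi b) -> f (cpt chi b) = F.[b] / G.[b].
  by rewrite /f; case: (ex _) => c h Ub /=; rewrite -(cpt_inj (h Ub)).
have [x Ux|s sE] := @mk_section 0 U f; last first.
  by exists s => b Ub; rewrite /evO sE // fE.
have /cDE[a xE] := UD _ Ux.
exists chi, a, U, F, G; split=> // b Ub _; split; first exact: G0.
by rewrite fE // expr0 mulr1.
Qed.

(** Near any point of [U] the numerator of [s] vanishes on a nonempty open set, hence is the zero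
    polynomial. *)
Lemma section_open_eq0 n U V (s : O_sec U n) : V `<=` U -> oset V !=set0 ->
  (forall x, oset V x -> ev s x = 0) -> s = 0.
Proof.
move=> VU V0 h; apply: ev_ext => x Ux; rewrite ev0.
have [chi [a xE]] : exists chi a, x = cpt chi a.
  by case: (cover_charts x) => /cDE[a ->]; [exists (chart0 k), a|exists (chart1 k), a].
rewrite xE in Ux *; have [W [F [G [Wa hW]]]] := local_frac s Ux.
have [Ga ->] := hW _ Ux Wa.
suff -> : F = 0 by rewrite horner0 !mul0r.
apply: (@poly_open_eq0 chi (oI V W)); first by apply: meet_opens => //; exists (cpt chi a).
move=> b [Vb Wb]; have [Gb] := hW b (VU _ Vb) Wb.
rewrite h // => /esym /eqP; rewrite !mulf_eq0 invr_eq0 (negbTE Gb) orbF.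
by rewrite (negbTE (expf_neq0 n (cu_neq0 chi b))) orbF => /eqP.
Qed.

Lemma O_open_eq U V (s t : O_P1 k U) : V `<=` U -> oset V !=set0 ->
  ra V s = ra V t -> s = t.
Proof.
move=> VU V0 e; apply/eqP; rewrite -subr_eq0; apply/eqP.
apply: (@section_open_eq0 0 U V) => // x Vx.
have /(congr1 (fun s => evO s x)) : ra V (s - t) = 0 by rewrite raddfB /= e subrr.
by rewrite evO_ra // evO0.
Qed.

Lemma O_domain U (s t : O_P1 k U) : s * t = 0 -> s = 0 \/ t = 0.
Proof.
move=> st0; case: (pselect (oset U !=set0)) => [U0|nU]; last first.
  by left; apply: evO_ext => x Ux; case: nU; exists x.
pose V := oI U (cD (chart0 k)).
have VU : V `<=` U by exact: oIl.
have V0 : oset V !=set0 by apply: meet_opens => //; exact: chart_neq0.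
have [F [G [_ h]]] := @global_frac 0 V (ra V s) (chart0 k) (@oIr _ _ _) V0.
have [F' [G' [_ h']]] := @global_frac 0 V (ra V t) (chart0 k) (@oIr _ _ _) V0.
have /eqP : F * F' = 0.
  apply: (@poly_open_eq0 (chart0 k) V) => // a Va; rewrite hornerM.
  have [Ga e] := h a Va; have [Ga' e'] := h' a Va.
  have Fa : F.[a] = evO s (cpt (chart0 k) a) * G.[a].
    by rewrite -(evO_ra s VU Va) /evO e expr0 mulr1 divfK.
  have Fa' : F'.[a] = evO t (cpt (chart0 k) a) * G'.[a].
    by rewrite -(evO_ra t VU Va) /evO e' expr0 mulr1 divfK.
  by rewrite Fa Fa' mulrACA -evOM st0 evO0 mul0r.
rewrite mulf_eq0 => /orP[] /eqP p0; [left|right];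
  apply: (@section_open_eq0 0 U V) => // x Vx;
  (have /cDE[a xE] : oset (cD (chart0 k)) x by case: Vx); rewrite xE in Vx *.
- have [_ ] := h a Vx; rewrite -/(evO _ _) evO_ra // => e.
  by rewrite -/(evO _ _) e p0 horner0 !mul0r.
- have [_ ] := h' a Vx; rewrite -/(evO _ _) evO_ra // => e.
  by rewrite -/(evO _ _) e p0 horner0 !mul0r.
Qed.

End Cofinite.

(** * Triviality of line bundles on a chart *)

Section PolyEval.
Variables (k : fieldType) (R : comPzRingType) (f : {rmorphism k -> R}).

(* [R] may be the zero ring, over which there are no polynomials, so the
   Horner evaluation of the library does not apply. *)
Definition pev (T : R) (P : {poly k}) : R := \sum_(i < size P) f P`_i * T ^+ i.

Variable T : R.

Lemma pev_wide n (P : {poly k}) : (size P <= n)%N ->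
  pev T P = \sum_(i < n) f P`_i * T ^+ i.
Proof.
move=> Pn; rewrite /pev (big_ord_widen n (fun i => f P`_i * T ^+ i) Pn).
rewrite big_mkcond; apply: eq_bigr => i _; case: ltnP => // iP.
by rewrite nth_default // rmorph0 mul0r.
Qed.

Fact pev_zmod : zmod_morphism (pev T).
Proof.
move=> P Q; pose n := maxn (size P) (size Q).
have PQn : (size (P - Q)%R <= n)%N by rewrite (leq_trans (size_polyD _ _)) ?size_polyN.
rewrite (pev_wide PQn) (pev_wide (leq_maxl _ _ : (size P <= n)%N)).
rewrite (pev_wide (leq_maxr _ _ : (size Q <= n)%N)) -sumrB.
by apply: eq_bigr => i _; rewrite coefB rmorphB mulrBl.
Qed.
HB.instance Definition _ := GRing.isZmodMorphism.Build _ _ (pev T) pev_zmod.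

Lemma pevC c : pev T c%:P = f c.
Proof.
by rewrite (pev_wide (size_polyC_leq1 c)) big_ord1 coefC mulr1.
Qed.

Lemma pev1 : pev T 1 = 1.
Proof. by rewrite -[1]/(1%:P) pevC rmorph1. Qed.

Lemma pevMX P : pev T (P * 'X) = pev T P * T.
Proof.
have := size_polyMleq P 'X; rewrite size_polyX addn2 /= => h.
rewrite (pev_wide h) big_ord_recl coefMX /= rmorph0 mul0r add0r /pev mulr_suml.
by apply: eq_bigr => i _; rewrite coefMX /= -mulrA exprSr.
Qed.

Lemma pevCM c P : pev T (c%:P * P) = f c * pev T P.
Proof.
have h : (size (c%:P * P)%R <= size P)%N by rewrite mul_polyC size_scale_leq.
rewrite (pev_wide h) /pev mulr_sumr; apply: eq_bigr => i _.
by rewrite coefCM rmorphM mulrA.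
Qed.

Fact pev_monoid : monoid_morphism (pev T).
Proof.
split=> [|P Q]; first exact: pev1.
elim/poly_ind: P => [|P c IH]; first by rewrite mul0r raddf0 mul0r.
rewrite mulrDl !raddfD /= pevMX pevCM pevC mulrDl mulrAC pevMX IH.
by rewrite mulrAC.
Qed.
HB.instance Definition _ := GRing.isMonoidMorphism.Build _ _ (pev T) pev_monoid.

Lemma pevX : pev T 'X = T.
Proof. by rewrite -['X]mul1r pevMX pev1 mul1r. Qed.

End PolyEval.

Lemma rmorph_pev (k : fieldType) (R S : comPzRingType) (f : {rmorphism k -> R})
    (f' : {rmorphism k -> S}) (g : {rmorphism R -> S}) :
  (forall c, g (f c) = f' c) -> forall T P, g (pev f T P) = pev f' (g T) P.
Proof.
move=> gf T P; rewrite /pev rmorph_sum; apply: eq_bigr => i _.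
by rewrite rmorphM rmorphXn /= gf.
Qed.

Section SheafPolyEval.
Variables (k : fieldType) (X : topologicalType) (A : algSheaf k X).

Definition spev (U : opens X) (T : A U) : {poly k} -> A U := pev (scal A U) T.

HB.instance Definition _ U (T : A U) := GRing.RMorphism.on (spev T).

Lemma ra_pev (U V : opens X) (T : A U) P : V `<=` U ->
  ra V (spev T P) = spev (ra V T) P.
Proof.
by move=> VU; rewrite -!(raE VU); apply: rmorph_pev => c; exact: ares_scal.
Qed.

Lemma spevX (U : opens X) (T : A U) : spev T 'X = T.
Proof. exact: pevX. Qed.

Lemma spevC (U : opens X) (T : A U) c : spev T c%:P = scal A U c.
Proof. exact: pevC. Qed.

End SheafPolyEval.

(** * Extension across the missing points of a chart *)

Section Extension.
Variable (k : closedFieldType).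
Implicit Types (chi : chart k) (U V W : opens (P1 k)).

Definition oU U V : opens (P1 k) := Opens (openU (osetP U) (osetP V)).

Lemma chart_coord chi : exists z : O_P1 k (cD chi), forall a, evO z (cpt chi a) = a.
Proof.
have [b _|z zE] := @mk_frac k chi (cD chi) 'X 1 (@subset_refl _ _).
  by rewrite hornerC oner_neq0.
by exists z => a; rewrite zE ?hornerX ?hornerC ?divr1 //; exact: cD_cpt.
Qed.

Definition zc chi : O_P1 k (cD chi) := projT1 (cid (chart_coord chi)).

Lemma zcE chi a : evO (zc chi) (cpt chi a) = a.
Proof. by rewrite /zc; case: cid. Qed.

Lemma evO_spev chi U (P : {poly k}) a : U `<=` cD chi -> oset U (cpt chi a) ->
  evO (spev (ra U (zc chi)) P) (cpt chi a) = P.[a].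
Proof.
move=> UD Ua; elim/poly_ind: P => [|P c IH]; first by rewrite raddf0 evO0 horner0.
rewrite hornerMXaddC rmorphD rmorphM /= evOD evOM IH spevX spevC evO_scal //.
by rewrite evO_ra // zcE.
Qed.

Lemma chart_ext chi U (s t : O_P1 k U) : U `<=` cD chi ->
  (forall a, oset U (cpt chi a) -> evO s (cpt chi a) = evO t (cpt chi a)) -> s = t.
Proof.
by move=> UD h; apply: evO_ext => x Ux; have /cDE[a xE] := UD _ Ux; rewrite xE in Ux *; exact: h.
Qed.

Lemma open_add V (x : P1 k) : oset V !=set0 ->
  exists W : opens (P1 k), oset W = oset V `|` [set x].
Proof.
move=> [y Vy]; have ow : open (oset V `|` [set x]).
  right; case: (osetP V) => [V0|fV]; first by rewrite V0 in Vy.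
  by apply: sub_finite_set fV => z h Vz; apply: h; left.
by exists (Opens ow).
Qed.

(** Only finitely many points of the chart lie outside a nonempty open set, so induction on a list
    of them reaches the whole chart. *)
Lemma extend_chart chi (Q : opens (P1 k) -> Prop) :
  (exists V, [/\ V `<=` cD chi, oset V !=set0 & Q V]) ->
  (forall V x, V `<=` cD chi -> oset V !=set0 -> Q V -> oset (cD chi) x ->
     ~ oset V x -> exists V', [/\ V `<=` V', V' `<=` cD chi, oset V' x & Q V']) ->
  Q (cD chi).
Proof.
move=> [V [VD V0 QV]] step.
have [r rE] : exists r : seq (P1 k), forall x, oset (cD chi) x -> oset V x \/ x \in r.
  case: (osetP V) => [Ve|/finite_seqP[r rE]]; first by case: V0 => y; rewrite Ve.
  exists r => x Dx; case: (pselect (oset V x)) => [|nV]; first by left.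
  by right; have : (~` oset V) x by []; rewrite rE.
elim: r V VD V0 QV rE => [|x r IH] V VD V0 QV rE.
  have -> : cD chi = V by apply: opens_eq => // y /rE[].
  by [].
case: (pselect (oset (cD chi) x)) => [Dx|nDx]; last first.
  apply: (IH V) => // y Dy; have [|] := rE y Dy; first by left.
  by rewrite inE => /orP[/eqP yx|]; [rewrite yx in Dy|right].
case: (pselect (oset V x)) => [Vx|nVx].
  apply: (IH V) => // y Dy; have [|] := rE y Dy; first by left.
  by rewrite inE => /orP[/eqP ->|]; [left|right].
have [V' [VV' V'D V'x QV']] := step V x VD V0 QV Dx nVx.
apply: (IH V') => //.
  by case: V0 => y Vy; exists y; exact: VV'.
move=> y Dy; have [Vy|] := rE y Dy; first by left; exact: VV'.
by rewrite inE => /orP[/eqP ->|]; [left|right].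
Qed.

(* [W] is a neighbourhood of the point [c], and [W] minus this point is
   [oI V W]. *)
Definition one_point chi V W (c : k) : Prop :=
  [/\ V `<=` cD chi, W `<=` cD chi, oset V !=set0, ~ oset V (cpt chi c) &
      oset W (cpt chi c) /\ forall a, oset W (cpt chi a) -> oset V (cpt chi a) \/ a = c].

Lemma one_point_ex chi V W0 c : V `<=` cD chi -> oset V !=set0 ->
  ~ oset V (cpt chi c) -> oset W0 (cpt chi c) ->
  exists2 W : opens (P1 k), W `<=` W0 & one_point chi V W c.
Proof.
move=> VD V0 nV W0c; have [V' V'E] := open_add (cpt chi c) V0.
exists (oI (oI W0 (cD chi)) V') => //; split=> //.
split; first by split; [split=> //; exact: cD_cpt|rewrite V'E; right].
move=> a [_]; rewrite V'E => -[|e]; first by left.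
by right; apply: (@cpt_inj _ chi); exact: e.
Qed.

Lemma one_point_meet chi V W c : one_point chi V W c -> oset (oI V W) !=set0.
Proof. by case=> _ _ V0 _ [Wc _]; apply: meet_opens => //; exists (cpt chi c). Qed.

Lemma horner_nonroot_split (G : {poly k}) c : G != 0 ->
  exists N (G' : {poly k}), G = G' * ('X - c%:P) ^+ N /\ G'.[c] != 0.
Proof.
move=> G0; have [N [G' h ->]] := multiplicity_XsubC G c.
by exists N, G'; split=> //; move: h; rewrite G0.
Qed.

(** Partial fractions at [c]. The denominator is (X - c)^N G' with G' nonzero at c; a Bezout
    relation u (X - c)^N + v G' = 1 gives F v / (X - c)^N, regular away from c, and F u / G',
    regular on [W]. *)
Lemma frac_split chi V W c (f : O_P1 k (oI V W)) : one_point chi V W c ->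
  exists (f1 : O_P1 k V) (f2 : O_P1 k W), f = ra (oI V W) f1 + ra (oI V W) f2.
Proof.
move=> opt; have [VD WD V0 nVc [Wc WV]] := opt.
have ZD : oI V W `<=` cD chi by [].
have Z0 := one_point_meet opt.
have [F [G [cop h]]] := @global_frac k 0 (oI V W) f chi ZD Z0.
have Gn0 : G != 0.
  by apply/eqP => G0; case: Z0 => x Zx; have /cDE[a xE] := ZD _ Zx;
    rewrite xE in Zx; have [] := h a Zx; rewrite G0 horner0 eqxx.
have [N [G' [GE Gc]]] := horner_nonroot_split c Gn0.
have /Bezout_eq1_coprimepP[[u v] /= uv] : coprimep (('X - c%:P) ^+ N) G'.
  by apply: coprimep_expl; rewrite coprimep_sym coprimep_XsubC rootE.
have [b Vb|f1 f1E] := @mk_frac k chi V (F * v) (('X - c%:P) ^+ N) VD.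
  rewrite horner_exp hornerXsubC expf_neq0 // subr_eq0.
  by apply/eqP => bc; rewrite bc in Vb.
have Wb0 b : oset W (cpt chi b) -> G'.[b] != 0.
  move=> Wb; have [Vb|->//] := WV b Wb.
  by have [+ _] := h b (conj Vb Wb); rewrite GE hornerM mulf_eq0 negb_or => /andP[].
have [//|f2 f2E] := @mk_frac k chi W (F * u) G' WD.
exists f1, f2; apply: (chart_ext ZD) => a [Va Wa].
have [Ga] := h a (conj Va Wa); rewrite -/(evO _ _) => ->.
rewrite evOD !evO_ra // f1E // f2E // expr0 mulr1.
move: Ga; rewrite GE !hornerM mulf_eq0 negb_or => /andP[Ga1 Ga2].
have := congr1 (fun p => p.[a]) uv; rewrite /= hornerD !hornerM hornerC => uva.
by rewrite -[LHS]mulr1 -uva; field; rewrite Ga1 Ga2.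
Qed.

(** The multiplicative analogue: all powers of X - c in numerator and denominator go to the factor
    on [V], and what remains is a unit on [W]. *)
Lemma unit_split_O chi V W c (f g : O_P1 k (oI V W)) : one_point chi V W c ->
  f * g = 1 ->
  exists (f1 g1 : O_P1 k V) (f2 g2 : O_P1 k W),
    [/\ f1 * g1 = 1, f2 * g2 = 1 & f = ra (oI V W) f1 * ra (oI V W) f2].
Proof.
move=> opt fg; have [VD WD V0 nVc [Wc WV]] := opt.
have ZD : oI V W `<=` cD chi by [].
have Z0 := one_point_meet opt.
have [F [G [cop h]]] := @global_frac k 0 (oI V W) f chi ZD Z0.
have Fb b : oset (oI V W) (cpt chi b) -> F.[b] != 0.
  move=> Zb; have [_ e] := h b Zb; apply/eqP => F0.
  have := congr1 (fun s => evO s (cpt chi b)) fg.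
  rewrite /= evOM {1}/evO e F0 !mul0r evO1 // => /eqP.
  by rewrite eq_sym oner_eq0.
have ex0 (P : {poly k}) : (forall b, oset (oI V W) (cpt chi b) -> P.[b] != 0) -> P != 0.
  move=> hP; apply/eqP => P0; case: Z0 => x Zx; have /cDE[a xE] := ZD _ Zx.
  by rewrite xE in Zx; have := hP a Zx; rewrite P0 horner0 eqxx.
have Gn0 : G != 0 by apply: ex0 => b /h[].
have [N [G' [GE Gc]]] := horner_nonroot_split c Gn0.
have [M [F' [FE Fc]]] := horner_nonroot_split c (ex0 _ Fb).
have Xb K b : oset V (cpt chi b) -> (('X - c%:P) ^+ K).[b] != 0.
  move=> Vb; rewrite horner_exp hornerXsubC expf_neq0 // subr_eq0.
  by apply/eqP => bc; rewrite bc in Vb.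
have G'b b : oset W (cpt chi b) -> G'.[b] != 0.
  move=> Wb; have [Vb|->//] := WV b Wb.
  by have [+ _] := h b (conj Vb Wb); rewrite GE hornerM mulf_eq0 negb_or => /andP[].
have F'b b : oset W (cpt chi b) -> F'.[b] != 0.
  move=> Wb; have [Vb|->//] := WV b Wb.
  by have := Fb b (conj Vb Wb); rewrite FE hornerM mulf_eq0 negb_or => /andP[].
have [f1 f1E] := @mk_frac k chi V (('X - c%:P) ^+ M) (('X - c%:P) ^+ N) VD (Xb N).
have [g1 g1E] := @mk_frac k chi V (('X - c%:P) ^+ N) (('X - c%:P) ^+ M) VD (Xb M).
have [f2 f2E] := @mk_frac k chi W F' G' WD G'b.
have [g2 g2E] := @mk_frac k chi W G' F' WD F'b.
exists f1, g1, f2, g2; split.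
- apply: (chart_ext VD) => a Va; rewrite evOM f1E // g1E // evO1 //.
  by have XM := Xb M _ Va; have XN := Xb N _ Va; field; rewrite XM XN.
- apply: (chart_ext WD) => a Wa; rewrite evOM f2E // g2E // evO1 //.
  by have FF := F'b _ Wa; have GG := G'b _ Wa; field; rewrite FF GG.
- apply: (chart_ext ZD) => a [Va Wa].
  have [Ga] := h a (conj Va Wa); rewrite -/(evO _ _) => ->.
  rewrite evOM !evO_ra // f1E // f2E // expr0 mulr1 GE FE !hornerM.
  by have XN := Xb N _ Va; have GG := G'b _ Wa; field; rewrite XN GG.
Qed.

End Extension.

(** * Generators of line bundles over a chart *)

Section LineBundles.
Variables (k : closedFieldType) (A : algSheaf k (P1 k)).

Definition restr_inj (M : modSheaf A) : Prop := forall (U V : opens (P1 k)) (m : M U),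
  V `<=` U -> oset V !=set0 -> rs V m = 0 -> m = 0.

(** A multiplicative Cech cocycle for the pair [V], [W] is a coboundary. Isolating this property
    lets one argument trivialize line bundles both on P^1 and on the ribbon. *)
Definition unit_split (chi : chart k) : Prop :=
  forall V W c (a b : A (oI V W)), one_point chi V W c -> a * b = 1 ->
  exists (u v : A V) (u' v' : A W),
    [/\ u * v = 1, u' * v' = 1 & a = ra (oI V W) u * ra (oI V W) u'].

Lemma line_bundle_restr_inj (M : modSheaf A) :
  restr_inj (regMod A) -> line_bundle M -> restr_inj M.
Proof.
move=> Ainj lM U V m VU V0 mV0; apply: (@sep _ _ _ M) => x Ux.
have [W [e [Wx g]]] := lM x; exists (oI U W); split=> //.
rewrite raddf0; have UW : oI U W `<=` W by [].
have [a aE] := gen_ex (rs (oI U W) m) g UW.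
rewrite aE; suff -> : a = 0 by rewrite scale0r.
have Z0 : oset (oI (oI U W) V) !=set0.
  by apply: meet_opens => //; exists x.
apply: (Ainj _ (oI (oI U W) V)) => //; rewrite -ra_rs.
have ZW : oI (oI U W) V `<=` W by [].
apply: (gen_eq0 g ZW); rewrite -(rs_rs (V := oI U W)) // -rsZ -aE rs_rs //.
have -> : rs (oI (oI U W) V) m = rs (oI (oI U W) V) (rs V m) by rewrite rs_rs.
by rewrite mV0 raddf0.
Qed.

(** If [e' = a e] on the overlap and a = u u', then u e and u'^-1 e' agree there and glue to a
    generator that reaches one more point. *)
Lemma line_bundle_trivial chi (M : modSheaf A) : unit_split chi ->
  line_bundle M -> exists e : M (cD chi), free_generator e.
Proof.
move=> us lM; apply: (@extend_chart _ chi (fun V => exists e : M V, free_generator e)).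
  have [W [e [We g]]] := lM (cpt chi 0).
  exists (oI W (cD chi)); split=> //.
    by apply: meet_opens; [exists (cpt chi 0)|exact: chart_neq0].
  by exists (rs (oI W (cD chi)) e); exact: gen_rs g.
move=> V x VD V0 [e g] /cDE[c ->] nVc.
have [W0 [e0 [W0c g0]]] := lM (cpt chi c).
have [W WW0 opt] := one_point_ex VD V0 nVc W0c.
have [_ WD _ _ [Wc _]] := opt.
pose e' := rs W e0; have g' : free_generator e' by exact: gen_rs g0.
have [a aE] := gen_ex (rs (oI V W) e') g (@oIl _ V W).
have [b bE] := gen_ex (rs (oI V W) e) g' (@oIr _ V W).
have ab1 : a * b = 1.
  apply: (@gen_inj _ _ _ _ _ _ _ _ _ g' (@oIr _ V W)).
  by rewrite scale1r -scalerA -bE -aE.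
have [u [v [u' [v' [uv uv' aE']]]]] := us V W c a b opt ab1.
have uvZ : ra (oI V W) v' * ra (oI V W) u' = 1.
  by rewrite -raM mulrC uv' ra1 //; exact: oIr.
have [||||m [mV mW]] := @glue2 _ _ _ M (oU V W) V W (u *: e) (v' *: e').
- by move=> y; left.
- by move=> y; right.
- by move=> y.
- by rewrite !rsZ aE scalerA aE' mulrCA uvZ mulr1.
exists (oU V W); split.
- by move=> y; left.
- by move=> y [/VD|/WD].
- by right.
exists m; apply: gen_local => y [Vy|Wy].
  exists V; split=> //; first by move=> ?; left.
  by rewrite mV; exact: gen_unit uv g.
exists W; split=> //; first by move=> ?; right.
by rewrite mW; apply: (gen_unit (b := u') _ g'); rewrite mulrC.
Qed.

End LineBundles.

Section LineBundlesP1.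
Variables (k : closedFieldType).
Notation O := (O_P1 k).

Lemma O_restr_inj : restr_inj (regMod O).
Proof.
move=> U V m VU V0 m0; apply: (O_open_eq VU V0).
by rewrite raddf0; exact: m0.
Qed.

Lemma O_unit_split chi : unit_split O chi.
Proof. move=> V W c a b opt ab; exact: unit_split_O opt ab. Qed.

Lemma line_torsion_free (M : modSheaf O) (U : opens (P1 k)) (f : O U) (m : M U) :
  line_bundle M -> f *: m = 0 -> f = 0 \/ m = 0.
Proof.
move=> lM fm; have Minj := line_bundle_restr_inj O_restr_inj lM.
case: (pselect (oset U !=set0)) => [[x Ux]|nU]; last first.
  by right; apply: sep => x Ux; case: nU; exists x.
have [W [e [Wx g]]] := lM x; pose Z := oI U W.
have Z0 : oset Z !=set0 by exists x.
have [a aE] := gen_ex (rs Z m) g (@oIr _ U W).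
have : ra Z f * a = 0.
  apply: (gen_eq0 g (@oIr _ U W)).
  by rewrite -scalerA -aE -rsZ fm raddf0.
move=> /O_domain [f0|a0]; [left|right].
  by apply: (O_open_eq (@oIl _ U W) Z0); rewrite raddf0.
by apply: (Minj U Z _ (@oIl _ U W) Z0); rewrite aE a0 scale0r.
Qed.

End LineBundlesP1.

(** * Local structure of a ribbon *)

Section RibbonTheory.
Variables (k : closedFieldType) (C : ribbon k).
Notation O := (O_P1 k).
Notation I := (rib_ideal C).
Notation red := (rib_red C).
Notation inc := (@rib_incl k C).
Implicit Types (chi : chart k) (U V W : opens (P1 k)).

Lemma red_ra U V (a : C U) : red V (ra V a) = ra V (red U a).
Proof.
by rewrite /ra; case: pselect => [VU|_]; [exact: ahom_res|exact: raddf0].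
Qed.

Lemma inc_rs U V (m : I U) : inc V (rs V m) = ra V (inc U m).
Proof.
by rewrite /rs /ra; case: pselect => [VU|_]; [exact: rib_incl_res|exact: raddf0].
Qed.

Lemma red_inc U (m : I U) : red U (inc U m) = 0.
Proof. by apply/rib_exact; exists m. Qed.

Lemma red_eq0 U (a : C U) : red U a = 0 -> exists m, a = inc U m.
Proof. by move=> /rib_exact[m <-]; exists m. Qed.

Lemma mul_inc U (a : C U) (m : I U) : a * inc U m = inc U (red U a *: m).
Proof. by rewrite rib_inclZ. Qed.

Lemma mul_inc0 U (m m' : I U) : inc U m * inc U m' = 0.
Proof. exact: rib_sqr0. Qed.

Lemma ideal_inj U : injective (inc U).
Proof. exact: rib_incl_inj. Qed.

Lemma ideal_restr_inj : restr_inj I.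
Proof. exact: line_bundle_restr_inj (@O_restr_inj k) (rib_ideal_line C). Qed.

(** The identity principle is used twice: on P^1 for the reduction, which puts [a] in the ideal,
    then on the ideal as a line bundle. *)
Lemma ribbon_open_eq0 U V (a : C U) : V `<=` U -> oset V !=set0 ->
  ra V a = 0 -> a = 0.
Proof.
move=> VU V0 a0; have /red_eq0[m mE] : red U a = 0.
  by apply: (O_open_eq VU V0); rewrite -red_ra a0 !raddf0.
suff m0 : m = 0 by rewrite mE m0 raddf0.
apply: (ideal_restr_inj VU V0); apply: (@ideal_inj V).
by rewrite inc_rs -mE a0 raddf0.
Qed.

Lemma ribbon_open_eq U V (a b : C U) : V `<=` U -> oset V !=set0 ->
  ra V a = ra V b -> a = b.
Proof.
move=> VU V0 e; apply/eqP; rewrite -subr_eq0; apply/eqP.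
by apply: (ribbon_open_eq0 VU V0); rewrite raddfB /= e subrr.
Qed.

Lemma ribbon_restr_inj : restr_inj (regMod C).
Proof. by move=> U V a VU V0 a0; exact: (ribbon_open_eq0 VU V0). Qed.

Lemma inverse_uniq (R : comPzRingType) (a b c : R) : a * b = 1 -> a * c = 1 -> b = c.
Proof. by move=> ab ac; rewrite -[b]mulr1 -ac mulrA [b * a]mulrC ab mul1r. Qed.

(** A local lift b' of [b] satisfies a b' = 1 + m with m^2 = 0, so b' (1 - m) is an inverse.
    Inverses are unique, hence the local ones glue. *)
Lemma unit_lift U (a : C U) (b : O U) : red U a * b = 1 -> exists c, a * c = 1.
Proof.
move=> ab; pose J := {V : opens (P1 k) & {c : C V | V `<=` U /\ ra V a * c = 1}}.
pose W (i : J) := projT1 i.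
pose c (i : J) : C (W i) := projT1 (projT2 i).
have WU i : W i `<=` U by case: (projT2 (projT2 i)).
have cP i : ra (W i) a * c i = 1 by case: (projT2 (projT2 i)).
have cov : U `<=` \bigcup_i W i.
  move=> x Ux; have [V [VU [b' [Vx b'E]]]] := rib_red_surj C b Ux.
  have /red_eq0[m mE] : red V (ra V a * b' - 1) = 0.
    rewrite rmorphB rmorphM rmorph1 b'E raE red_ra -raM ab ra1 //.
    by rewrite subrr.
  have h : ra V a * (b' * (1 - inc V m)) = 1.
    rewrite mulrA -[ra V a * b'](subrK 1) mE mulrBr mulr1 mulrDl mul1r mul_inc0.
    by rewrite add0r addrAC subrr add0r.
  by exists (existT _ V (exist _ _ (conj VU h))).
have [||i j|t tE] := @glue_alg _ _ _ U J W c; [exact: WU|exact: cov| |].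
  set Z := oI _ _; have Zi : Z `<=` W i by exact: oIl.
  have Zj : Z `<=` W j by exact: oIr.
  apply: (@inverse_uniq _ (ra Z a)).
    by have := congr1 (ra Z) (cP i); rewrite raM ra_ra // ra1.
  by have := congr1 (ra Z) (cP j); rewrite raM ra_ra // ra1.
exists t; apply: sep_alg => x /cov[i _ Wx]; exists (W i); split=> //.
by rewrite raM tE cP ra1.
Qed.

Section OnChart.
Variable chi : chart k.

Lemma ideal_trivial : exists e : I (cD chi), free_generator e.
Proof. exact: line_bundle_trivial (@O_unit_split k chi) (rib_ideal_line C). Qed.

(** Two lifts differ on the overlap by an ideal element f eps. Splitting f additively over the two
    opens corrects both lifts so that they glue. *)
Lemma coord_lift : exists T : C (cD chi), red _ T = zc chi.
Proof.
have [eps g] := ideal_trivial.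
suff [T TE] : exists T : C (cD chi), red _ T = ra _ (zc chi).
  by exists T; rewrite TE ra_id.
apply: (@extend_chart _ chi (fun V => exists T : C V, red _ T = ra V (zc chi))).
  have [V [VD [T [Vx TE]]]] := rib_red_surj C (zc chi) (cD_cpt chi 0).
  exists V; split=> //; first by exists (cpt chi 0).
  by exists T; rewrite TE raE.
move=> V x VD V0 [T TE] /cDE[c ->] nVc.
have [W0 [W0D [T' [W0c T'E]]]] := rib_red_surj C (zc chi) (cD_cpt chi c).
have [W WW0 opt] := one_point_ex VD V0 nVc W0c.
have [_ WD _ _ [Wc _]] := opt.
have Z1 : oI V W `<=` W0 by exact: subset_trans WW0.
have ZD : oI V W `<=` cD chi by [].
have /red_eq0[m mE] : red (oI V W) (ra _ T' - ra _ T) = 0.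
  by rewrite raddfB /= !red_ra T'E raE TE !ra_ra // subrr.
have [f fE] := gen_ex m g ZD.
have [f1 [f2 ff]] := frac_split f opt.
have [||||t [tV tW]] := @glue2_alg _ _ C (oU V W) V W
  (T + inc V (f1 *: rs V eps)) (ra W T' - inc W (f2 *: rs W eps)).
- by move=> y; left.
- by move=> y; right.
- by move=> y.
- rewrite raddfD raddfB /= -!inc_rs !rsZ !rs_rs // ra_ra //.
  apply/eqP; rewrite eq_sym subr_eq -addrA -raddfD -scalerDl /= -ff -fE -mE.
  by rewrite addrC subrK.
exists (oU V W); split.
- by move=> y; left.
- by move=> y [/VD|/WD].
- by right.
exists t; apply: evO_ext => x0 Ux.
have UD : oU V W `<=` cD chi by move=> y [/VD|/WD].
case: (Ux) => [Vx|Wx].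
  rewrite -(evO_ra _ (V := V)) //; last by move=> y; left.
  rewrite -red_ra tV raddfD /= red_inc addr0 TE !evO_ra //.
rewrite -(evO_ra _ (V := W)) //; last by move=> y; right.
rewrite -red_ra tW raddfB /= red_inc subr0 red_ra T'E raE !evO_ra //.
by exact: WW0.
Qed.

Lemma red_spev U V (T : C U) P : V `<=` U ->
  red V (spev (ra V T) P) = spev (ra V (red U T)) P.
Proof.
move=> VU; rewrite -red_ra; apply: rmorph_pev => c; exact: ahom_scal.
Qed.

Lemma spev_unit U V (T : C U) (P : {poly k}) : V `<=` U -> U `<=` cD chi ->
  red U T = ra U (zc chi) -> (forall a, oset V (cpt chi a) -> P.[a] != 0) ->
  exists c, spev (ra V T) P * c = 1.
Proof.
move=> VU UD TE P0; have VD : V `<=` cD chi by exact: subset_trans UD.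
have [b bE] := mk_frac 1 VD P0.
apply: (@unit_lift V _ b); rewrite red_spev // TE ra_ra //.
apply: (chart_ext VD) => a Va; rewrite evOM evO_spev // bE // evO1 //.
by rewrite hornerC div1r divff // P0.
Qed.

(** Write [b] as a fraction F/G and substitute the lift of the coordinate; G becomes a unit because
    its reduction has no zeros on [V]. *)
Lemma red_lift V (b : O V) : V `<=` cD chi -> exists c : C V, red V c = b.
Proof.
move=> VD; case: (pselect (oset V !=set0)) => [V0|nV]; last first.
  by exists 0; apply: sep_empty_alg => x Vx; apply: nV; exists x.
have [T TE] := coord_lift.
have [F [G [_ h]]] := @global_frac _ 0 V b chi VD V0.
have [c cE] : exists c, spev (ra V T) G * c = 1.
  by apply: (@spev_unit (cD chi)) => //; [rewrite TE ra_id|move=> a /h[]].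
exists (spev (ra V T) F * c); apply: (chart_ext VD) => a Va.
have [Ga] := h a Va; rewrite -/(evO _ _) expr0 mulr1 => ->.
have := congr1 (fun s => evO (red V s) (cpt chi a)) cE.
rewrite /= !rmorphM rmorph1 !evOM evO1 // !red_spev // TE !evO_spev // => e.
by congr (_ * _); apply: (mulfI Ga); rewrite divff.
Qed.

(** Lifting the factorization found on P^1 leaves an error 1 + m with m in the ideal. Since the
    ideal has square zero, an additive splitting m = n1 + n2 gives 1 + m = (1 + n1)(1 + n2). *)
Lemma ribbon_unit_split : unit_split C chi.
Proof.
move=> V W c a b opt ab; have [VD WD V0 nVc [Wc _]] := opt.
have [eps g] := ideal_trivial.
have [|f1 [g1 [f2 [g2 [fg1 fg2 fE]]]]] := @unit_split_O k chi V W c (red _ a) (red _ b) opt.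
  by rewrite -rmorphM ab rmorph1.
have [u uE] := red_lift f1 VD; have [u' u'E] := red_lift f2 WD.
have [v uv] : exists v, u * v = 1 by apply: (@unit_lift _ _ g1); rewrite uE.
have [v' uv'] : exists v, u' * v = 1 by apply: (@unit_lift _ _ g2); rewrite u'E.
set Z := oI V W; have ZV : Z `<=` V by exact: oIl.
have ZW : Z `<=` W by exact: oIr.
have uvZ : ra Z u * ra Z v = 1 by rewrite -raM uv ra1.
have uvZ' : ra Z u' * ra Z v' = 1 by rewrite -raM uv' ra1.
have ZD : Z `<=` cD chi by exact: subset_trans VD.
have /red_eq0[m mE] : red Z (a * (ra Z v * ra Z v') - 1) = 0.
  rewrite rmorphB rmorphM rmorph1 fE -uE -u'E -!red_ra -!rmorphM.
  by rewrite mulrACA uvZ uvZ' mulr1 rmorph1 subrr.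
have [f mfE] := gen_ex m g ZD.
have [h1 [h2 hE]] := frac_split f opt.
pose n1 := inc V (h1 *: rs V eps); pose n2 := inc W (h2 *: rs W eps).
have n1E : n1 * n1 = 0 by exact: mul_inc0.
have n2E : n2 * n2 = 0 by exact: mul_inc0.
exists (u * (1 + n1)), (v * (1 - n1)), (u' * (1 + n2)), (v' * (1 - n2)); split.
- rewrite mulrACA uv mul1r; ring: n1E.
- rewrite mulrACA uv' mul1r; ring: n2E.
- rewrite !raM mulrACA !raddfD /= !ra1 //.
have -> : (1 + ra Z n1) * (1 + ra Z n2) = 1 + inc Z m.
  rewrite mulrDl mul1r mulrDr mulr1 -!inc_rs mul_inc0 addr0 -addrA.
  by rewrite mfE hE !rsZ !rs_rs // scalerDl [in RHS]raddfD /= [inc Z _ + _]addrC.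
rewrite -mE [1 + _]addrC subrK.
by rewrite [RHS]mulrC -mulrA mulrACA [ra Z v * _]mulrC uvZ [ra Z v' * _]mulrC uvZ' !mulr1.
Qed.

Lemma line_trivial (L : modSheaf C) : line_bundle L ->
  exists e : L (cD chi), free_generator e.
Proof. exact: line_bundle_trivial ribbon_unit_split. Qed.

End OnChart.

Lemma line_restr_inj (L : modSheaf C) : line_bundle L -> restr_inj L.
Proof. exact: line_bundle_restr_inj ribbon_restr_inj. Qed.

End RibbonTheory.

(** * Laurent expansions on the intersection of the charts *)

Section Laurent.
Variable (k : closedFieldType).
Notation O := (O_P1 k).

Definition D0 : opens (P1 k) := cD (chart0 k).
Definition D1 : opens (P1 k) := cD (chart1 k).
Definition D01 : opens (P1 k) := off2 None (Some 0).

Lemma D010 : D01 `<=` D0. Proof. exact: off2_subl. Qed.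
Lemma D011 : D01 `<=` D1. Proof. exact: off2_subr. Qed.

Lemma D01_Some (a : k) : oset D01 (Some a) <-> a != 0.
Proof.
split; first by move=> h; apply/eqP => a0; apply: h; right; rewrite a0.
by move=> a0 [] // [e]; rewrite e eqxx in a0.
Qed.

Lemma D01E x : oset D01 x <-> exists2 a : k, a != 0 & x = Some a.
Proof.
split; last by case=> a a0 ->; exact/D01_Some.
case: x => [a /D01_Some a0|h]; first by exists a.
by case: h; left.
Qed.

Lemma D01_neq0 : oset D01 !=set0.
Proof. by exists (Some 1); apply/D01_Some; rewrite oner_neq0. Qed.

Lemma D01_meet : D01 = oI D0 D1.
Proof.
apply: opens_eq; first by move=> x xD; split; [exact: D010|exact: D011].
move=> x [x0 x1] [xE|xE]; [exact: x0|exact: x1].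
Qed.

Lemma cpt1V (a : k) : a != 0 -> cpt1 a^-1 = Some a.
Proof. by move=> a0; rewrite /cpt1 invr_eq0 (negbTE a0) invrK. Qed.

Lemma laurent_ext (f g : O D01) :
  (forall a, a != 0 -> evO f (Some a) = evO g (Some a)) -> f = g.
Proof. by move=> h; apply: evO_ext => x /D01E[a a0 ->]; exact: h. Qed.

Definition laurent_rep (f : O D01) (P : {poly k}) (N : nat) : Prop :=
  forall a, a != 0 -> evO f (Some a) = P.[a] / a ^+ N.

Lemma nonvanishing_monomial (G : {poly k}) : (forall a, a != 0 -> G.[a] != 0) ->
  exists c N, c != 0 /\ G = c%:P * 'X^N.
Proof.
move=> h; have G0 : G != 0.
  by apply: contraTneq (h 1 (oner_neq0 k)) => ->; rewrite horner0 eqxx.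
have [N [G' [GE G'0]]] := horner_nonroot_split 0 G0.
rewrite polyC0 subr0 in GE.
have : size G' == 1; last first.
  move=> /size_poly1P[c c0 cE]; exists c, N; split=> //.
  by rewrite GE cE.
apply: contraT => /closed_rootP[a]; rewrite rootE => ra.
have [a0|a0] := eqVneq a 0; first by rewrite a0 (negbTE G'0) in ra.
by have := h a a0; rewrite GE hornerM (eqP ra) mul0r eqxx.
Qed.

Lemma laurent_rep_ex f : exists P N, laurent_rep f P N.
Proof.
have [F [G [_ h]]] := @global_frac k 0 D01 f (chart0 k) D010 D01_neq0.
have [a a0|c [N [c0 GE]]] := @nonvanishing_monomial G.
  by have [] := h a; first exact/D01_Some.
exists (c^-1 *: F), N => a a0; have [|_] := h a; first exact/D01_Some.
rewrite -/(evO _ _) expr0 mulr1 => ->.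
rewrite GE hornerZ hornerM hornerC hornerXn.
by field; rewrite c0 expf_neq0.
Qed.

Lemma laurent_of_poly (P : {poly k}) N : exists f, laurent_rep f P N.
Proof.
have [a /D01_Some a0|f fE] := @mk_frac k (chart0 k) D01 P 'X^N D010.
  by rewrite hornerXn expf_neq0.
by exists f => a a0; rewrite fE ?hornerXn //; exact/D01_Some.
Qed.

Definition poly_icoef (P : {poly k}) (i : int) : k :=
  if i is Posz j then P`_j else 0.

(* The coefficient of [t ^ i], where [t] is the coordinate of [chart0]. *)
Definition lcoef (f : O D01) (i : int) : k :=
  let: exist P h := cid (laurent_rep_ex f) in poly_icoef P (i + (projT1 (cid h))%:Z).

(** Any two representations cross-multiply to the same polynomial, so the one chosen inside [lcoef]
    does not matter. *)
Lemma lcoefE f P N i : laurent_rep f P N -> lcoef f i = poly_icoef P (i + N%:Z).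
Proof.
move=> hP; rewrite /lcoef; case: cid => Q h /=; case: cid => M hQ /=.
have e : Q * 'X^N = P * 'X^M.
  apply: (@poly_open_eq _ (chart0 k) D01); first exact: D01_neq0.
  move=> a /D01_Some a0; have := hP a a0; rewrite hQ // !hornerM !hornerXn => /eqP.
  by rewrite eqr_div ?expf_neq0 // => /eqP.
have cX (R : {poly k}) K m : poly_icoef (R * 'X^K) (m + K%:Z) = poly_icoef R m.
  case: m => m /=; first by rewrite coefMXn ltnNge leq_addl /= addnK.
  case E : (Negz m + K%:Z)%R => [j|//] /=.
  by rewrite coefMXn ifT //; lia.
by rewrite -(cX Q N) -(cX P M) e addrAC.
Qed.

Lemma laurent_eq0 f : (forall i, lcoef f i = 0) -> f = 0.
Proof.
move=> f0; have [P [N h]] := laurent_rep_ex f.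
apply: laurent_ext => a a0; rewrite h // evO0.
suff -> : P = 0 by rewrite horner0 mul0r.
apply/polyP => j; rewrite coef0; have := f0 (j%:Z - N%:Z).
by rewrite (lcoefE _ h) subrK.
Qed.

Lemma lcoefB f g i : lcoef (f - g) i = lcoef f i - lcoef g i.
Proof.
have [P [N h]] := laurent_rep_ex f; have [Q [M h']] := laurent_rep_ex g.
have hf : laurent_rep f (P * 'X^M) (N + M).
  move=> a a0; rewrite h // hornerM hornerXn exprD.
  by field; rewrite !expf_neq0.
have hg : laurent_rep g (Q * 'X^N) (N + M).
  move=> a a0; rewrite h' // hornerM hornerXn exprD.
  by field; rewrite !expf_neq0.
have hfg : laurent_rep (f - g) (P * 'X^M - Q * 'X^N) (N + M).
  by move=> a a0; rewrite evOB hf // hg // hornerD hornerN mulrBl.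
rewrite (lcoefE _ hfg) (lcoefE _ hf) (lcoefE _ hg) /poly_icoef.
by case: (_ + _) => j; rewrite ?coefB ?subr0.
Qed.

Definition lcoef_at i f := lcoef f i.

HB.instance Definition _ i := GRing.isZmodMorphism.Build _ _ (lcoef_at i)
  (fun f g => lcoefB f g i).

Lemma lcoef0 i : lcoef 0 i = 0. Proof. exact: raddf0 (lcoef_at i). Qed.

Lemma lcoefD f g i : lcoef (f + g) i = lcoef f i + lcoef g i.
Proof. exact: raddfD (lcoef_at i) _ _. Qed.

Lemma lcoef_sum (J : Type) (r : seq J) (F : J -> O D01) i :
  lcoef (\sum_(j <- r) F j) i = \sum_(j <- r) lcoef (F j) i.
Proof. exact: raddf_sum (lcoef_at i) _ _ _ _. Qed.

Lemma laurent_eq f g : (forall i, lcoef f i = lcoef g i) -> f = g.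
Proof.
move=> h; apply/eqP; rewrite -subr_eq0; apply/eqP/laurent_eq0 => i.
by rewrite lcoefB h subrr.
Qed.

Lemma lcoef_shift f g c (m : int) :
  (forall a, a != 0 -> evO g (Some a) = c * a ^ m * evO f (Some a)) ->
  forall i, lcoef g i = c * lcoef f (i - m).
Proof.
move=> hg i; have [P [N h]] := laurent_rep_ex f.
have sc (j : int) : poly_icoef (c *: P) j = c * poly_icoef P j.
  by case: j => j; rewrite /poly_icoef ?coefZ ?mulr0.
case: m hg => m hg.
  have hg' : laurent_rep g (c *: P * 'X^m) N.
    move=> a a0; rewrite hg // h // hornerM hornerXn hornerZ -exprnP.
    by field; rewrite expf_neq0.
  rewrite (lcoefE _ hg') (lcoefE _ h) -sc.
  have -> : i + N%:Z = (i - Posz m + N%:Z) + m%:Z by ring.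
  case: (i - _ + _) => j /=; first by rewrite coefMXn ltnNge leq_addl /= addnK.
  case E : (Negz j + m%:Z)%R => [j'|//] /=.
  by rewrite coefMXn ifT //; lia.
have hg' : laurent_rep g (c *: P) (N + m.+1).
  move=> a a0; rewrite hg // h // hornerZ NegzE -exprnN exprD.
  by field; rewrite ?expf_neq0 ?a0.
rewrite (lcoefE _ hg') (lcoefE _ h) sc; congr (_ * poly_icoef _ _).
by rewrite NegzE; lia.
Qed.

Lemma lcoef_scal c f i : lcoef (scal O D01 c * f) i = c * lcoef f i.
Proof.
rewrite -[in RHS](subr0 i); apply: lcoef_shift => a a0.
by rewrite evOM evO_scal ?expr0z ?mulr1 //; exact/D01_Some.
Qed.

Lemma laurent_trunc (S : int -> bool) f :
  exists g, forall i, lcoef g i = if S i then lcoef f i else 0.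
Proof.
have [P [N h]] := laurent_rep_ex f.
pose Q := \poly_(j < size P) (if S (j%:Z - N%:Z) then P`_j else 0).
have [g hg] := laurent_of_poly Q N.
exists g => i; rewrite (lcoefE _ hg) (lcoefE _ h).
case E : (i + N%:Z)%R => [j|j] /=; last by rewrite if_same.
rewrite coef_poly; have -> : j%:Z - N%:Z = i by rewrite -E addrK.
by case: ltnP => // jP; rewrite [P`_j]nth_default // if_same.
Qed.

Lemma lcoef_bound f : exists d : nat, forall i : int, (d < `|i|)%N -> lcoef f i = 0.
Proof.
have [P [N h]] := laurent_rep_ex f.
exists (size P + N)%N => i id; rewrite (lcoefE _ h).
case E : (i + N%:Z)%R => [j|//] /=; rewrite nth_default //.
by move: (size P) id E => n id E; lia.
Qed.

Definition tc : O D01 := ra D01 (zc (chart0 k)).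
Definition uc : O D01 := ra D01 (zc (chart1 k)).

Lemma evO_tc a : a != 0 -> evO tc (Some a) = a.
Proof.
move=> a0; rewrite evO_ra //; last exact/D01_Some; last exact: D010.
exact: (zcE (chart0 k)).
Qed.

Lemma evO_uc a : a != 0 -> evO uc (Some a) = a^-1.
Proof.
move=> a0; rewrite evO_ra //; last exact/D01_Some; last exact: D011.
by rewrite -cpt1V //; exact: (zcE (chart1 k)).
Qed.

Lemma tc_uc : tc * uc = 1.
Proof.
apply: laurent_ext => a a0; rewrite evOM evO_tc // evO_uc // divff // evO1 //.
exact/D01_Some.
Qed.

Lemma evO_ra_spev0 P a : a != 0 ->
  evO (ra D01 (spev (zc (chart0 k)) P)) (Some a) = P.[a].
Proof.
move=> a0; rewrite ra_pev; last exact: D010.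
by rewrite (evO_spev (chi := chart0 k) _ D010) //; exact/D01_Some.
Qed.

Lemma evO_ra_spev1 P a : a != 0 ->
  evO (ra D01 (spev (zc (chart1 k)) P)) (Some a) = P.[a^-1].
Proof.
move=> a0; rewrite ra_pev; last exact: D011.
rewrite -cpt1V // (evO_spev (chi := chart1 k) _ D011) //.
by rewrite /= cpt1V //; exact/D01_Some.
Qed.

(** Over an algebraically closed field a denominator without zeros is constant. *)
Lemma chart_poly chi (F : O (cD chi)) : exists P, F = spev (zc chi) P.
Proof.
have [P [G [_ h]]] := @global_frac k 0 _ F chi (@subset_refl _ _) (chart_neq0 chi).
have : size G == 1.
  apply: contraT => /closed_rootP[a]; rewrite rootE => ra.
  by have [] := h a (cD_cpt chi a); rewrite ra.
move=> /size_poly1P[c c0 cE]; exists (c^-1 *: P).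
apply: (chart_ext (@subset_refl _ _)) => a Da.
have [_] := h a Da; rewrite -/(evO _ _) => ->.
rewrite -[zc chi in RHS]ra_id evO_spev // cE hornerC hornerZ expr0 mulr1 mulrC //.
Qed.

Lemma lcoef_D0 (F : O D0) i : (i < 0)%R -> lcoef (ra D01 F) i = 0.
Proof.
move=> i0; have [P ->] := chart_poly F.
have h : laurent_rep (ra D01 (spev (zc (chart0 k)) P)) P 0.
  by move=> a a0; rewrite evO_ra_spev0 // expr0 divr1.
by rewrite (lcoefE _ h) addr0; case: i i0.
Qed.

Lemma from_D0 f : (forall i : int, (i < 0)%R -> lcoef f i = 0) ->
  exists F : O D0, f = ra D01 F.
Proof.
move=> f0; have [P [N h]] := laurent_rep_ex f.
exists (spev (zc (chart0 k)) (drop_poly N P)); apply: laurent_ext => a a0.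
rewrite h // evO_ra_spev0 //.
rewrite -{1}(poly_take_drop N P) hornerD hornerM hornerXn.
suff -> : take_poly N P = 0 by rewrite horner0 add0r mulfK // expf_neq0.
apply/polyP => j; rewrite coef_take_poly coef0; case: ifP => // jN.
have := f0 (j%:Z - N%:Z); rewrite (lcoefE _ h) subrK /=; apply; lia.
Qed.

Lemma rev_form_eval N (P : {poly k}) a : a != 0 -> (size P <= N.+1)%N ->
  P.[a] = (rev_form N P).[a^-1] * a ^+ N.
Proof.
move=> a0 PN; have := rev_form_form N P a^-1; rewrite cpt1V // chart0_form.
rewrite expr1n mulr1 take_poly_id // => ->.
by rewrite /cu1 invr_eq0 (negbTE a0) invrK.
Qed.

Lemma lcoef_D1 (F : O D1) i : (0 < i)%R -> lcoef (ra D01 F) i = 0.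
Proof.
move=> i0; have [P ->] := chart_poly F.
have h : laurent_rep (ra D01 (spev (zc (chart1 k)) P)) (rev_form (size P) P) (size P).
  move=> a a0; rewrite evO_ra_spev1 // (@rev_form_eval (size P)) ?size_poly //.
  by rewrite rev_formK take_poly_id // mulfK // expf_neq0.
rewrite (lcoefE _ h); case: i i0 => // i i0 /=.
by rewrite nth_default // (leq_trans (size_poly _ _)) //; lia.
Qed.

Lemma from_D1 f : (forall i : int, (0 < i)%R -> lcoef f i = 0) ->
  exists F : O D1, f = ra D01 F.
Proof.
move=> f0; have [P [N h]] := laurent_rep_ex f.
exists (spev (zc (chart1 k)) (rev_form N P)); apply: laurent_ext => a a0.
rewrite h // evO_ra_spev1 // (@rev_form_eval N) ?mulfK ?expf_neq0 //.
apply/leq_sizeP => j Nj; have := f0 (j%:Z - N%:Z).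
by rewrite (lcoefE _ h) subrK /=; apply; lia.
Qed.

(** The numerator of a unit can vanish only at 0, so it is a monomial. For a transition function,
    the exponent [m] is the degree of the line bundle on P^1. *)
Lemma laurent_unit (f g : O D01) : f * g = 1 -> exists c (m : int), c != 0 /\
  forall a, a != 0 -> evO f (Some a) = c * a ^ m.
Proof.
move=> fg; have [P [N h]] := laurent_rep_ex f.
have [a a0|c [M [c0 PE]]] := @nonvanishing_monomial P.
  have := congr1 (fun s : O D01 => evO s (Some a)) fg.
  rewrite /= evOM h // evO1; last exact/D01_Some.
  by move=> e; apply: contra_eq_neq e => ->; rewrite !mul0r eq_sym oner_neq0.
exists c, (M%:Z - N%:Z); split=> // a a0.
by rewrite h // PE hornerM hornerC hornerXn expfzDr // -exprnN -exprnP mulrA.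
Qed.

End Laurent.

(** * Euler characteristics *)

Section Index.
Variables (k : fieldType) (R : pzRingType) (f : {rmorphism k -> R}) (W : lmodType R).

Definition lincomb n (v : 'I_n -> W) (c : 'rV[k]_n) : W := \sum_(i < n) f (c 0 i) *: v i.

Fact lincomb_zmod n (v : 'I_n -> W) : zmod_morphism (lincomb v).
Proof.
move=> c d; rewrite /lincomb -sumrB; apply: eq_bigr => i _.
by rewrite !mxE rmorphB scalerBl.
Qed.
HB.instance Definition _ n v := GRing.isZmodMorphism.Build _ _ _ (@lincomb_zmod n v).

Lemma lincombZ n (v : 'I_n -> W) a c : lincomb v (a *: c) = f a *: lincomb v c.
Proof.
rewrite /lincomb scaler_sumr; apply: eq_bigr => i _.
by rewrite mxE rmorphM scalerA.
Qed.

Lemma lincomb_mul m n (v : 'I_n -> W) (c : 'rV_m) (A : 'M_(m, n)) :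
  lincomb v (c *m A) = \sum_(i < m) f (c 0 i) *: lincomb v (row i A).
Proof.
rewrite mulmx_sum_row raddf_sum; apply: eq_bigr => i _; exact: lincombZ.
Qed.

Definition subspace (S : W -> Prop) : Prop :=
  [/\ S 0, forall x y, S x -> S y -> S (x - y) & forall c x, S x -> S (f c *: x)].

Section Subspace.
Variables (S : W -> Prop) (sS : subspace S).

Lemma subspace0 : S 0. Proof. by case: sS. Qed.
Lemma subspaceB x y : S x -> S y -> S (x - y). Proof. by case: sS => _ h _; exact: h. Qed.
Lemma subspaceZ c x : S x -> S (f c *: x). Proof. by case: sS => _ _; exact. Qed.
Lemma subspaceN x : S x -> S (- x). Proof. by rewrite -sub0r; apply: subspaceB subspace0. Qed.
Lemma subspaceD x y : S x -> S y -> S (x + y).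
Proof. by move=> Sx Sy; rewrite -[y]opprK; apply: subspaceB Sx _; exact: subspaceN. Qed.

Lemma subspace_bigsum (J : Type) (r : seq J) (F : J -> W) : (forall j, S (F j)) ->
  S (\sum_(j <- r) F j).
Proof. by move=> h; elim/big_ind: _ => //; [exact: subspace0|exact: subspaceD]. Qed.

Lemma subspace_trans y x z : S (x - y) -> S (y - z) -> S (x - z).
Proof. by move=> h h'; rewrite -[x](subrK y) -addrA; exact: subspaceD. Qed.

Lemma subspace_sym x y : S (x - y) -> S (y - x).
Proof. by move=> /subspaceN; rewrite opprB. Qed.

Lemma subspace_lincomb_mul m n (v : 'I_n -> W) (w : 'I_m -> W) (A : 'M_(m, n)) :
  (forall i, S (w i - lincomb v (row i A))) ->
  forall c, S (lincomb w c - lincomb v (c *m A)).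
Proof.
move=> h c; rewrite lincomb_mul -sumrB; apply: subspace_bigsum => i.
by rewrite -scalerBr; exact: subspaceZ.
Qed.

End Subspace.

Definition sum_sub (S T : W -> Prop) (x : W) : Prop :=
  exists y z, [/\ S y, T z & x = y + z].

Lemma subspace_sum_sub S T : subspace S -> subspace T -> subspace (sum_sub S T).
Proof.
move=> sS sT; split.
- by exists 0, 0; rewrite addr0; split=> //; exact: subspace0.
- move=> _ _ [y [z [Sy Tz ->]]] [y' [z' [Sy' Tz' ->]]].
  by exists (y - y'), (z - z'); split; [exact: subspaceB|exact: subspaceB|rewrite opprD addrACA].
- move=> c _ [y [z [Sy Tz ->]]]; exists (f c *: y), (f c *: z).
  by split; [exact: subspaceZ|exact: subspaceZ|rewrite scalerDr].
Qed.

(** Quotients are not formed: a finite basis modulo [S] is expressed by unique coordinates, the form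
    in which [dim_mod] provides it, while [Q] and [S] themselves may be infinite-dimensional. *)
Definition basis_mod (Q S : W -> Prop) n (v : 'I_n -> W) : Prop :=
  (forall i, Q (v i)) /\ forall x, Q x -> exists! c, S (x - lincomb v c).

Lemma basis_coords Q S n (v : 'I_n -> W) m (w : 'I_m -> W) : basis_mod Q S v ->
  (forall i, Q (w i)) -> exists A : 'M_(m, n), forall i, S (w i - lincomb v (row i A)).
Proof.
move=> [_ h] Qw.
have ex i : {c | S (w i - lincomb v c)}.
  by apply: cid; have [c [hc _]] := h _ (Qw i); exists c.
exists (\matrix_i projT1 (ex i)) => i; rewrite rowK; exact: (projT2 (ex i)).
Qed.

Lemma basis_uniq (Q S : W -> Prop) n (v : 'I_n -> W) x c d : basis_mod Q S v -> Q x ->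
  S (x - lincomb v c) -> S (x - lincomb v d) -> c = d.
Proof. by move=> [_ h] /h[e [_ u]] /u <- /u. Qed.

(* Rank-nullity for the map [M1/N -> W/(M0 + N)], whose kernel is the
   intersection of [M0] and [M1] and whose cokernel is [W/(M0 + M1)]. *)
Lemma index_formula (M0 M1 N : W -> Prop) A B h0 h1
    (m : 'I_A -> W) (w : 'I_B -> W) (v : 'I_h0 -> W) (u : 'I_h1 -> W) :
  subspace M0 -> subspace M1 -> subspace N -> (forall x, N x -> M1 x) ->
  (forall x, M0 x -> N x -> x = 0) ->
  basis_mod M1 N m -> basis_mod (fun=> True) (sum_sub M0 N) w ->
  basis_mod (fun x => M0 x /\ M1 x) (fun x => x = 0) v ->
  basis_mod (fun=> True) (sum_sub M0 M1) u ->
  (h0 + B = h1 + A)%N.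
Proof.
move=> s0 s1 sN NM1 M0N bm bw bv bu.
have sP := subspace_sum_sub s0 sN; have sQ := subspace_sum_sub s0 s1.
set P := sum_sub M0 N; set Q := sum_sub M0 M1.
have PQ x : P x -> Q x by case=> y [z [My Nz ->]]; exists y, z; split=> //; exact: NM1.
have M1Q x : M1 x -> Q x by move=> M1x; exists 0, x; rewrite add0r; split=> //; exact: subspace0.
have NP x : N x -> P x by move=> Nx; exists 0, x; rewrite add0r; split=> //; exact: subspace0.
have M0P x : M0 x -> P x by move=> Mx; exists x, 0; rewrite addr0; split=> //; exact: subspace0.
(* On row vectors, [V], [D] and [U] are the matrices of the maps from the intersection of M0 and M1
   to M1/N, from there to W/(M0 + N), and on to W/(M0 + M1). The claims below make this sequence
   exact, with [V] injective and [U] surjective, and the ranks give the formula. *)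
have [D hD] := basis_coords bw (fun i => I : (fun=> True) (m i)).
have [V hV] := basis_coords bm (fun i => (bv.1 i).2).
have [U hU] := basis_coords bu (fun i => I : (fun=> True) (w i)).
have kD a : P (lincomb m a - lincomb w (a *m D)) by exact: subspace_lincomb_mul.
have kV c : N (lincomb v c - lincomb m (c *m V)) by exact: subspace_lincomb_mul.
have kU b : Q (lincomb w b - lincomb u (b *m U)) by exact: subspace_lincomb_mul.
have w0 b : P (lincomb w b) -> b = 0.
  move=> Pb; apply: (basis_uniq bw (x := lincomb w b) I).
    by rewrite subrr; exact: subspace0.
  by rewrite raddf0 subr0.
have u0 b : Q (lincomb u b) -> b = 0.
  move=> Pb; apply: (basis_uniq bu (x := lincomb u b) I).
    by rewrite subrr; exact: subspace0.
  by rewrite raddf0 subr0.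
have M0v c : M0 (lincomb v c).
  by apply: subspace_bigsum => // i; apply: subspaceZ => //; case: (bv.1 i).
have M1m a : M1 (lincomb m a) by apply: subspace_bigsum => // i; apply: subspaceZ => //; exact: bm.1.
have M1v c : M1 (lincomb v c).
  by apply: subspace_bigsum => // i; apply: subspaceZ => //; case: (bv.1 i).
have rV : \rank V = h0.
  apply/eqP; rewrite -/(row_free V) -kermx_eq0; apply/rowV0P => c /sub_kermxP cV.
  have := kV c; rewrite cV raddf0 subr0 => Nc.
  apply: (basis_uniq bv (x := 0)); first by split; exact: subspace0.
    by rewrite sub0r (M0N _ (M0v c) Nc) oppr0.
  by rewrite raddf0 subr0.
have eV : (V :=: kermx D)%MS.
  apply/eqmxP/andP; split; last first.
    apply/row_subP => i; move: (row_sub i (kermx D)) => /sub_kermxP.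
    move: (row i _) => a aD; have := kD a; rewrite aD raddf0 subr0 => -[x [n [Mx Nn aE]]].
    have xE : x = lincomb m a - n by rewrite aE addrK.
    have M1x : M1 x by rewrite xE; apply: subspaceB => //; exact: NM1.
    have [c [/eqP]] := bv.2 x (conj Mx M1x); rewrite subr_eq0 => /eqP cE _.
    suff -> : a = c *m V by exact: submxMl.
    apply: (basis_uniq bm (x := lincomb m a)); first exact: M1m.
      by rewrite subrr; exact: subspace0.
    apply: (subspace_trans sN (y := lincomb v c)); last exact: kV.
    by rewrite -cE xE opprB addrC subrK.
  apply/sub_kermxP/row_matrixP => i; rewrite row_mul row0; apply: w0.
  rewrite -[lincomb _ _](subrK (lincomb m (row i V))).
  apply: (subspaceD sP); first by apply: (subspace_sym sP); exact: kD.
  rewrite -[lincomb m _](subrK (v i)); apply: (subspaceD sP).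
    by apply: NP; apply: (subspace_sym sN).
  by apply: M0P; case: (bv.1 i).
have rU : \rank U = h1.
  apply/eqP; rewrite -/(row_full U) -sub1mx; apply/row_subP => i.
  move: (row i 1%:M) => c; have [b [Pb _]] := bw.2 (lincomb u c) I.
  suff -> : c = b *m U by exact: submxMl.
  apply/eqP; rewrite -subr_eq0; apply/eqP/u0; rewrite raddfB /=.
  by apply: (subspace_trans sQ (y := lincomb w b)); [exact: PQ Pb|exact: kU].
have eU : (D :=: kermx U)%MS.
  apply/eqmxP/andP; split.
    apply/sub_kermxP/row_matrixP => i; rewrite row_mul row0; apply: u0.
    rewrite -[lincomb _ _](subrK (lincomb w (row i D))).
    apply: (subspaceD sQ); first by apply: (subspace_sym sQ); exact: kU.
    rewrite -[lincomb w _](subrK (m i)); apply: (subspaceD sQ).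
      by apply: PQ; apply: (subspace_sym sP).
    by apply: M1Q; exact: bm.1.
  apply/row_subP => i; move: (row_sub i (kermx U)) => /sub_kermxP.
  move: (row i _) => b bU; have := kU b; rewrite bU raddf0 subr0 => -[x [y [Mx My bE]]].
  have [a [Na _]] := bm.2 y My.
  suff -> : b = a *m D by exact: submxMl.
  apply/eqP; rewrite -subr_eq0; apply/eqP/w0; rewrite raddfB /=.
  apply: (subspace_trans sP (y := lincomb m a)); last exact: kD.
  by rewrite bE -addrA; apply: (subspaceD sP); [exact: M0P|exact: NP].
have := mxrank_ker D; rewrite -eV rV; have := mxrank_ker U; rewrite -eU rU.
have := rank_leq_row D; have := rank_leq_row U; rewrite rU; lia.
Qed.

End Index.

(** * Coordinates on the ribbon over the overlap of the charts *)

Section Coordinates.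
Variables (k : closedFieldType) (C : ribbon k).
Notation O := (O_P1 k).
Notation I := (rib_ideal C).
Notation red := (rib_red C).
Notation inc := (@rib_incl k C).
Notation D01 := (D01 k).
Notation D0 := (D0 k).
Notation D1 := (D1 k).

Variables (T0 : C D0) (eps0 : I D0).
Hypotheses (redT0 : red D0 T0 = zc (chart0 k)) (gen0 : free_generator eps0).

Let T : C D01 := ra D01 T0.
Let eps : I D01 := rs D01 eps0.

Lemma red_T : red D01 T = tc k.
Proof. by rewrite /T red_ra redT0. Qed.

Lemma T_unit : exists U, T * U = 1.
Proof. by apply: (@unit_lift _ _ _ _ (uc k)); rewrite red_T tc_uc. Qed.

Definition Tinv : C D01 := projT1 (cid T_unit).

Lemma TTinv : T * Tinv = 1.
Proof. by rewrite /Tinv; case: cid. Qed.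

Lemma red_Tinv : red D01 Tinv = uc k.
Proof.
apply: (@inverse_uniq _ (tc k)); last exact: tc_uc.
by rewrite -red_T -rmorphM TTinv rmorph1.
Qed.

(* The ring morphism from O(D01) to C(D01) that sends the coordinate to [T]. *)
Definition lft (f : O D01) : C D01 :=
  let: exist P h := cid (laurent_rep_ex f) in spev T P * Tinv ^+ projT1 (cid h).

Lemma TTinvX n : T ^+ n * Tinv ^+ n = 1.
Proof. by rewrite -exprMn TTinv expr1n. Qed.

Lemma lftE f P N : laurent_rep f P N -> lft f = spev T P * Tinv ^+ N.
Proof.
move=> hP; rewrite /lft; case: cid => Q h /=; case: cid => M hQ /=.
have e : Q * 'X^N = P * 'X^M.
  apply: (@poly_open_eq _ (chart0 k) D01); first exact: D01_neq0.
  move=> a /D01_Some a0; have := hP a a0; rewrite hQ // !hornerM !hornerXn => /eqP.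
  by rewrite eqr_div ?expf_neq0 // => /eqP.
have := congr1 (spev T) e; rewrite !rmorphM !rmorphXn /= spevX => e'.
transitivity (spev T Q * Tinv ^+ M * (T ^+ N * Tinv ^+ N)).
  by rewrite TTinvX mulr1.
transitivity (spev T Q * T ^+ N * (Tinv ^+ M * Tinv ^+ N)); first by ring.
rewrite e'; transitivity (spev T P * Tinv ^+ N * (T ^+ M * Tinv ^+ M)); first by ring.
by rewrite TTinvX mulr1.
Qed.

Lemma red_lft f : red D01 (lft f) = f.
Proof.
have [P [N h]] := laurent_rep_ex f; rewrite (lftE h).
apply: laurent_ext => a a0; have Da : oset D01 (Some a) by exact/D01_Some.
rewrite rmorphM rmorphXn evOM evOX // red_Tinv evO_uc //.
rewrite -[T]ra_id red_spev // red_T ra_ra //; last exact: D010.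
by rewrite (evO_spev (chi := chart0 k)) //; [rewrite h // exprVn|exact: D010].
Qed.

Fact lft_zmod : zmod_morphism lft.
Proof.
move=> f g; have [P [N h]] := laurent_rep_ex f; have [Q [M h']] := laurent_rep_ex g.
have hf : laurent_rep f (P * 'X^M) (N + M).
  move=> a a0; rewrite h // hornerM hornerXn exprD.
  by field; rewrite ?expf_neq0.
have hg : laurent_rep g (Q * 'X^N) (N + M).
  move=> a a0; rewrite h' // hornerM hornerXn exprD.
  by field; rewrite ?expf_neq0.
have hfg : laurent_rep (f - g) (P * 'X^M - Q * 'X^N) (N + M).
  by move=> a a0; rewrite evOB hf // hg // hornerD hornerN mulrBl.
by rewrite (lftE hfg) (lftE hf) (lftE hg) rmorphB mulrBl.
Qed.
HB.instance Definition _ := GRing.isZmodMorphism.Build _ _ lft lft_zmod.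

Lemma lftM f g : lft (f * g) = lft f * lft g.
Proof.
have [P [N h]] := laurent_rep_ex f; have [Q [M h']] := laurent_rep_ex g.
have hfg : laurent_rep (f * g) (P * Q) (N + M).
  move=> a a0; rewrite evOM h // h' // hornerM exprD.
  by field; rewrite ?expf_neq0.
by rewrite (lftE hfg) (lftE h) (lftE h') rmorphM exprD mulrACA.
Qed.

Lemma lft_poly0 P : lft (ra D01 (spev (zc (chart0 k)) P)) = spev T P.
Proof.
have h : laurent_rep (ra D01 (spev (zc (chart0 k)) P)) P 0.
  by move=> a a0; rewrite evO_ra_spev0 // expr0 divr1.
by rewrite (lftE h) expr0 mulr1.
Qed.

Lemma lft_scal c : lft (scal O D01 c) = scal C D01 c.
Proof.
have h : laurent_rep (scal O D01 c) c%:P 0.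
  by move=> a a0; rewrite evO_scal ?hornerC ?expr0 ?divr1 //; exact/D01_Some.
by rewrite (lftE h) spevC expr0 mulr1.
Qed.

Lemma lft1 : lft 1 = 1.
Proof. by rewrite -(rmorph1 (scal O D01)) lft_scal rmorph1. Qed.

Lemma lft_tc : lft (tc k) = T.
Proof.
have h : laurent_rep (tc k) 'X 0.
  by move=> a a0; rewrite evO_tc // hornerX expr0 divr1.
by rewrite (lftE h) spevX expr0 mulr1.
Qed.

Lemma coord_ex (x : C D01) : exists g, x = lft (red D01 x) + inc D01 (g *: eps).
Proof.
have /red_eq0[m mE] : red D01 (x - lft (red D01 x)) = 0.
  by rewrite rmorphB red_lft subrr.
have [g gE] := gen_ex m gen0 (@D010 k).
by exists g; rewrite /eps -gE -mE addrC subrK.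
Qed.

(** The ideal coordinate in the splitting of C(D01) determined by the lift [T0]. Another lift
    changes it by a derivation applied to the reduction. *)
Definition epart (x : C D01) : O D01 := projT1 (cid (coord_ex x)).

Lemma coordE x : x = lft (red D01 x) + inc D01 (epart x *: eps).
Proof. by rewrite /epart; case: cid. Qed.

Lemma coord_inj f g f' g' :
  lft f + inc D01 (g *: eps) = lft f' + inc D01 (g' *: eps) -> f = f' /\ g = g'.
Proof.
move=> e; have ff : f = f'.
  by have := congr1 (red D01) e; rewrite !rmorphD !red_lft !red_inc !addr0.
split=> //; move: e; rewrite ff => /addrI /ideal_inj; rewrite /eps.
by apply: (gen_inj gen0); exact: D010.
Qed.

Lemma epartE x f g : x = lft f + inc D01 (g *: eps) -> epart x = g.
Proof. by move=> xE; have := coordE x; rewrite {1}xE => /coord_inj[]. Qed.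

Lemma coord_ext x y : red D01 x = red D01 y -> epart x = epart y -> x = y.
Proof. by move=> r s; rewrite (coordE x) r s -coordE. Qed.

Fact epart_zmod : zmod_morphism epart.
Proof.
move=> x y; apply: (@epartE _ (red D01 x - red D01 y)).
rewrite {1}(coordE x) {1}(coordE y) raddfB /= scalerBl raddfB /=.
by rewrite opprD addrACA.
Qed.
HB.instance Definition _ := GRing.isZmodMorphism.Build _ _ epart epart_zmod.

(** The product of two ideal parts vanishes and [lft] is multiplicative, so [epart] is a derivation
    over the reduction map. *)
Lemma epartM x y : epart (x * y) = red D01 x * epart y + red D01 y * epart x.
Proof.
apply: (@epartE _ (red D01 x * red D01 y)).
rewrite {1}(coordE x) {1}(coordE y) lftM mulrDl !mulrDr mul_inc0 addr0.
rewrite mul_inc red_lft [inc D01 _ * _]mulrC mul_inc red_lft !scalerA.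
by rewrite -addrA -raddfD /= -scalerDl.
Qed.

Lemma epart_lft f : epart (lft f) = 0.
Proof. by apply: (@epartE _ f); rewrite scale0r raddf0 addr0. Qed.

Lemma epart_inc g : epart (inc D01 (g *: eps)) = g.
Proof. by apply: (@epartE _ 0); rewrite raddf0 add0r. Qed.

Lemma epart_scal c x : epart (scal C D01 c * x) = scal O D01 c * epart x.
Proof. by rewrite epartM -lft_scal epart_lft mulr0 addr0 red_lft. Qed.

Lemma red_scal c : red D01 (scal C D01 c) = scal O D01 c.
Proof. exact: ahom_scal. Qed.

Lemma epart1 : epart 1 = 0.
Proof. by rewrite -lft1 epart_lft. Qed.

Lemma epartX x n : epart (x ^+ n) = n%:R * red D01 x ^+ n.-1 * epart x.
Proof.
elim: n => [|n IH]; first by rewrite expr0 epart1 !mul0r.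
rewrite exprS epartM IH rmorphXn /= -natr1.
case: n {IH} => [|n] /=; first by rewrite !mul0r mulr0 !add0r mul1r expr0.
rewrite exprS; move: (red D01 x) (epart x) => r y; move: (r ^+ n) (n.+1%:R) => rn c; ring.
Qed.

Lemma from_C0P x : (exists y : C D0, x = ra D01 y) <->
  forall i : int, (i < 0)%R -> lcoef (red D01 x) i = 0 /\ lcoef (epart x) i = 0.
Proof.
split=> [[y ->] i i0|h].
  have [P PE] := chart_poly (red D0 y).
  have /red_eq0[m mE] : red D0 (y - spev T0 P) = 0.
    by rewrite rmorphB /= PE -[T0]ra_id red_spev // redT0 ra_id subrr.
  have [g gE] := gen_ex m gen0 (@subset_refl _ D0); rewrite rs_id in gE.
  have xE : ra D01 y = lft (red D01 (ra D01 y)) + inc D01 (ra D01 g *: eps).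
    rewrite -{1}(subrK (spev T0 P) y) mE raddfD /= ra_pev //; last exact: D010.
    by rewrite -lft_poly0 -PE -red_ra -inc_rs gE rsZ addrC.
  by rewrite (epartE xE) red_ra !lcoef_D0.
have [F FE] := @from_D0 _ (red D01 x) (fun i i0 => (h i i0).1).
have [G GE] := @from_D0 _ (epart x) (fun i i0 => (h i i0).2).
have [P PE] := chart_poly F.
exists (spev T0 P + inc D0 (G *: eps0)).
rewrite raddfD /= ra_pev; last exact: D010.
by rewrite -lft_poly0 -PE -FE -inc_rs rsZ -GE -coordE.
Qed.

End Coordinates.

(** * The index of the transition data of a line bundle *)

Section EulerCharacteristic.
Variables (k : closedFieldType) (C : ribbon k).
Notation O := (O_P1 k).
Notation I := (rib_ideal C).
Notation red := (rib_red C).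
Notation inc := (@rib_incl k C).
Notation D01 := (D01 k).
Notation D0 := (D0 k).
Notation D1 := (D1 k).

Variables (T0 : C D0) (eps0 : I D0) (T1 : C D1) (eps1 : I D1).
Hypotheses (redT0 : red D0 T0 = zc (chart0 k)) (gen0 : free_generator eps0).
Hypotheses (redT1 : red D1 T1 = zc (chart1 k)) (gen1 : free_generator eps1).
Variables (iota : O D01) (kap : k) (p0 : int).
Hypotheses (eps10 : rs D01 eps1 = iota *: rs D01 eps0) (kap0 : kap != 0).
Hypothesis iotaE : forall a, a != 0 -> evO iota (Some a) = kap * a ^ p0.
Variables (w : C D01) (kap' : k) (q : int).
Hypothesis kap'0 : kap' != 0.
Hypothesis redwE : forall a, a != 0 -> evO (red D01 w) (Some a) = kap' * a ^ q.

Notation eps := (rs D01 eps0).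
Let U : C D01 := ra D01 T1.
Notation sd := (epart redT0 gen0).
Notation lf := (lft redT0).

Lemma red_U : red D01 U = uc k.
Proof. by rewrite /U red_ra redT1. Qed.

Lemma evO_ucX (f : O D01) j a : a != 0 ->
  evO (uc k ^+ j * f) (Some a) = 1 * a ^ (- j%:Z) * evO f (Some a).
Proof.
move=> a0; have Da : oset D01 (Some a) by exact/D01_Some.
by rewrite evOM evOX // evO_uc // mul1r -exprnN exprVn.
Qed.

Lemma lcoef_ucX (f : O D01) j i : lcoef (uc k ^+ j * f) i = lcoef f (i + j%:Z).
Proof.
rewrite (lcoef_shift (f := f) (c := 1) (m := - j%:Z)) ?mul1r ?opprK //.
by move=> a a0; rewrite evO_ucX.
Qed.

Lemma lcoef_one (i : int) : lcoef (1 : O D01) i = (i == 0)%:R.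
Proof.
have h : laurent_rep (1 : O D01) 1 0.
  by move=> a a0; rewrite evO1 ?hornerC ?expr0 ?divr1 //; exact/D01_Some.
rewrite (lcoefE _ h) addr0 /poly_icoef; case: i => i; last by [].
by rewrite coef1.
Qed.

Lemma lcoef_redw (f : O D01) i : lcoef (red D01 w * f) i = kap' * lcoef f (i - q).
Proof. by apply: lcoef_shift => a a0; rewrite evOM redwE. Qed.

Lemma lcoef_iota (f : O D01) i : lcoef (iota * f) i = kap * lcoef f (i - p0).
Proof. by apply: lcoef_shift => a a0; rewrite evOM iotaE. Qed.

Variables (winv : C D01) (iotainv : O D01).
Hypotheses (wwinv : w * winv = 1) (iotaK : iota * iotainv = 1).

Let inE (y : C D1) : exists P (G : O D1), y = spev T1 P + inc D1 (G *: eps1).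
Proof.
have [P PE] := chart_poly (red D1 y).
have /red_eq0[m mE] : red D1 (y - spev T1 P) = 0.
  by rewrite rmorphB /= PE -[T1]ra_id red_spev // redT1 ra_id subrr.
have [g gE] := gen_ex m gen1 (@subset_refl _ D1); rewrite rs_id in gE.
by exists P, g; rewrite -gE -mE addrC subrK.
Qed.

(** By the Leibniz rule the ideal coordinate of U^j w is u^j epart(w) + j u^(j-1) red(w) epart(U),
    with u = 1/t. The two series epart(w) and epart(U) are fixed and merely shifted by about -j, so
    one [d] serves all [j]. *)
Lemma snd_powers_bound : exists d : nat, forall (j : nat) (i : int),
  (q - j%:Z + d%:Z < i)%R -> lcoef (sd (U ^+ j * w)) i = 0.
Proof.
clear kap0 kap'0; have [d1 h1] := lcoef_bound (sd w); have [d2 h2] := lcoef_bound (sd U).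
exists (d1 + d2 + `|q| + 2)%N => j i ij.
rewrite epartM lcoefD rmorphXn /= red_U lcoef_ucX h1; last by lia.
rewrite add0r lcoef_redw epartX red_U -mulrA -[j%:R]/(1 *+ j) mulrnAl mul1r.
have -> (f : O D01) n i' : lcoef (f *+ n) i' = lcoef f i' *+ n.
  exact: (raddfMn (lcoef_at i')).
case: j ij => [|j] ij; first by rewrite mulr0n mulr0.
by rewrite lcoef_ucX h2 ?mul0rn ?mulr0 //=; lia.
Qed.

(* After division by a generator over D0, the sections over D01 that extend to
   D0, resp. to D1; [w] is the transition function of the line bundle. *)
Definition M0 (x : C D01) : Prop := exists y : C D0, x = ra D01 y.
Definition M1 (x : C D01) : Prop := exists y : C D1, x = ra D01 y * w.

Lemma red_spevU P : red D01 (spev U P) = ra D01 (spev (zc (chart1 k)) P).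
Proof.
rewrite /U red_spev ?redT1 ?ra_pev //; exact: D011.
Qed.

Lemma lcoef_spev1 P (j : nat) :
  lcoef (ra D01 (spev (zc (chart1 k)) P)) (- j%:Z) = P`_j.
Proof.
rewrite ra_pev; last exact: D011.
rewrite -/(uc k) /spev /pev lcoef_sum.
have -> : P`_j = \sum_(i < size P) P`_i * (i == j :> nat)%:R.
  case: (ltnP j (size P)) => jP.
    rewrite (bigD1 (Ordinal jP)) //= eqxx mulr1 big1 ?addr0 // => i ij.
    by rewrite (_ : _ == _ = false) ?mulr0 //; apply/negbTE.
  rewrite nth_default // big1 // => i _.
  by rewrite (_ : _ == _ = false) ?mulr0 //; have := ltn_ord i; lia.
apply: eq_bigr => i _; rewrite lcoef_scal -[uc k ^+ _]mulr1 lcoef_ucX lcoef_one.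
by congr (_ * (_ : bool)%:R); lia.
Qed.

(** [iota] and [w] convert the frame of D1 to that of D0. The ideal coordinate of [spev U P * w] is
    left unexpanded: only bounds on it are available. *)
Lemma M1_coords y P G : y = spev T1 P + inc D1 (G *: eps1) ->
  red D01 (ra D01 y * w) = ra D01 (spev (zc (chart1 k)) P) * red D01 w /\
  sd (ra D01 y * w) = sd (spev U P * w) + red D01 w * (iota * ra D01 G).
Proof.
move=> ->; have yE : ra D01 (spev T1 P + inc D1 (G *: eps1)) =
    spev U P + inc D01 ((ra D01 G * iota) *: eps).
  by rewrite raddfD /= ra_pev -?inc_rs ?rsZ ?eps10 ?scalerA //; exact: D011.
rewrite yE; split; first by rewrite rmorphM raddfD /= red_inc addr0 red_spevU.
rewrite mulrDl raddfD /= [inc _ _ * w]mulrC mul_inc scalerA.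
by rewrite [in X in _ + X]epart_inc [ra D01 G * _]mulrC.
Qed.

Lemma M1_red x i : M1 x -> (q < i)%R -> lcoef (red D01 x) i = 0.
Proof.
move=> [y ->] qi; have [P [G yE]] := inE y.
have [-> _] := M1_coords yE.
by rewrite mulrC lcoef_redw lcoef_D1 ?mulr0 // Num.Theory.subr_gt0.
Qed.

(** A zero reduction forces the polynomial part in [T1] to vanish, so the uncontrolled term of
    [M1_coords] disappears and only the ideal part remains, of order at most p0 + q. *)
Lemma M1_red0 x i : M1 x -> red D01 x = 0 -> (p0 + q < i)%R -> lcoef (sd x) i = 0.
Proof.
move=> [y ->] x0 pi; have [P [G yE]] := inE y.
have [rE ->] := M1_coords yE.
have P0 : P = 0.
  have /(congr1 ( *%R^~ (red D01 winv))) := rE.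
  rewrite /= x0 mul0r -mulrA -rmorphM wwinv rmorph1 mulr1 => e.
  by apply/polyP => j; rewrite coef0 -lcoef_spev1 -e lcoef0.
rewrite P0 raddf0 mul0r raddf0 add0r lcoef_redw lcoef_iota lcoef_D1 ?mulr0 //.
by move: pi; clear; lia.
Qed.

Section Window.
Variables (d a b : nat).
Hypothesis dP : forall (j : nat) (i : int),
  (q - j%:Z + d%:Z < i)%R -> lcoef (sd (U ^+ j * w)) i = 0.
Hypotheses (bp : (- b%:Z <= p0 + q)%R) (aq : (- a%:Z <= q)%R) (ab : (b + d <= a)%N).
Hypotheses (a0 : (0 < a)%N) (b0 : (0 < b)%N).

(** Only powers U^j with q - j <= -a can occur, and [dP] confines their ideal coordinates to
    exponents at most q - j + d <= d - a <= -b <= p0 + q. At this depth the discrepancy between the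
    two lifts is harmless. *)
Lemma M1_snd x : M1 x -> (forall i : int, (- a%:Z < i)%R -> lcoef (red D01 x) i = 0) ->
  forall i : int, (p0 + q < i)%R -> lcoef (sd x) i = 0.
Proof.
move=> [y ->] hx i pi; have [P [G yE]] := inE y.
have [rE ->] := M1_coords yE.
rewrite lcoefD lcoef_redw lcoef_iota lcoef_D1 ?mulr0 ?addr0; last by lia.
rewrite /spev /pev mulr_suml raddf_sum lcoef_sum big1 // => j _.
rewrite /= -mulrA epart_scal lcoef_scal.
case: (eqVneq P`_j 0) => [->|Pj0]; first by rewrite mul0r.
rewrite (_ : lcoef _ _ = 0) ?mulr0 //; apply: dP.
have key (n : nat) : (q - n%:Z <= - a%:Z)%R -> (q - n%:Z + d%:Z < i)%R.
  by move: bp ab pi; clear; lia.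
apply: key.
rewrite leNgt; apply/negP => aj; move: (hx (q - j%:Z) aj).
rewrite rE mulrC lcoef_redw addrAC subrr add0r lcoef_spev1 => /eqP.
by rewrite mulf_eq0 (negbTE kap'0) (negbTE Pj0).
Qed.

(* Only very negative powers of the coordinate: a lattice small enough to lie
   in [M1] and to meet [M0] trivially, and standard enough for both [M1/Nsub] and
   [C(D01)/(M0 + Nsub)] to have monomial bases. *)
Definition Nsub (x : C D01) : Prop :=
  (forall i : int, (- a%:Z < i)%R -> lcoef (red D01 x) i = 0) /\
  (forall i : int, (- b%:Z < i)%R -> lcoef (sd x) i = 0).

Lemma lcoef_redwinv (f : O D01) i :
  lcoef (red D01 winv * f) i = kap'^-1 * lcoef f (i + q).
Proof.
have wE : red D01 w * (red D01 winv * f) = f.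
  by rewrite mulrA -rmorphM wwinv rmorph1 mul1r.
by rewrite -{2}wE lcoef_redw addrK mulKf.
Qed.

Lemma lcoef_iotainv (f : O D01) i :
  lcoef (iotainv * f) i = kap^-1 * lcoef f (i + p0).
Proof.
have wE : iota * (iotainv * f) = f by rewrite mulrA iotaK mul1r.
by rewrite -{2}wE lcoef_iota addrK mulKf.
Qed.

(** A polynomial in [T1] first realizes the reduction; by [M1_snd] the remaining error lies in
    exponents at most p0 + q, where a multiple of [eps1] over D1 absorbs it. *)
Lemma Nsub_M1 x : Nsub x -> M1 x.
Proof.
move=> [hr hs].
have [i i0|F FE] := @from_D1 _ (red D01 winv * red D01 x).
  by rewrite lcoef_redwinv hr ?mulr0 //; lia.
have [P PE] := chart_poly F.
have redE : red D01 (spev U P * w) = red D01 x.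
  rewrite rmorphM red_spevU -PE -FE mulrAC -rmorphM [winv * w]mulrC wwinv.
  by rewrite rmorph1 mul1r.
have M1P : M1 (spev U P * w).
  by exists (spev T1 P); rewrite ra_pev; [|exact: D011].
have sP i : (p0 + q < i)%R -> lcoef (sd (spev U P * w)) i = 0.
  by apply: (M1_snd M1P) => j aj; rewrite redE hr.
pose g := iotainv * (red D01 winv * (sd x - sd (spev U P * w))).
have [i i0|G GE] := @from_D1 _ g.
  rewrite /g lcoef_iotainv lcoef_redwinv lcoefB sP ?hs ?subr0 ?mulr0 //; lia.
exists (spev T1 P + inc D1 (G *: eps1)).
have [rE sE] := M1_coords (erefl (spev T1 P + inc D1 (G *: eps1))).
apply: (coord_ext (redT0 := redT0) (gen0 := gen0)).
  by rewrite rE -redE rmorphM red_spevU.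
rewrite sE -GE /g [iota * _]mulrA iotaK mul1r mulrA -rmorphM wwinv rmorph1 mul1r.
by rewrite addrC subrK.
Qed.

Notation scal01 := (scal C D01).
Notation W := ((C D01)^o : lmodType (C D01)).

Lemma M0_subspace : @subspace k (C D01) scal01 W M0.
Proof.
split; first by exists 0; rewrite raddf0.
  by move=> _ _ [y ->] [z ->]; exists (y - z); rewrite raddfB.
move=> c _ [y ->]; exists (scal C D0 c * y).
by rewrite raM ra_scal //; exact: D010.
Qed.

Lemma M1_subspace : @subspace k (C D01) scal01 W M1.
Proof.
split; first by exists 0; rewrite raddf0 mul0r.
  by move=> _ _ [y ->] [z ->]; exists (y - z); rewrite raddfB mulrBl.
move=> c _ [y ->]; exists (scal C D1 c * y).
by rewrite raM (ra_scal _ _ (@D011 k)) -mulrA.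
Qed.

Lemma lcoef_red_scal c x i : lcoef (red D01 (scal01 c * x)) i = c * lcoef (red D01 x) i.
Proof. by rewrite rmorphM red_scal lcoef_scal. Qed.

Lemma lcoef_sd_scal c x i : lcoef (sd (scal01 c * x)) i = c * lcoef (sd x) i.
Proof. by rewrite epart_scal lcoef_scal. Qed.

Lemma Nsub_subspace : @subspace k (C D01) scal01 W Nsub.
Proof.
split; first by split=> i _; rewrite raddf0 lcoef0.
  move=> x y [hx hx'] [hy hy']; split=> i ai.
    by rewrite raddfB lcoefB hx ?hy ?subr0.
  by rewrite raddfB lcoefB hx' ?hy' ?subr0.
move=> c x [hx hx']; split=> i ai.
  by rewrite [LHS]lcoef_red_scal hx ?mulr0.
by rewrite [LHS]lcoef_sd_scal hx' ?mulr0.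
Qed.

Lemma M0_Nsub x : M0 x -> Nsub x -> x = 0.
Proof.
move=> /(from_C0P redT0 gen0) h [hr hs].
apply: (coord_ext (redT0 := redT0) (gen0 := gen0)); rewrite raddf0.
  apply: laurent_eq0 => i; case: (ltP i 0) => i0; first by case: (h i i0).
  by apply: hr; lia.
apply: laurent_eq0 => i; case: (ltP i 0) => i0; first by case: (h i i0).
by apply: hs; lia.
Qed.

Lemma M0_sum_Nsub x : @sum_sub (C D01) W M0 Nsub x <->
  (forall i : int, (- a%:Z < i < 0)%R -> lcoef (red D01 x) i = 0) /\
  (forall i : int, (- b%:Z < i < 0)%R -> lcoef (sd x) i = 0).
Proof.
split=> [[y [z [/(from_C0P redT0 gen0) hy [hr hs] ->]]]|[hr hs]].
  split=> i /andP[ai i0]; rewrite raddfD lcoefD.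
    by rewrite (hy i i0).1 hr ?addr0.
  by rewrite (hy i i0).2 hs ?addr0.
pose S (i : int) := (0 <= i)%R; pose S' (i : int) := (i < 0)%R.
have [f fE] := laurent_trunc S (red D01 x).
have [f' f'E] := laurent_trunc S' (red D01 x).
have [g gE] := laurent_trunc S (sd x).
have [g' g'E] := laurent_trunc S' (sd x).
have split_sum (h h1 h2 : O D01) :
    (forall i, lcoef h1 i = if S i then lcoef h i else 0) ->
    (forall i, lcoef h2 i = if S' i then lcoef h i else 0) -> h = h1 + h2.
  move=> e e'; apply: laurent_eq => i; rewrite lcoefD e e' /S /S'.
  by case: (ltP i 0) => _; rewrite ?addr0 ?add0r.
exists (lf f + inc D01 (g *: eps)), (lf f' + inc D01 (g' *: eps)); split.
- apply/(from_C0P redT0 gen0) => i i0.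
  rewrite rmorphD /= red_lft red_inc addr0 fE raddfD /= epart_lft epart_inc add0r gE /S.
  by rewrite leNgt i0.
- split=> i ai; rewrite raddfD /= ?red_lft ?red_inc ?epart_lft ?epart_inc.
    rewrite addr0 f'E /S'; case: ifP => // i0; apply: hr; exact/andP.
  rewrite add0r g'E /S'; case: ifP => // i0; apply: hs; exact/andP.
- rewrite addrACA -(raddfD lf) -raddfD -scalerDl /=.
  by rewrite -(split_sum _ _ _ fE f'E) -(split_sum _ _ _ gE g'E) -coordE.
Qed.

Lemma delta_sum n (F : 'I_n -> k) c (e : int) (j : 'I_n) :
  \sum_(l < n) F l * (c * (e - j%:Z == e - l%:Z)%:R) = F j * c.
Proof.
rewrite (bigD1 j) //= eqxx mulr1 big1 ?addr0 // => l lj.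
rewrite (_ : (_ == _) = false) ?mulr0 //; apply/negbTE.
by apply: contra lj => /eqP lj; apply/eqP/val_inj => /=; lia.
Qed.

Lemma delta_sum0 n (F : 'I_n -> k) c (e i : int) :
  (forall j : 'I_n, i <> e - j%:Z) ->
  \sum_(l < n) F l * (c * (i == e - l%:Z)%:R) = 0.
Proof.
move=> h; rewrite big1 // => l _.
by rewrite (_ : (_ == _) = false) ?mulr0 //; apply/eqP/h.
Qed.

Lemma lcoef_red_lincomb n (v : 'I_n -> W) c i :
  lcoef (red D01 (lincomb scal01 v c)) i = \sum_(l < n) c 0 l * lcoef (red D01 (v l)) i.
Proof.
rewrite /lincomb rmorph_sum lcoef_sum; apply: eq_bigr => l _.
exact: lcoef_red_scal.
Qed.

Lemma lcoef_sd_lincomb n (v : 'I_n -> W) c i :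
  lcoef (sd (lincomb scal01 v c)) i = \sum_(l < n) c 0 l * lcoef (sd (v l)) i.
Proof.
rewrite /lincomb raddf_sum lcoef_sum; apply: eq_bigr => l _.
exact: lcoef_sd_scal.
Qed.

Lemma lcoef_ucn (j : nat) i : lcoef (uc k ^+ j) i = (i == - j%:Z)%:R.
Proof.
rewrite -[uc k ^+ j]mulr1 lcoef_ucX lcoef_one; congr (_ : bool)%:R.
by rewrite addr_eq0.
Qed.

(** One monomial for each exponent strictly between -a and 0 in the reduction, and strictly between
    -b and 0 in the ideal coordinate. *)
Definition coker_basis (i : 'I_(a.-1 + b.-1)) : W :=
  match fintype.split i with
  | inl j => lf (uc k ^+ j.+1)
  | inr j => inc D01 (uc k ^+ j.+1 *: eps)
  end.

Lemma split_lshift m n (j : 'I_m) : fintype.split (lshift n j) = inl j.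
Proof. exact: (unsplitK (inl j)). Qed.

Lemma split_rshift m n (j : 'I_n) : fintype.split (rshift m j) = inr j.
Proof. exact: (unsplitK (inr j)). Qed.

Lemma lcoef_red_coker c i : lcoef (red D01 (lincomb scal01 coker_basis c)) i =
  \sum_(l < a.-1) c 0 (lshift _ l) * (1 * (i == -1 - l%:Z)%:R).
Proof.
rewrite lcoef_red_lincomb big_split_ord /= [X in _ + X]big1 ?addr0 => [|l _].
  apply: eq_bigr => l _; rewrite /coker_basis split_lshift red_lft lcoef_ucn mul1r.
  by congr (_ * (_ : bool)%:R); lia.
by rewrite /coker_basis split_rshift red_inc lcoef0 mulr0.
Qed.

Lemma lcoef_sd_coker c i : lcoef (sd (lincomb scal01 coker_basis c)) i =
  \sum_(l < b.-1) c 0 (rshift _ l) * (1 * (i == -1 - l%:Z)%:R).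
Proof.
rewrite lcoef_sd_lincomb big_split_ord /= big1 ?add0r => [|l _].
  apply: eq_bigr => l _; rewrite /coker_basis split_rshift epart_inc lcoef_ucn mul1r.
  by congr (_ * (_ : bool)%:R); lia.
by rewrite /coker_basis split_lshift epart_lft lcoef0 mulr0.
Qed.

Lemma coker_basisP : basis_mod scal01 (fun=> True) (@sum_sub (C D01) W M0 Nsub) coker_basis.
Proof.
split=> // x _.
pose c : 'rV_(a.-1 + b.-1) := row_mx (\row_j lcoef (red D01 x) (-1 - j%:Z))
                                      (\row_j lcoef (sd x) (-1 - j%:Z)).
exists c; split=> [|c' /M0_sum_Nsub[hr hs]].
  apply/M0_sum_Nsub; split=> i /andP[ai i0]; rewrite raddfB lcoefB.
    rewrite lcoef_red_coker; have ja : (`|(-1 - i)%R| < a.-1)%N by lia.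
    have iE : i = -1 - (Ordinal ja : nat)%:Z by rewrite /=; lia.
    by rewrite [in X in _ - X]iE delta_sum row_mxEl mxE mulr1 -iE subrr.
  rewrite lcoef_sd_coker; have ja : (`|(-1 - i)%R| < b.-1)%N by lia.
  have iE : i = -1 - (Ordinal ja : nat)%:Z by rewrite /=; lia.
  by rewrite [in X in _ - X]iE delta_sum row_mxEr mxE mulr1 -iE subrr.
rewrite -[c']hsubmxK; congr row_mx; apply/rowP => j; rewrite !mxE.
  have /hr : (- a%:Z < -1 - j%:Z < 0)%R by have := ltn_ord j; lia.
  by rewrite raddfB lcoefB lcoef_red_coker delta_sum mulr1 => /eqP; rewrite subr_eq0 => /eqP.
have /hs : (- b%:Z < -1 - j%:Z < 0)%R by have := ltn_ord j; lia.
by rewrite raddfB lcoefB lcoef_sd_coker delta_sum mulr1 => /eqP; rewrite subr_eq0 => /eqP.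
Qed.

(** [A1] counts the exponents in ]-a, q] and [A2] those in ]-b, p0 + q]; by [aq] and [bp] the
    absolute values are only conversions to [nat]. *)
Let A1 : nat := `|(q + a%:Z)%R|%N.
Let A2 : nat := `|(p0 + q + b%:Z)%R|%N.

Definition M1_basis (i : 'I_(A1 + A2)) : W :=
  match fintype.split i with
  | inl j => U ^+ j * w
  | inr j => inc D01 ((uc k ^+ j * iota) *: eps) * w
  end.

Lemma M1_basis_M1 i : M1 (M1_basis i).
Proof.
rewrite /M1_basis; case: fintype.split => j.
  by exists (T1 ^+ j); rewrite raXn //; exact: D011.
exists (inc D1 (zc (chart1 k) ^+ j *: eps1)); rewrite -inc_rs rsZ eps10 scalerA.
by rewrite raXn //; exact: D011.
Qed.

Lemma lcoef_red_M1 c i : lcoef (red D01 (lincomb scal01 M1_basis c)) i =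
  \sum_(l < A1) c 0 (lshift _ l) * (kap' * (i == q - l%:Z)%:R).
Proof.
rewrite lcoef_red_lincomb big_split_ord /= [X in _ + X]big1 ?addr0 => [|l _].
  apply: eq_bigr => l _; rewrite /M1_basis split_lshift rmorphM.
  rewrite [red D01 _ * _]mulrC lcoef_redw rmorphXn /= red_U lcoef_ucn.
  by congr (_ * (_ * (_ : bool)%:R)); lia.
by rewrite /M1_basis split_rshift rmorphM red_inc mul0r lcoef0 mulr0.
Qed.

(** The elements U^j w have ideal coordinates that are not explicit, so a formula is possible only
    once their coefficients vanish. *)
Lemma lcoef_sd_M1 (c : 'rV_(A1 + A2)) i : (forall l, c 0 (lshift _ l) = 0) ->
  lcoef (sd (lincomb scal01 M1_basis c)) i =
  \sum_(l < A2) c 0 (rshift _ l) * (kap' * kap * (i == p0 + q - l%:Z)%:R).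
Proof.
move=> c0; rewrite lcoef_sd_lincomb big_split_ord /= big1 ?add0r => [|l _]; last first.
  by rewrite c0 mul0r.
apply: eq_bigr => l _; rewrite /M1_basis split_rshift [inc _ _ * w]mulrC.
rewrite mul_inc scalerA epart_inc lcoef_redw [uc k ^+ l * _]mulrC lcoef_iota lcoef_ucn.
by rewrite !mulrA; congr (_ * (_ : bool)%:R); lia.
Qed.

(** The system is triangular: [c1] is read off the reduction, and [c2] off the ideal coordinate of
    the remainder [x1], whose reduction is already deep enough for [M1_snd]. *)
Lemma M1_basisP : @basis_mod k (C D01) scal01 W M1 Nsub _ M1_basis.
Proof.
split=> [|x M1x]; first exact: M1_basis_M1.
have kk0 : kap' * kap != 0 by rewrite mulf_neq0.
have s1 := M1_subspace.
have M1l c : M1 (lincomb scal01 M1_basis c).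
  by apply: (subspace_bigsum s1) => i; apply: (subspaceZ s1); exact: M1_basis_M1.
pose c1 := \row_(j < A1) (lcoef (red D01 x) (q - j%:Z) / kap').
pose x1 : C D01 := x - lincomb scal01 M1_basis (row_mx c1 0).
have M1x1 : M1 x1 by exact: (subspaceB s1).
have rx1 (i : int) : (- a%:Z < i)%R -> lcoef (red D01 x1) i = 0.
  move=> ai; case: (ltP q i) => qi; first exact: M1_red M1x1 qi.
  have ja : (`|(q - i)%R| < A1)%N by rewrite /A1; lia.
  have iE : i = q - (Ordinal ja : nat)%:Z by rewrite /=; lia.
  rewrite /x1 raddfB lcoefB lcoef_red_M1 [in X in _ - X]iE delta_sum row_mxEl mxE -iE.
  by rewrite divfK // subrr.
pose c2 := \row_(j < A2) (lcoef (sd x1) (p0 + q - j%:Z) / (kap' * kap)).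
have x1E : x - lincomb scal01 M1_basis (row_mx c1 c2) =
    x1 - lincomb scal01 M1_basis (row_mx 0 c2) :> C D01.
  rewrite /x1 -addrA -opprD -(raddfD (lincomb scal01 M1_basis)).
  by rewrite add_row_mx addr0 add0r.
have l0 l : (row_mx 0 c2 : 'rV_(A1 + A2)) 0 (lshift _ l) = 0.
  by rewrite row_mxEl mxE.
have hN : Nsub (x - lincomb scal01 M1_basis (row_mx c1 c2)).
  rewrite x1E; split=> i ai.
    rewrite raddfB lcoefB rx1 // lcoef_red_M1 big1 ?subr0 // => l _.
    by rewrite l0 mul0r.
  rewrite raddfB lcoefB lcoef_sd_M1 //; case: (ltP (p0 + q) i) => pi.
    rewrite (M1_snd M1x1 rx1 pi) delta_sum0 ?subr0 // => j ij.
    by move: pi; rewrite ij; clear; lia.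
  have ja : (`|(p0 + q - i)%R| < A2)%N by rewrite /A2; lia.
  have iE : i = p0 + q - (Ordinal ja : nat)%:Z by rewrite /=; lia.
  rewrite [in X in _ - X]iE delta_sum row_mxEr mxE -iE.
  by rewrite divfK // subrr.
exists (row_mx c1 c2); split=> // c' hc'; apply/eqP; rewrite eq_sym -subr_eq0; apply/eqP.
set e := c' - _.
have : Nsub (lincomb scal01 M1_basis e).
  rewrite /e raddfB /=; apply: (subspace_trans Nsub_subspace (y := x)) => //.
  exact: (subspace_sym Nsub_subspace).
move=> [hr hs].
have e1 l : e 0 (lshift _ l) = 0.
  have /hr : (- a%:Z < q - l%:Z)%R by have := ltn_ord l; rewrite /A1; lia.
  by rewrite lcoef_red_M1 delta_sum => /eqP; rewrite mulf_eq0 (negbTE kap'0) orbF => /eqP.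
have e2 l : e 0 (rshift _ l) = 0.
  have /hs : (- b%:Z < p0 + q - l%:Z)%R by have := ltn_ord l; rewrite /A2; lia.
  by rewrite lcoef_sd_M1 // delta_sum => /eqP; rewrite mulf_eq0 (negbTE kk0) orbF => /eqP.
rewrite -[e]hsubmxK -[RHS](@row_mx0 _ 1); congr row_mx; apply/rowP => j;
  rewrite [LHS]mxE [RHS]mxE; [exact: e1|exact: e2].
Qed.

(** The count A1 + A2 - (a - 1) - (b - 1) no longer involves the window. It equals (q + 1) + (p0 + q
    + 1), the sum of the Euler characteristics of O(q) and O(p0 + q). *)
Lemma index_window h0 h1 (v : 'I_h0 -> W) (u : 'I_h1 -> W) :
  @basis_mod k (C D01) scal01 W (fun x => M0 x /\ M1 x) (fun x => x = 0) _ v ->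
  basis_mod scal01 (fun=> True) (@sum_sub (C D01) W M0 M1) u ->
  h0%:Z - h1%:Z = p0 + q + q + 2%:Z.
Proof.
move=> bv bu.
have := index_formula M0_subspace M1_subspace Nsub_subspace Nsub_M1 M0_Nsub
  M1_basisP coker_basisP bv bu.
rewrite /A1 /A2; lia.
Qed.

End Window.
End EulerCharacteristic.

(** * From the index to Euler characteristics of line bundles *)

Section EulerLine.
Variables (k : closedFieldType) (C : ribbon k).
Notation O := (O_P1 k).
Notation I := (rib_ideal C).
Notation red := (rib_red C).
Notation D01 := (D01 k).
Notation D0 := (D0 k).
Notation D1 := (D1 k).
Notation W := ((C D01)^o : lmodType (C D01)).

Lemma gen_change (A : algSheaf k (P1 k)) (M : modSheaf A) (e0 : M D0) (e1 : M D1) :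
  free_generator e0 -> free_generator e1 ->
  exists w winv : A D01, w * winv = 1 /\ rs D01 e1 = w *: rs D01 e0.
Proof.
move=> g0 g1; have [w wE] := gen_ex (rs D01 e1) g0 (@D010 k).
have [v vE] := gen_ex (rs D01 e0) g1 (@D011 k).
exists w, v; split=> //; apply: (gen_inj g1 (@D011 k)).
by rewrite scale1r -scalerA -vE -wE.
Qed.

Section Line.
Variables (L : modSheaf C) (e0 : L D0) (e1 : L D1) (w : C D01).
Hypotheses (g0 : free_generator e0) (g1 : free_generator e1).
Hypothesis wE : rs D01 e1 = w *: rs D01 e0.
Hypothesis L_line : line_bundle L.

Definition crd (m : L D01) : C D01 := projT1 (cid (gen_ex m g0 (@D010 k))).

Lemma crdE m : m = crd m *: rs D01 e0.
Proof. by rewrite /crd; case: cid. Qed.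

Lemma crdZ a : crd (a *: rs D01 e0) = a.
Proof. by apply: (gen_inj g0 (@D010 k)); rewrite -crdE. Qed.

Lemma crd_unique m a : m = a *: rs D01 e0 -> crd m = a.
Proof. by move=> ->; exact: crdZ. Qed.

Fact crd_zmod : zmod_morphism crd.
Proof. by move=> m n; apply: crd_unique; rewrite scalerBl -!crdE. Qed.
HB.instance Definition _ := GRing.isZmodMorphism.Build _ _ crd crd_zmod.

Lemma crd_scale a m : crd (a *: m) = a * crd m.
Proof. by apply: crd_unique; rewrite -scalerA -crdE. Qed.

Lemma crd_rs0 (m : L D0) a : m = a *: e0 -> crd (rs D01 m) = ra D01 a.
Proof. by move=> ->; rewrite rsZ crdZ. Qed.

Lemma crd_rs1 (m : L D1) a : m = a *: e1 -> crd (rs D01 m) = ra D01 a * w.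
Proof. by move=> ->; rewrite rsZ wE scalerA crdZ. Qed.

Lemma gen_ex0 (m : L D0) : exists a, m = a *: e0.
Proof. by have [a] := gen_ex m g0 (@subset_refl _ _); rewrite rs_id; exists a. Qed.

Lemma gen_ex1 (m : L D1) : exists a, m = a *: e1.
Proof. by have [a] := gen_ex m g1 (@subset_refl _ _); rewrite rs_id; exists a. Qed.

Definition gcrd (m : L (oT _)) : C D01 := crd (rs D01 m).

Lemma subT (U : opens (P1 k)) : U `<=` oT (P1 k). Proof. by []. Qed.

Lemma gcrd_eq0 m : gcrd m = 0 -> m = 0.
Proof.
move=> m0; apply: (line_restr_inj L_line (@subT D01) (D01_neq0 k)).
by rewrite (crdE (rs _ m)) -/(gcrd m) m0 scale0r.
Qed.

Lemma gcrd_M0 m : M0 (gcrd m).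
Proof.
have [y yE] := gen_ex0 (rs D0 m); exists y.
by rewrite -(crd_rs0 yE) rs_rs //; exact: D010.
Qed.

Lemma gcrd_M1 m : M1 w (gcrd m).
Proof.
have [y yE] := gen_ex1 (rs D1 m); exists y.
by rewrite -(crd_rs1 yE) rs_rs //; exact: D011.
Qed.

Lemma gcrd_surj x : M0 x -> M1 w x -> exists m, gcrd m = x.
Proof.
move=> [y0 y0E] [y1 y1E].
have [||||m [m0 _]] := @glue2 _ _ _ L (oT _) D0 D1 (y0 *: e0) (y1 *: e1).
- exact: subT.
- exact: subT.
- by move=> x0 _; exact: cover_charts.
- by rewrite -D01_meet !rsZ wE scalerA -y1E y0E.
by exists m; rewrite /gcrd -(rs_rs _ (@D010 k) (@subT _)) (crd_rs0 m0).
Qed.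

Fact gcrd_zmod : zmod_morphism gcrd.
Proof. by move=> m n; rewrite /gcrd !raddfB. Qed.
HB.instance Definition _ := GRing.isZmodMorphism.Build _ _ gcrd gcrd_zmod.

Lemma gcrd_scal c m : gcrd (scal C _ c *: m) = scal C _ c * gcrd m.
Proof. by rewrite /gcrd rsZ crd_scale ra_scal //; exact: subT. Qed.

(** [gcrd] identifies global sections with the intersection of [M0] and [M1]: it is injective
    because sections are determined on a nonempty open set, and surjective by gluing. *)
Lemma H0_basis h0 : dim_H0 L h0 -> exists v : 'I_h0 -> W,
  @basis_mod k _ (scal C D01) W (fun x => M0 x /\ M1 w x) (fun x => x = 0) _ v.
Proof.
move=> [v vP]; exists (fun i => gcrd (v i)); split.
  by move=> i; split; [exact: gcrd_M0|exact: gcrd_M1].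
move=> x [x0 x1]; have [m <-] := gcrd_surj x0 x1.
have lE (c : 'rV_h0) : gcrd (m - \sum_(i < h0) scal C _ (c 0 i) *: v i) =
    gcrd m - @lincomb k _ (scal C D01) W _ (fun i => gcrd (v i)) c.
  rewrite raddfB raddf_sum /=; congr (_ - _); apply: eq_bigr => i _.
  exact: gcrd_scal.
have [c [cE u]] := vP m; exists c; split.
  by rewrite -lE cE raddf0.
by move=> d; rewrite -lE => /gcrd_eq0 dE; apply: u.
Qed.

Lemma coboundaryP (m : L D01) :
  cech_coboundary m <-> @sum_sub _ W (@M0 k C) (M1 w) (crd m).
Proof.
split=> [[a [b ->]]|[_ [_ [[y ->] [z ->] e]]]].
  rewrite !rsE raddfB /=.
  have [y yE] := gen_ex0 a; have [z zE] := gen_ex1 b.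
  rewrite (crd_rs0 yE) (crd_rs1 zE).
  exists (- ra D01 y), (ra D01 z * w); split; last by rewrite addrC.
    by exists (- y); rewrite raddfN.
  by exists z.
exists (- (y *: e0)), (z *: e1); rewrite !rsE raddfN opprK /= (crdE m) e scalerDl addrC.
by rewrite !rsZ wE scalerA.
Qed.

Lemma H1_basis h1 : dim_H1 L h1 -> exists u : 'I_h1 -> W,
  @basis_mod k _ (scal C D01) W (fun=> True) (@sum_sub _ W (@M0 k C) (M1 w)) _ u.
Proof.
move=> [u uP]; exists (fun i => crd (u i)); split=> // x _.
have lE (c : 'rV_h1) : crd (x *: rs D01 e0 - \sum_(i < h1) scal C _ (c 0 i) *: u i) =
    x - @lincomb k _ (scal C D01) W _ (fun i => crd (u i)) c.
  rewrite raddfB raddf_sum /= crdZ; congr (_ - _); apply: eq_bigr => i _.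
  exact: crd_scale.
have [c [cE uu]] := uP (x *: rs D01 e0); exists c; split.
  by rewrite -lE; apply/coboundaryP.
by move=> d; rewrite -lE => /coboundaryP; exact: uu.
Qed.

End Line.

(** All choices on the two charts, with the transition function of the ideal; its exponent [if_p] is
    the degree of the ideal on P^1. *)
Record ideal_frame := IdealFrame {
  if_T0 : C D0;
  if_T1 : C D1;
  if_eps0 : I D0;
  if_eps1 : I D1;
  if_red0 : red D0 if_T0 = zc (chart0 k);
  if_red1 : red D1 if_T1 = zc (chart1 k);
  if_gen0 : free_generator if_eps0;
  if_gen1 : free_generator if_eps1;
  if_iota : O D01;
  if_iotainv : O D01;
  if_iotaK : if_iota * if_iotainv = 1;
  if_eps10 : rs D01 if_eps1 = if_iota *: rs D01 if_eps0;
  if_kap : k;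
  if_p : int;
  if_kap0 : if_kap != 0;
  if_iotaE : forall a, a != 0 -> evO if_iota (Some a) = if_kap * a ^ if_p
}.

Lemma ideal_frame_ex : exists F : ideal_frame, True.
Proof.
have [T0 T0E] := coord_lift C (chart0 k); have [T1 T1E] := coord_lift C (chart1 k).
have [eps0 g0] := ideal_trivial C (chart0 k); have [eps1 g1] := ideal_trivial C (chart1 k).
have [iota [iotai [ii ee]]] := gen_change g0 g1.
have [kap [p [kap0 iE]]] := laurent_unit ii.
by exists (IdealFrame T0E T1E g0 g1 ii ee kap0 iE).
Qed.

Lemma euler_line (F : ideal_frame) (L : modSheaf C) (e0 : L D0) (e1 : L D1)
    (w winv : C D01) kap q c :
  line_bundle L -> free_generator e0 -> free_generator e1 ->
  rs D01 e1 = w *: rs D01 e0 -> w * winv = 1 -> kap != 0 ->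
  (forall a, a != 0 -> evO (red D01 w) (Some a) = kap * a ^ q) ->
  euler_char L c -> c = if_p F + q + q + 2%:Z.
Proof.
move=> lL g0 g1 wE ww kap0 redwE [h0 [h1 [H0 H1 ->]]].
have [v bv] := H0_basis g0 g1 wE lL H0.
have [u bu] := H1_basis g0 g1 wE H1.
have [d dP] := snd_powers_bound (if_red0 F) (if_gen0 F) (if_red1 F) redwE.
(* Chosen to meet the window conditions: -b <= p + q with b positive, then b + d <= a and -a <=
   q. *)
pose b := (`|(if_p F + q)%R| + 1)%N.
pose a := (b + d + `|q|)%N.
apply: (index_window (if_red1 F) (if_gen1 F) (if_eps10 F)
  (if_kap0 F) (@if_iotaE F) kap0 redwE ww (if_iotaK F) (a := a) (b := b)
  dP _ _ _ _ _ bv bu); rewrite /a /b; lia.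
Qed.

End EulerLine.

(** * Global sections *)

Section H0.
Variables (k : closedFieldType) (C : ribbon k).
Notation O := (O_P1 k).
Notation I := (rib_ideal C).
Notation red := (rib_red C).
Notation D01 := (D01 k).
Notation D0 := (D0 k).
Notation D1 := (D1 k).

Lemma regMod_gen1 (A : algSheaf k (P1 k)) (U : opens (P1 k)) :
  free_generator (1 : regMod A U).
Proof.
apply/genP => V VU m; have e : rs V (1 : regMod A U) = 1 by exact: (@ra1 _ _ A).
rewrite e; exists m; split; first by apply: esym; exact: mulr1.
by move=> a ->; exact: mulr1.
Qed.

Lemma regMod_line_bundle (A : algSheaf k (P1 k)) : line_bundle (regMod A).
Proof. by move=> x; exists (oT _), 1; split=> //; exact: regMod_gen1. Qed.

(** The structure sheaf has transition function 1, hence q = 0, and its Euler characteristic 1 - g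
    equals p + 2. *)
Lemma frame_degree (F : ideal_frame C) (g : nat) : has_genus C g ->
  if_p F = - g%:Z - 1.
Proof.
move=> hg; have e0 : rs D01 (1 : regMod C D1) = (1 : C D01) *: rs D01 (1 : regMod C D0).
  by rewrite -!ra_rs !ra1 ?scale1r //; [exact: D010|exact: D011].
have red1 (a : k) : a != 0 -> evO (red D01 1) (Some a) = 1 * a ^ (0 : int).
  by move=> a0; rewrite rmorph1 evO1 ?expr0z ?mulr1 //; exact/D01_Some.
have := euler_line F (@regMod_line_bundle C) (@regMod_gen1 C _) (@regMod_gen1 C _) e0
  (mulr1 1) (oner_neq0 k) red1 hg.
by clear; lia.
Qed.

(** The difference of the Euler characteristics p + 2q + 2 and p + 2 is 2q. *)
Lemma twist_degree (L : modSheaf C) (e0 : L D0) (e1 : L D1)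
    (w winv : C D01) kap q (g n : nat) :
  line_bundle L -> free_generator e0 -> free_generator e1 ->
  rs D01 e1 = w *: rs D01 e0 -> w * winv = 1 -> kap != 0 ->
  (forall a, a != 0 -> evO (red D01 w) (Some a) = kap * a ^ q) ->
  has_genus C g -> has_degree L (2 * n)%N -> q = n.
Proof.
move=> lL g0 g1 wE ww kap0 redwE hg [[c c'] /= [hc hc' cE]].
have [F _] := ideal_frame_ex C.
have e : c = if_p F + q + q + 2%:Z := euler_line F lL g0 g1 wE ww kap0 redwE hc.
have e' : c' = if_p F + 2%:Z.
  have e1' : rs D01 (1 : regMod C D1) = (1 : C D01) *: rs D01 (1 : regMod C D0).
    by rewrite -!ra_rs !ra1 ?scale1r //; [exact: D010|exact: D011].
  have red1 (a : k) : a != 0 -> evO (red D01 1) (Some a) = 1 * a ^ (0 : int).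
    by move=> a0; rewrite rmorph1 evO1 ?expr0z ?mulr1 //; exact/D01_Some.
  have := euler_line F (@regMod_line_bundle C) (@regMod_gen1 C _) (@regMod_gen1 C _) e1'
    (mulr1 1) (oner_neq0 k) red1 hc'.
  by rewrite !addr0.
by move: cE; rewrite e e'; clear; lia.
Qed.

(* The global sections of L inject into those of its restriction O(q) to P^1,
   because the kernel is of negative degree. *)
Section Bound.
Variables (F : ideal_frame C) (L : modSheaf C) (e0 : L D0) (e1 : L D1).
Variables (w winv : C D01) (kap : k) (n : nat).
Hypotheses (L_line : line_bundle L) (g0 : free_generator e0) (g1 : free_generator e1).
Hypotheses (wE : rs D01 e1 = w *: rs D01 e0) (ww : w * winv = 1) (kap0 : kap != 0).
Hypothesis redwE : forall a, a != 0 -> evO (red D01 w) (Some a) = kap * a ^ n%:Z.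
Hypothesis pn : (if_p F + n%:Z < 0)%R.

Lemma gcrd_coef m (i : int) : (i < 0)%R || (n%:Z < i)%R ->
  lcoef (red D01 (gcrd g0 m)) i = 0.
Proof.
case/orP => hi.
  by have [] := (from_C0P (if_red0 F) (if_gen0 F) _).1 (gcrd_M0 g0 m) i hi.
exact: (M1_red (if_red0 F) (if_gen0 F) (if_red1 F) (if_gen1 F) (if_eps10 F) redwE
  (gcrd_M1 g0 g1 wE m)).
Qed.

Lemma gcrd_red_eq0 m : red D01 (gcrd g0 m) = 0 -> m = 0.
Proof.
move=> r0; apply: (gcrd_eq0 (g0 := g0) L_line).
apply: (coord_ext (redT0 := if_red0 F) (gen0 := if_gen0 F)); first by rewrite r0 raddf0.
rewrite raddf0; apply: laurent_eq0 => i; case: (ltP i 0) => i0.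
  by have [] := (from_C0P (if_red0 F) (if_gen0 F) _).1 (gcrd_M0 g0 m) i i0.
apply: (M1_red0 (if_red0 F) (if_gen0 F) (if_red1 F) (if_gen1 F) (if_eps10 F)
  (if_kap0 F) (@if_iotaE _ _ F) kap0 redwE ww (gcrd_M1 g0 g1 wE m) r0).
exact: lt_le_trans pn i0.
Qed.

Notation lc := (@lincomb k (C (oT (P1 k))) (scal C (oT (P1 k))) (L (oT (P1 k)))).

Lemma lcoef_gcrd_lc h (v : 'I_h -> L (oT (P1 k))) c i :
  lcoef (red D01 (gcrd g0 (lc v c))) i =
  \sum_(l < h) c 0 l * lcoef (red D01 (gcrd g0 (v l))) i.
Proof.
rewrite /lincomb raddf_sum rmorph_sum lcoef_sum; apply: eq_bigr => l _.
by rewrite /= gcrd_scal rmorphM red_scal lcoef_scal.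
Qed.

Lemma dim_H0_basis (h : nat) : dim_H0 L h -> exists v : 'I_h -> L (oT (P1 k)),
  @basis_mod k _ (scal C _) (L (oT (P1 k))) (fun=> True) (fun x => x = 0) _ v.
Proof. by move=> [v vP]; exists v; split=> // x _; exact: vP. Qed.

(** [B] records the coefficients of t^0, ..., t^n in the reductions of a basis, and its rows are
    independent by [gcrd_red_eq0]. With n + 1 rows it is invertible, so each monomial is the
    reduction of a section. *)
Lemma H0_bound h : dim_H0 L h -> (h <= n.+1)%N /\
  (h = n.+1 -> exists s : nat -> L (oT (P1 k)), forall i, (i <= n)%N ->
     red D01 (gcrd g0 (s i)) = tc k ^+ i).
Proof.
move=> /dim_H0_basis[v bv].
pose B := \matrix_(l < h, j < n.+1) lcoef (red D01 (gcrd g0 (v l))) j%:Z.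
have BE c (j : 'I_n.+1) : lcoef (red D01 (gcrd g0 (lc v c))) j%:Z = (c *m B) 0 j.
  by rewrite lcoef_gcrd_lc mxE; apply: eq_bigr => l _; rewrite mxE.
have Bfree : row_free B.
  rewrite -kermx_eq0; apply/rowV0P => c /sub_kermxP cB.
  have m0 : lc v c = 0.
    apply: gcrd_red_eq0; apply: laurent_eq0 => i.
    case: i => [j|j]; last by apply: gcrd_coef.
    case: (leqP j n) => jn; last by apply: gcrd_coef; apply/orP; right.
    by have := BE c (Ordinal (jn : (j < n.+1)%N)); rewrite cB mxE.
  apply: (basis_uniq bv (x := 0)) => //; first by rewrite m0 subr0.
  by rewrite (raddf0 (lincomb (scal C _) v)) subr0.
split; first by rewrite -(eqP Bfree) rank_leq_col.
move=> hn; have Bfull : row_full B by rewrite /row_full (eqP Bfree) hn.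
(* For i > n nothing is asked and the section 0 is a dummy, so that [s] may be indexed by [nat]. *)
have ex (i : nat) : exists m, (i <= n)%N -> red D01 (gcrd g0 m) = tc k ^+ i.
  case: (leqP i n) => [lin|]; last by exists 0.
  pose i' := Ordinal (lin : (i < n.+1)%N).
  have /submxP[c cE] : ((delta_mx 0 i' : 'rV[k]_n.+1) <= B)%MS by exact: submx_full.
  exists (lc v c) => _; apply: laurent_eq => j.
  have tE : laurent_rep (tc k ^+ i) 'X^i 0.
    move=> a a0; rewrite evOX ?evO_tc ?hornerXn ?expr0 ?divr1 //.
    exact/D01_Some.
  rewrite (lcoefE _ tE) addr0; case: j => [j|j]; last by rewrite gcrd_coef.
  rewrite /= coefXn; case: (leqP j n) => jn; last first.
    rewrite gcrd_coef; last by apply/orP; right.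
    by rewrite (_ : _ == _ = false) //; apply/eqP => ij; move: (lin); rewrite -ij leqNgt jn.
  by rewrite (BE c (Ordinal (jn : (j < n.+1)%N))) -cE mxE /=.
exists (fun i => projT1 (cid (ex i))) => i; by case: cid.
Qed.

End Bound.

Lemma H0_lower (L : modSheaf C) h m (s : 'I_m -> L (oT (P1 k))) :
  (forall c : 'rV[k]_m, lincomb (scal C _) s c = 0 -> c = 0) ->
  dim_H0 L h -> (m <= h)%N.
Proof.
move=> free_s /dim_H0_basis[v bv].
have [B hB] := basis_coords bv (w := s) (fun _ => Logic.I).
have Bfree : row_free B.
  rewrite -kermx_eq0; apply/rowV0P => c /sub_kermxP cB; apply: free_s.
  rewrite /lincomb; transitivity (lincomb (scal C _) v (c *m B)).
    rewrite lincomb_mul; apply: eq_bigr => i _; congr (_ *: _).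
    by apply/eqP; rewrite -subr_eq0; apply/eqP; exact: hB.
  by rewrite cB raddf0.
by rewrite -(eqP Bfree) rank_leq_col.
Qed.

End H0.

(** * Second differences: the lifted monomials are powers of one coordinate *)

Section SecondDifference.
Variables (k : closedFieldType) (C : ribbon k).
Notation O := (O_P1 k).
Notation I := (rib_ideal C).
Notation red := (rib_red C).
Notation inc := (@rib_incl k C).
Notation D01 := (D01 k).
Notation D0 := (D0 k).
Notation D1 := (D1 k).

Variables (F : ideal_frame C) (n : nat) (alpha : nat -> C D0) (beta : nat -> C D1).
Hypothesis n_gt0 : (0 < n)%N.
Hypothesis pn : (if_p F + n%:Z < - 2%:Z)%R.
Hypothesis alpha_red : forall i, (i <= n)%N -> red D0 (alpha i) = zc (chart0 k) ^+ i.
Hypothesis beta_red : forall i, (i <= n)%N -> red D1 (beta i) = zc (chart1 k) ^+ (n - i).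
Hypothesis alpha0 : alpha 0%N = 1.
Hypothesis alpha_beta : forall i, (i <= n)%N ->
  ra D01 (alpha i) = ra D01 (beta i) * ra D01 (alpha n).

Lemma red_alpha1 : red D0 (alpha 1%N) = zc (chart0 k).
Proof. by rewrite alpha_red // expr1. Qed.

Notation gen0 := (if_gen0 F).
Notation sd := (epart red_alpha1 gen0).
Notation iota := (if_iota F).
Notation T := (ra D01 (alpha 1%N)).
Notation U := (ra D01 (beta n.-1)).

Lemma evO_tcX (f : O D01) j a : a != 0 ->
  evO (tc k ^+ j * f) (Some a) = 1 * a ^ j%:Z * evO f (Some a).
Proof.
move=> a0; have Da : oset D01 (Some a) by exact/D01_Some.
by rewrite evOM evOX // evO_tc // mul1r.
Qed.

Lemma lcoef_tcX (f : O D01) j i : lcoef (tc k ^+ j * f) i = lcoef f (i - j%:Z).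
Proof.
by rewrite (lcoef_shift (f := f) (c := 1) (m := j%:Z)) ?mul1r // => a a0; rewrite evO_tcX.
Qed.

Lemma red_beta_last : red D1 (beta n.-1) = zc (chart1 k).
Proof. by rewrite beta_red ?leq_pred // -subn1 subKn // expr1. Qed.

Lemma tcuc j : tc k ^+ j * uc k ^+ j = 1.
Proof. by rewrite -exprMn tc_uc expr1n. Qed.

Let f i := sd (ra D01 (alpha i)).

(** [beta i] and the power of [beta n.-1] with the same reduction differ by an ideal element over
    D1; the power rule for [epart] supplies the factor n - i. *)
Lemma sd_beta i : (i <= n)%N -> exists G : O D1,
  sd (ra D01 (beta i)) = (n - i)%:R * uc k ^+ (n - i).-1 * sd U + iota * ra D01 G.
Proof.
move=> lin.
have /red_eq0[m mE] : red D1 (beta i - beta n.-1 ^+ (n - i)) = 0.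
  by rewrite rmorphB rmorphXn /= beta_red // red_beta_last subrr.
have [G GE] := gen_ex m (if_gen1 F) (@subset_refl _ D1); rewrite rs_id in GE.
exists G; rewrite -(subrK (beta n.-1 ^+ (n - i)) (beta i)) mE GE raddfD /=.
rewrite -inc_rs rsZ if_eps10 scalerA raddfD /= epart_inc addrC mulrC; congr (_ + _).
by rewrite raXn ?epartX ?red_ra ?red_beta_last //; exact: D011.
Qed.

(** The relative deviation from a power: since T is the lift defining the splitting, [alpha i]
    restricts to T^i (1 + E_i eps). *)
Let E i := uc k ^+ i * f i.

(** A logarithmic derivative of [alpha_beta]: E_n is constant in i, the power of U contributes a
    term linear in n - i, and the last term has exponents at most n - i + p. *)
Lemma E_formula i : (i <= n)%N -> exists G : O D1,
  E i = uc k ^+ n * f n + (n - i)%:R * (tc k * sd U) + tc k ^+ (n - i) * (iota * ra D01 G).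
Proof.
move=> lin; have [G GE] := sd_beta lin; exists G.
rewrite /E /f alpha_beta // epartM !red_ra beta_red // alpha_red // GE.
have rX (chi : chart k) (x : O (cD chi)) j : D01 `<=` cD chi -> ra D01 (x ^+ j) = ra D01 x ^+ j.
  by move=> sub; rewrite raXn.
rewrite (rX (chart1 k)) ?(rX (chart0 k)); [|exact: D010|exact: D011].
rewrite -/(tc k) -/(uc k) mulrDr mulrA -exprD subnKC // mulrA.
have -> : uc k ^+ i * tc k ^+ n = tc k ^+ (n - i).
  have -> : tc k ^+ n = tc k ^+ (n - i) * tc k ^+ i by rewrite -exprD subnK.
  by rewrite mulrCA [uc k ^+ i * _]mulrC tcuc mulr1.
rewrite mulrDr addrA; congr (_ + _ + _).
case: (n - i)%N => [|m] /=; first by rewrite !mul0r mulr0.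
rewrite exprS; transitivity (m.+1%:R * (tc k * sd U) * (tc k ^+ m * uc k ^+ m)).
  by move: (m.+1%:R) => c; ring.
by rewrite tcuc mulr1.
Qed.

Lemma lcoef_E_low i j : (j < - i%:Z)%R -> lcoef (E i) j = 0.
Proof.
move=> ji; rewrite /E lcoef_ucX.
have [] := (from_C0P red_alpha1 gen0 (ra D01 (alpha i))).1 _ (j + i%:Z) => //.
  by exists (alpha i).
by move: ji; clear; lia.
Qed.

(** For the indices i, i+1, i+2, extension over D0 leaves only exponents at least -(i+2). The affine
    part cancels, and by [E_formula] the rest has exponents at most n - i + p. No exponent satisfies
    both because n + p < -2. *)
Lemma E_second_difference i : (0 < i < n)%N -> E i.+1 = E i + E i - E i.-1.
Proof.
case: i => // i /andP[_ lin] /=; apply/eqP; rewrite -subr_eq0; apply/eqP.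
have [G2 E2] := E_formula lin; have [G1 E1] := E_formula (ltnW lin).
have [G0 E0] := E_formula (ltnW (ltnW lin)).
apply: laurent_eq0 => j; case: (ltP j (- i.+2%:Z)) => ji.
  rewrite !(lcoefB, lcoefD) !lcoef_E_low ?(subr0, addr0) //;
    by move: ji; clear; lia.
have -> : E i.+2 - (E i.+1 + E i.+1 - E i) =
    tc k ^+ (n - i.+2) * (iota * ra D01 G2) - tc k ^+ (n - i.+1) * (iota * ra D01 G1)
    - tc k ^+ (n - i.+1) * (iota * ra D01 G1) + tc k ^+ (n - i) * (iota * ra D01 G0).
  (* Relative to m = n - i - 2 the linear coefficients are m, m + 1, m + 2, whose second difference
     is zero. *)
  rewrite E2 E1 E0; have -> : (n - i = (n - i.+2) + 2)%N by move: lin; clear; lia.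
  have -> : (n - i.+1 = (n - i.+2) + 1)%N by move: lin; clear; lia.
  rewrite !natrD; move: (tc k ^+ _ * (iota * ra D01 G2)) (tc k ^+ _ * (iota * ra D01 G1)).
  move: (tc k ^+ _ * (iota * ra D01 G0)) (tc k * sd U) (uc k ^+ n * f n) ((n - i.+2)%:R).
  by move=> x y z t v v'; ring.
have h (l : nat) (G : O D1) : (l <= n - i)%N -> lcoef (tc k ^+ l * (iota * ra D01 G)) j = 0.
  move=> ln; rewrite lcoef_tcX (lcoef_iota (@if_iotaE _ _ F)) lcoef_D1 ?mulr0 //.
  by move: ln ji pn lin; clear; lia.
rewrite !(lcoefB, lcoefD) !h ?(subr0, addr0) //; move: lin; clear; lia.
Qed.

(** E_0 vanishes because [alpha 0] is 1, and E_1 because [alpha 1] is the very lift that defines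
    [epart]; the recursion does the rest. *)
Lemma E_eq0 i : (i <= n)%N -> E i = 0.
Proof.
suff h m : (m <= n)%N -> E m = 0 /\ ((m.+1 <= n)%N -> E m.+1 = 0) by move=> /h[].
elim: m => [|m IH] mn.
  rewrite /E /f alpha0 ra1; last exact: D010.
  rewrite epart1 mulr0; split=> // _.
  rewrite -[ra D01 (alpha 1%N)](lft_tc red_alpha1) epart_lft mulr0 //.
have [Em Em1] := IH (ltnW mn); split; first exact: Em1.
move=> mn'; rewrite E_second_difference //= Em1 // Em !addr0 subr0 //.
Qed.

Lemma alpha_power i : (i <= n)%N -> ra D01 (alpha i) = T ^+ i.
Proof.
move=> lin; have fi0 : sd (ra D01 (alpha i)) = 0.
  have := congr1 ( *%R (tc k ^+ i)) (E_eq0 lin).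
  by rewrite /= mulr0 /E mulrA tcuc mul1r.
apply: (coord_ext (redT0 := red_alpha1) (gen0 := gen0)).
  rewrite rmorphXn /= !red_ra !alpha_red // expr1 raXn //; exact: D010.
by rewrite fi0 epartX -{2}(lft_tc red_alpha1) epart_lft mulr0.
Qed.

(** At i = n - 1, [alpha_beta] reads T^(n-1) = U T^n, and T is a unit. *)
Lemma alpha_beta_inverse : T * U = 1.
Proof.
have [S TS] := T_unit red_alpha1.
have := alpha_beta (leq_pred n).
rewrite (alpha_power (leq_pred n)) (alpha_power (leqnn n)).
have -> : T ^+ n = T * T ^+ n.-1 by rewrite -exprS prednK.
have TSn : T ^+ n.-1 * S ^+ n.-1 = 1 by rewrite -exprMn TS expr1n.
move=> /(congr1 ( *%R^~ (S ^+ n.-1))); rewrite /= -!mulrA TSn mulr1 => ->.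
by rewrite mulrC.
Qed.

End SecondDifference.

(** * The splitting defined by a coordinate *)

(** Clears denominators when a polynomial in 1/t is to be rewritten in t. *)
Lemma pev_rev (k : fieldType) (R : comPzRingType) (f : {rmorphism k -> R}) (t u : R)
    N (P : {poly k}) : t * u = 1 -> (size P <= N.+1)%N ->
  pev f t (rev_form N P) = t ^+ N * pev f u P.
Proof.
move=> tu PN; rewrite (pev_wide _ _ (size_poly _ _ : (size (rev_form N P) <= N.+1)%N)).
rewrite (pev_wide _ _ PN) mulr_sumr (reindex_inj rev_ord_inj) /=.
apply: eq_bigr => i _; have iN : (i <= N)%N by rewrite -ltnS.
rewrite coef_poly subSS ltnS leq_subr subKn // mulrCA; congr (_ * _).
have -> : t ^+ N = t ^+ (N - i) * t ^+ i by rewrite -exprD subnK.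
rewrite -mulrA.
have -> : t ^+ i * u ^+ i = 1 by rewrite -exprMn tu expr1n.
by rewrite mulr1.
Qed.

Section Splitting.
Variables (k : closedFieldType) (C : ribbon k).
Notation O := (O_P1 k).
Notation red := (rib_red C).
Notation inc := (@rib_incl k C).
Notation D01 := (D01 k).
Notation D0 := (D0 k).
Notation D1 := (D1 k).
Implicit Types (U V : opens (P1 k)).

Variables (T0 : C D0) (T1 : C D1).
Hypotheses (redT0 : red D0 T0 = zc (chart0 k)) (redT1 : red D1 T1 = zc (chart1 k)).
Hypothesis T01 : ra D01 T0 * ra D01 T1 = 1.

Definition tl U : C (oI U D01) := ra _ T0.
Definition tO U : O (oI U D01) := ra _ (zc (chart0 k)).

Lemma oID U : oI U D01 `<=` D01. Proof. exact: oIr. Qed.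
Lemma oID0 U : oI U D01 `<=` D0. Proof. exact: subset_trans (@oID U) (@D010 k). Qed.
Lemma oID1 U : oI U D01 `<=` D1. Proof. exact: subset_trans (@oID U) (@D011 k). Qed.

Lemma red_tl U P : red _ (spev (tl U) P) = spev (tO U) P.
Proof. by rewrite /tl red_spev ?redT0 //; exact: oID0. Qed.

(* [c] is the element of C over [U] obtained by substituting [T0] for the
   coordinate in a fraction representing [b]. *)
Definition Rat U (b : O U) (c : C U) : Prop := exists F G : {poly k},
  [/\ G != 0, spev (tO U) G * ra _ b = spev (tO U) F &
      spev (tl U) G * ra _ c = spev (tl U) F].

Lemma spev_tO_neq0 U P : oset U !=set0 -> P != 0 -> spev (tO U) P <> 0.
Proof.
move=> U0 P0 e; case/eqP: P0; apply: (@poly_open_eq0 _ (chart0 k) (oI U D01)).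
  by apply: meet_opens => //; exact: D01_neq0.
move=> a Za; rewrite -(evO_spev P (@oID0 U) Za) -/(tO U) e evO0 //.
Qed.

Lemma Rat_red U (b : O U) (c : C U) : Rat b c -> red U c = b.
Proof.
move=> [F [G [G0 hb hc]]]; case: (pselect (oset U !=set0)) => [U0|nU]; last first.
  by apply: sep_empty_alg => x Ux; apply: nU; exists x.
have Z0 : oset (oI U D01) !=set0 by apply: meet_opens => //; exact: D01_neq0.
apply: (O_open_eq (@oIl _ U D01) Z0); apply/eqP; rewrite -subr_eq0; apply/eqP.
have := congr1 (red _) hc; rewrite rmorphM !red_tl -hb red_ra => e.
have : spev (tO U) G * (ra _ (red U c) - ra _ b) = 0 by rewrite mulrBr e subrr.
by case/O_domain => // /spev_tO_neq0; case.
Qed.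

(** The reduction of c vanishes because O is a domain; then c lies in the ideal, which is
    torsion-free over O. *)
Lemma spev_tl_reg U P c : oset U !=set0 -> P != 0 -> spev (tl U) P * c = 0 -> c = 0.
Proof.
move=> U0 P0 e; have := congr1 (red _) e; rewrite rmorphM red_tl raddf0.
case/O_domain => [/spev_tO_neq0|]; first by case.
move=> /red_eq0[m mE]; rewrite mE; move: e; rewrite mE mul_inc red_tl.
rewrite -(raddf0 (inc _)) => /ideal_inj /(line_torsion_free (rib_ideal_line C)) [].
  by move=> /spev_tO_neq0; case.
by move=> ->; rewrite raddf0.
Qed.

(** Both fractions represent [b], so G' F = G F' already as polynomials. Hence G G' annihilates c -
    c' after substitution, and it is a nonzerodivisor. *)
Lemma Rat_uniq U (b : O U) (c c' : C U) : Rat b c -> Rat b c' -> c = c'.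
Proof.
move=> [F [G [G0 hb hc]]] [F' [G' [G'0 hb' hc']]].
case: (pselect (oset U !=set0)) => [U0|nU]; last first.
  by apply: sep_empty_alg => x Ux; apply: nU; exists x.
have Z0 : oset (oI U D01) !=set0 by apply: meet_opens => //; exact: D01_neq0.
apply: (ribbon_open_eq (@oIl _ U D01) Z0); apply/eqP; rewrite -subr_eq0; apply/eqP.
have GG : G * G' != 0 by rewrite mulf_neq0.
apply: (spev_tl_reg U0 GG).
have e : G' * F = G * F'.
  apply/eqP; rewrite -subr_eq0; apply/eqP/eqP; apply: contraT => n0.
  case: (spev_tO_neq0 U0 n0); rewrite rmorphB !rmorphM /= -hb -hb'.
  by rewrite [X in X - _]mulrCA subrr.
rewrite mulrBr rmorphM -[X in _ - X]mulrA hc' [spev _ G * _]mulrC -mulrA hc.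
by rewrite -!rmorphM e [G * F']mulrC [F' * G]mulrC subrr.
Qed.

Lemma Rat_sub U (b b' : O U) (c c' : C U) : Rat b c -> Rat b' c' -> Rat (b - b') (c - c').
Proof.
move=> [F [G [G0 hb hc]]] [F' [G' [G'0 hb' hc']]].
exists (F * G' - F' * G), (G * G'); rewrite mulf_neq0 //; split=> //.
  by rewrite raddfB !rmorphB !rmorphM /= -hb -hb'; ring.
by rewrite raddfB !rmorphB !rmorphM /= -hc -hc'; ring.
Qed.

Lemma Rat_mul U (b b' : O U) (c c' : C U) : Rat b c -> Rat b' c' -> Rat (b * b') (c * c').
Proof.
move=> [F [G [G0 hb hc]]] [F' [G' [G'0 hb' hc']]].
exists (F * F'), (G * G'); rewrite mulf_neq0 //; split=> //.
  by rewrite raM !rmorphM /= -hb -hb'; ring.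
by rewrite raM !rmorphM /= -hc -hc'; ring.
Qed.

Lemma Rat_scal U c : Rat (scal O U c) (scal C U c).
Proof.
exists c%:P, 1; rewrite oner_neq0 !rmorph1 !mul1r !spevC !ra_scal //;
  by split=> //; exact: oIl.
Qed.

Lemma Rat_res U V (b : O U) (c : C U) : V `<=` U -> Rat b c -> Rat (ra V b) (ra V c).
Proof.
move=> VU [F [G [G0 hb hc]]]; exists F, G.
have ZZ : oI V D01 `<=` oI U D01 by [].
have tE : tO V = ra _ (tO U) by rewrite /tO ra_ra //; exact: oID0.
have lE : tl V = ra _ (tl U) by rewrite /tl ra_ra //; exact: oID0.
split=> //.
  have := congr1 (ra (oI V D01)) hb; rewrite raM !ra_pev // -tE !ra_ra //; exact: oIl.
have := congr1 (ra (oI V D01)) hc; rewrite raM !ra_pev // -lE !ra_ra //; exact: oIl.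
Qed.

Lemma Rat_local0 V (b : O V) : V `<=` D0 -> oset V !=set0 -> exists c, Rat b c.
Proof.
move=> VD V0; have [F [G [_ h]]] := @global_frac _ 0 V b (chart0 k) VD V0.
have [c cE] : exists c, spev (ra V T0) G * c = 1.
  by apply: (@spev_unit _ _ (chart0 k) D0) => //; [rewrite redT0 ra_id|move=> a /h[]].
have ZV : oI V D01 `<=` V by exact: oIl.
exists (spev (ra V T0) F * c), F, G; split.
- have [x Vx] := V0; have /cDE[a xE] := VD _ Vx; rewrite xE in Vx.
  by have [+ _] := h a Vx; apply: contraNneq => ->; rewrite horner0.
- apply: (chart_ext (@oID0 V)) => a Za; have Va := ZV _ Za.
  have [Ga] := h a Va; rewrite -/(evO _ _) expr0 mulr1 => e.
  rewrite evOM !(evO_spev (chi := chart0 k)) //; try exact: oID0.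
  by rewrite evO_ra // e mulrC divfK.
- have := congr1 (ra (oI V D01)) cE; rewrite raM ra1 // !ra_pev // ra_ra //.
  rewrite -/(tl V) raM ra_pev // ra_ra // -/(tl V) => e.
  by rewrite mulrCA e mulr1.
Qed.

(** Near infinity the fraction is in [T1]. Because [T0 * T1 = 1] on the overlap, reversing numerator
    and denominator in a common degree N turns it into a fraction in [T0]. *)
Lemma Rat_local1 V (b : O V) : V `<=` D1 -> oset V !=set0 -> exists c, Rat b c.
Proof.
move=> VD V0; have [F [G [_ h]]] := @global_frac _ 0 V b (chart1 k) VD V0.
have [c cE] : exists c, spev (ra V T1) G * c = 1.
  by apply: (@spev_unit _ _ (chart1 k) D1) => //; [rewrite redT1 ra_id|move=> a /h[]].
have ZV : oI V D01 `<=` V by exact: oIl.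
pose N := maxn (size F) (size G).
have FN : (size F <= N.+1)%N by apply: leqW; exact: leq_maxl.
have GN : (size G <= N.+1)%N by apply: leqW; exact: leq_maxr.
have ZT : tl V * ra _ T1 = 1.
  rewrite /tl -(ra_ra T0 (@oID V) (@D010 k)) -(ra_ra T1 (@oID V) (@D011 k)).
  by rewrite -raM T01 ra1 //; exact: oID.
have ZO : tO V * ra _ (zc (chart1 k)) = 1.
  have := congr1 (red _) ZT; rewrite rmorphM rmorph1 /tl !red_ra redT0 redT1 //.
exists (spev (ra V T1) F * c), (rev_form N F), (rev_form N G); split.
- have [x Vx] := V0; have /cDE[a xE] := VD _ Vx; rewrite xE in Vx.
  have [+ _] := h a Vx; apply: contraNneq => r0.
  have := rev_formK N G; rewrite take_poly_id // => <-; rewrite r0.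
  have -> : rev_form N (0 : {poly k}) = 0.
    by apply/polyP => i; rewrite coef_poly !coef0 if_same.
  by rewrite horner0.
- rewrite /spev !(pev_rev _ ZO) // -mulrA; congr (_ * _).
  apply: (chart_ext (@oID1 V)) => a Za; have Va := ZV _ Za.
  have [Ga] := h a Va; rewrite -/(evO _ _) expr0 mulr1 => e.
  rewrite evOM !(evO_spev (chi := chart1 k)) //; try exact: oID1.
  by rewrite evO_ra // e mulrC divfK.
- rewrite /spev !(pev_rev _ ZT) // -mulrA; congr (_ * _).
  have := congr1 (ra (oI V D01)) cE; rewrite raM ra1 // !ra_pev // ra_ra //.
  rewrite raM ra_pev // ra_ra // => e.
  by rewrite mulrCA e mulr1.
Qed.

(** The solutions over the two charts agree on the overlap by [Rat_uniq]. The fraction found on one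
    chart then works on all of [U], since its equations may be checked on a smaller nonempty open
    set. *)
Lemma Rat_ex U (b : O U) : exists c, Rat b c.
Proof.
case: (pselect (oset U !=set0)) => [[x0 Ux0]|nU]; last first.
  have Z0 : oI U D01 `<=` set0 by move=> x [Ux _]; apply: nU; exists x.
  exists 0, 0, 1; rewrite oner_neq0; split=> //.
    exact: (sep_empty_alg _ _ Z0).
  exact: (sep_empty_alg _ _ Z0).
have U0 : oset U !=set0 by exists x0.
have V00 : oset (oI U D0) !=set0 by apply: meet_opens => //; exact: (chart_neq0 (chart0 k)).
have V10 : oset (oI U D1) !=set0 by apply: meet_opens => //; exact: (chart_neq0 (chart1 k)).
have [c0 h0] := Rat_local0 (ra (oI U D0) b) (@oIr _ _ _) V00.
have [c1 h1] := Rat_local1 (ra (oI U D1) b) (@oIr _ _ _) V10.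
have [||||c [cE0 cE1]] := @glue2_alg _ _ C U (oI U D0) (oI U D1) c0 c1.
- by [].
- by [].
- by move=> x Ux; case: (cover_charts x) => Dx; [left|right].
- set Z := oI _ _; have Z0 : Z `<=` oI U D0 by exact: oIl.
  have Z1 : Z `<=` oI U D1 by exact: oIr.
  apply: (@Rat_uniq _ (ra Z b)).
    have := Rat_res Z0 h0; rewrite ra_ra //.
  by have := Rat_res Z1 h1; rewrite ra_ra.
exists c; case: h0 => F [G [G0 hb hc]]; exists F, G.
have ZZ : oI (oI U D0) D01 `<=` oI U D01 by [].
have Z0 : oset (oI (oI U D0) D01) !=set0 by apply: meet_opens => //; exact: D01_neq0.
have tE : tO (oI U D0) = ra _ (tO U) by rewrite /tO ra_ra //; exact: oID0.
have lE : tl (oI U D0) = ra _ (tl U) by rewrite /tl ra_ra //; exact: oID0.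
split=> //.
  apply: (O_open_eq ZZ Z0); rewrite raM !ra_pev // -tE ra_ra // -hb ra_ra //.
apply: (ribbon_open_eq ZZ Z0); rewrite raM !ra_pev // -lE ra_ra // -hc -cE0 ra_ra //.
Qed.

Definition spl U (b : O U) : C U := projT1 (cid (Rat_ex b)).

Lemma splP U (b : O U) : Rat b (spl b).
Proof. by rewrite /spl; case: cid. Qed.

Lemma splE U (b : O U) c : Rat b c -> spl b = c.
Proof. exact: Rat_uniq (splP b). Qed.

Fact spl_zmod U : zmod_morphism (@spl U).
Proof. by move=> b b'; apply: splE; apply: Rat_sub; exact: splP. Qed.

Fact spl_monoid U : monoid_morphism (@spl U).
Proof.
split=> [|b b']; last by apply: splE; apply: Rat_mul; exact: splP.
by apply: splE; have := @Rat_scal U 1; rewrite !rmorph1.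
Qed.
HB.instance Definition _ U := GRing.isZmodMorphism.Build _ _ (@spl U) (@spl_zmod U).
HB.instance Definition _ U := GRing.isMonoidMorphism.Build _ _ (@spl U) (@spl_monoid U).

Lemma spl_res U V (VU : V `<=` U) b : spl (ares VU b) = ares VU (spl b).
Proof. by rewrite !raE; apply: splE; apply: Rat_res => //; exact: splP. Qed.

Lemma spl_scal U c : spl (scal O U c) = scal C U c.
Proof. by apply: splE; exact: Rat_scal. Qed.

Definition splitting : algHom O C :=
  @AlgHom k (P1 k) O C (fun U => @spl U) spl_res spl_scal.

Lemma splitting_is : is_splitting splitting.
Proof. by move=> U b; apply: Rat_red; exact: splP. Qed.

Lemma splitting_tc : splitting D01 (tc k) = ra D01 T0.
Proof.
apply: splE; exists 'X, 1; rewrite oner_neq0 !rmorph1 !mul1r !spevX; split=> //.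
  by rewrite /tc ra_ra //; exact: D010.
by rewrite /tl ra_ra //; exact: D010.
Qed.

End Splitting.

(** * Pullbacks *)

Section ModHom.
Variables (k : fieldType) (A B : algSheaf k (P1 k)) (f : algHom A B).
Variables (M : modSheaf A) (N : modSheaf B) (h : modHom f M N).
Implicit Types (U V : opens (P1 k)).

Lemma mhom_rs U V (m : M U) : V `<=` U -> h V (rs V m) = rs V (h U m).
Proof. by move=> VU; rewrite -!(rsE VU) mhom_res. Qed.

Lemma ahom_ra U V (a : A U) : V `<=` U -> f V (ra V a) = ra V (f U a).
Proof. by move=> VU; rewrite -!(raE VU) ahom_res. Qed.

End ModHom.

Section TwoGenerators.
Variables (k : closedFieldType) (A B : algSheaf k (P1 k)) (f : algHom A B).
Variables (M : modSheaf A) (P : modSheaf B).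
Notation D0 := (D0 k).
Notation D1 := (D1 k).
Implicit Types (U V : opens (P1 k)).
Variables (x0 : M D0) (x1 : M D1) (z0 : P D0) (z1 : P D1).
Hypotheses (gx0 : free_generator x0) (gx1 : free_generator x1).

(** The graph of the morphism that takes [x0] to [z0] and [x1] to [z1]. With uniqueness in hand,
    linearity and compatibility with restriction need only be checked on the graph. *)
Definition sends U (t : M U) (y : P U) : Prop :=
  (forall a, rs (oI U D0) t = a *: rs _ x0 -> rs (oI U D0) y = f _ a *: rs _ z0) /\
  (forall a, rs (oI U D1) t = a *: rs _ x1 -> rs (oI U D1) y = f _ a *: rs _ z1).

Lemma cover_meet U x : oset U x -> oset (oI U D0) x \/ oset (oI U D1) x.
Proof. by move=> Ux; case: (cover_charts x) => Dx; [left|right]. Qed.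

Lemma sends_uniq U (t : M U) (y y' : P U) : sends t y -> sends t y' -> y = y'.
Proof.
move=> [h0 h1] [h0' h1'].
apply: (@sep2 _ _ _ _ U (oI U D0) (oI U D1)) => //; first exact: cover_meet.
  have [b bE] := gen_ex (rs (oI U D0) t) gx0 (@oIr _ _ _).
  by rewrite (h0 b bE) (h0' b bE).
have [b bE] := gen_ex (rs (oI U D1) t) gx1 (@oIr _ _ _).
by rewrite (h1 b bE) (h1' b bE).
Qed.

Lemma hom_sends (h : modHom f M P) : h D0 x0 = z0 -> h D1 x1 = z1 ->
  forall U (t : M U), sends t (h U t).
Proof.
move=> h0 h1 U t; split=> a aE.
  by rewrite -mhom_rs // aE mhomZ mhom_rs ?h0.
by rewrite -mhom_rs // aE mhomZ mhom_rs ?h1.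
Qed.

Hypothesis compat : forall V (a : A V), V `<=` D0 -> V `<=` D1 ->
  rs V x1 = a *: rs V x0 -> rs V z1 = f V a *: rs V z0.

Lemma sends_ex U (t : M U) : exists y, sends t y.
Proof.
have [b0 b0E] := gen_ex (rs (oI U D0) t) gx0 (@oIr _ _ _).
have [b1 b1E] := gen_ex (rs (oI U D1) t) gx1 (@oIr _ _ _).
pose Z := oI (oI U D0) (oI U D1).
have Z0 : Z `<=` oI U D0 by exact: oIl.
have Z1 : Z `<=` oI U D1 by exact: oIr.
have ZD0 : Z `<=` D0 by exact: subset_trans Z0 (@oIr _ _ _).
have ZD1 : Z `<=` D1 by exact: subset_trans Z1 (@oIr _ _ _).
have [a aE] := gen_ex (rs Z x1) gx0 ZD0.
have bE : ra Z b0 = ra Z b1 * a.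
  apply: (gen_inj gx0 ZD0); rewrite -scalerA -aE.
  have := congr1 (rs Z) b0E; have := congr1 (rs Z) b1E.
  by rewrite !rsZ !rs_rs // => <- <-.
have [||||y [y0 y1]] := @glue2 _ _ _ P U (oI U D0) (oI U D1)
  (f _ b0 *: rs _ z0) (f _ b1 *: rs _ z1).
- by [].
- by [].
- exact: cover_meet.
- rewrite !rsZ !rs_rs // -/Z (compat ZD0 ZD1 aE) scalerA -!ahom_ra //.
  by rewrite -rmorphM bE.
exists y; split=> b.
  by rewrite b0E y0 => /(gen_inj gx0 (@oIr _ _ _)) ->.
by rewrite b1E y1 => /(gen_inj gx1 (@oIr _ _ _)) ->.
Qed.

Lemma sends_lin U (a : A U) (t t' : M U) (y y' : P U) :
  sends t y -> sends t' y' -> sends (a *: t - t') (f U a *: y - y').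
Proof.
move=> [h0 h1] [h0' h1']; split=> b.
  have [c cE] := gen_ex (rs (oI U D0) t) gx0 (@oIr _ _ _).
  have [c' cE'] := gen_ex (rs (oI U D0) t') gx0 (@oIr _ _ _).
  rewrite !raddfB /= !rsZ cE cE' (h0 c cE) (h0' c' cE') !scalerA -!scalerBl.
  by move=> /(gen_inj gx0 (@oIr _ _ _)) <-; rewrite rmorphB rmorphM ahom_ra.
have [c cE] := gen_ex (rs (oI U D1) t) gx1 (@oIr _ _ _).
have [c' cE'] := gen_ex (rs (oI U D1) t') gx1 (@oIr _ _ _).
rewrite !raddfB /= !rsZ cE cE' (h1 c cE) (h1' c' cE') !scalerA -!scalerBl.
by move=> /(gen_inj gx1 (@oIr _ _ _)) <-; rewrite rmorphB rmorphM ahom_ra.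
Qed.

Lemma sends_rs U V (t : M U) (y : P U) : V `<=` U ->
  sends t y -> sends (rs V t) (rs V y).
Proof.
move=> VU [h0 h1]; split=> b.
  have VV : oI V D0 `<=` oI U D0 by [].
  have [c cE] := gen_ex (rs (oI U D0) t) gx0 (@oIr _ _ _).
  have := congr1 (rs (oI V D0)) cE; have := congr1 (rs (oI V D0)) (h0 c cE).
  rewrite !rsZ !rs_rs // => -> ->.
  by move=> /(gen_inj gx0 (@oIr _ _ _)) <-; rewrite ahom_ra.
have VV : oI V D1 `<=` oI U D1 by [].
have [c cE] := gen_ex (rs (oI U D1) t) gx1 (@oIr _ _ _).
have := congr1 (rs (oI V D1)) cE; have := congr1 (rs (oI V D1)) (h1 c cE).
rewrite !rsZ !rs_rs // => -> ->.
by move=> /(gen_inj gx1 (@oIr _ _ _)) <-; rewrite ahom_ra.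
Qed.

Lemma sends_x0 : sends x0 z0.
Proof.
split=> a aE.
  have -> : a = 1 by apply: (gen_inj gx0 (@oIr _ _ _)); rewrite -aE scale1r.
  by rewrite rmorph1 scale1r.
have V0 : oI D0 D1 `<=` D0 by exact: oIl.
have V1 : oI D0 D1 `<=` D1 by exact: oIr.
have [b bE] := gen_ex (rs (oI D0 D1) x1) gx0 V0.
have ab : a * b = 1.
  by apply: (gen_inj gx0 V0); rewrite -scalerA -bE -aE scale1r.
by rewrite (compat V0 V1 bE) scalerA -rmorphM ab rmorph1 scale1r.
Qed.

Lemma sends_x1 : sends x1 z1.
Proof.
split=> a aE.
  exact: (compat (@oIr _ D1 D0) (@oIl _ D1 D0)).
have -> : a = 1 by apply: (gen_inj gx1 (@oIr _ _ _)); rewrite -aE scale1r.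
by rewrite rmorph1 scale1r.
Qed.

Definition send U (t : M U) : P U := projT1 (cid (sends_ex t)).

Lemma sendP U (t : M U) : sends t (send t).
Proof. by rewrite /send; case: cid. Qed.

Lemma sendE U (t : M U) y : sends t y -> send t = y.
Proof. exact: sends_uniq (sendP t). Qed.

Fact send_zmod U : zmod_morphism (@send U).
Proof.
move=> t t'; apply: sendE.
have := sends_lin 1 (sendP t) (sendP t'); rewrite rmorph1 !scale1r //.
Qed.
HB.instance Definition _ U := GRing.isZmodMorphism.Build _ _ (@send U) (@send_zmod U).

Lemma sendZ U (a : A U) (t : M U) : send (a *: t) = f U a *: send t.
Proof.
apply: sendE; have := sends_lin a (sendP t) (sendP (0 : M U)).
by rewrite (raddf0 (@send U)) !subr0.
Qed.

Lemma send_res U V (VU : V `<=` U) (t : M U) : send (mres VU t) = mres VU (send t).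
Proof. by rewrite !rsE; apply: sendE; apply: sends_rs => //; exact: sendP. Qed.

Lemma hom_of_generators : exists h : modHom f M P, h D0 x0 = z0 /\ h D1 x1 = z1.
Proof.
exists (@ModHom k (P1 k) A B f M P (fun U => @send U) sendZ send_res).
by split; apply: sendE; [exact: sends_x0|exact: sends_x1].
Qed.

End TwoGenerators.

Section PullbackCriterion.
Variables (k : closedFieldType) (A B : algSheaf k (P1 k)) (f : algHom A B).
Variables (M : modSheaf A) (N : modSheaf B) (eta : modHom f M N).
Notation D0 := (D0 k).
Notation D1 := (D1 k).
Variables (x0 : M D0) (x1 : M D1).
Hypotheses (gx0 : free_generator x0) (gx1 : free_generator x1).
Hypotheses (gy0 : free_generator (eta D0 x0)) (gy1 : free_generator (eta D1 x1)).

Definition comp_hom (P : modSheaf B) (v : modHom (idHom B) N P) : modHom f M P :=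
  @ModHom k (P1 k) A B f M P (fun U => v U \o eta U)
    (fun U a m => etrans (congr1 (v U) (mhomZ eta a m)) (mhomZ v (f U a) (eta U m)))
    (fun U V VU m => etrans (congr1 (v V) (mhom_res eta VU m)) (mhom_res v VU (eta U m))).

(** When [eta] takes generators to generators, a morphism out of [N] is fixed by their images, which
    [u] prescribes. These are compatible because the transition coefficients of [N] are the images
    under [f] of those of [M]. *)
Lemma pullback_of_generators : is_pullback f M N.
Proof.
exists eta => P u.
have [V b V0 V1 bE|v [v0 v1]] := @hom_of_generators _ _ _ (idHom B) N P
    (eta D0 x0) (eta D1 x1) (u D0 x0) (u D1 x1) gy0 gy1.
  have [a aE] := gen_ex (rs V x1) gx0 V0.
  have -> : b = f V a.
    by apply: (gen_inj gy0 V0); rewrite -bE -!mhom_rs // aE mhomZ.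
  by rewrite -!mhom_rs // aE mhomZ.
exists v => [U m|v' hv' U t].
  apply: (sends_uniq gx0 gx1); last exact: hom_sends.
  exact: (hom_sends (h := comp_hom v)).
apply: (sends_uniq gy0 gy1 (f := idHom B)); last exact: hom_sends.
by apply: hom_sends; rewrite hv'.
Qed.

End PullbackCriterion.

(** * Generators and monomial sections of O(n) *)

Section Twist.
Variables (k : closedFieldType) (n : nat).
Notation O := (O_P1 k).
Notation D01 := (D01 k).

(** On the standard charts this is the n-th power of the homogeneous coordinate that does not vanish
    there: x0^n or x1^n. *)
Lemma twist_gen chi : exists x : twist k n (cD chi),
  (forall a, @ev k n (cD chi) x (cpt chi a) = cu chi a ^+ n) /\ free_generator x.
Proof.
pose g (x : P1 k) : k :=
  if pselect (exists a, x = cpt chi a) is left h then cu chi (projT1 (cid h)) ^+ n else 0.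
have gE a : g (cpt chi a) = cu chi a ^+ n.
  rewrite /g; case: pselect => [h|[]]; last by exists a.
  by congr (cu chi _ ^+ n); case: cid => b /= /cpt_inj.
have [x xE] : exists x : twist k n (cD chi),
    forall y, oset (cD chi) y -> @ev k n (cD chi) x y = g y.
  apply: mk_section => y Dy; have /cDE[a yE] := Dy.
  exists chi, a, (cD chi), 1, 1; split=> // b _ _.
  by rewrite !hornerC oner_neq0 gE divr1 mul1r.
exists x; split=> [a|]; first by rewrite xE ?gE //; exact: cD_cpt.
apply/genP => V VD m.
have mE (a : O V) : m = a *: rs V x <->
    forall c, oset V (cpt chi c) -> @ev k n V m (cpt chi c) = evO a (cpt chi c) * cu chi c ^+ n.
  split=> [-> c Vc|h].
    by rewrite evTZ evT_rs // xE ?gE //; exact: cD_cpt.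
  apply: ev_ext => y Vy; have /cDE[c yE] := VD _ Vy; rewrite yE in Vy *.
  by rewrite h // evTZ evT_rs // xE ?gE //; exact: cD_cpt.
have [a aE] : exists a : O V, m = a *: rs V x.
  case: (pselect (oset V !=set0)) => [V0|nV]; last first.
    by exists 0; apply: sep_empty => y Vy; apply: nV; exists y.
  have [F [G [_ h]]] := @global_frac k n V m chi VD V0.
  have [b Vb|a aE] := @mk_frac k chi V F G VD; first by have [] := h b Vb.
  by exists a; apply/mE => c Vc; rewrite aE //; have [] := h c Vc.
exists a; split=> // a' /mE h'; move: aE => /mE h.
apply: (chart_ext VD) => c Vc; apply: (mulIf (expf_neq0 n (cu_neq0 chi c))).
by rewrite -h // -h'.
Qed.

Lemma twist_transition (x0 : twist k n (D0 k)) (x1 : twist k n (D1 k)) :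
  (forall a, @ev k n (D0 k) x0 (cpt (chart0 k) a) = cu (chart0 k) a ^+ n) ->
  (forall a, @ev k n (D1 k) x1 (cpt (chart1 k) a) = cu (chart1 k) a ^+ n) ->
  rs D01 x1 = tc k ^+ n *: rs D01 x0.
Proof.
move=> h0 h1; apply: ev_ext => y Dy; have /D01E[a a0 yE] := Dy; rewrite yE in Dy *.
rewrite evTZ !evT_rs //; [|exact: D010|exact: D011].
rewrite evOX // evO_tc // (h0 a) /= expr1n mulr1 -(cpt1V a0) (h1 a^-1) /=.
by rewrite /cu1 invr_eq0 (negbTE a0) invrK.
Qed.

Lemma twist_monomial (i : nat) : (i <= n)%N ->
  exists X : twist k n (oT _), forall a, @ev k n (oT (P1 k)) X (Some a) = a ^+ i.
Proof.
(* The form x0^(n-i) x1^i at (1, a) and at (0, 1); the latter value is nonzero only for i = n. *)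
move=> lin; pose g (x : P1 k) : k := if x is Some a then a ^+ i else (i == n)%:R.
suff [X XE] : exists X : twist k n (oT _),
    forall x, oset (oT (P1 k)) x -> @ev k n (oT (P1 k)) X x = g x.
  by exists X => a; rewrite XE.
apply: mk_section => x _; case: (cover_charts x) => /cDE[a ->].
  exists (chart0 k), a, (oT _), 'X^i, 1; split=> // b _ _.
  by rewrite hornerC oner_neq0 hornerXn divr1 /= expr1n mulr1.
exists (chart1 k), a, (oT _), 'X^(n - i), 1; split=> // b _ _.
rewrite hornerC oner_neq0 hornerXn divr1 /= /cpt1 /cu1; split=> //.
case: (eqVneq b 0) => [->|b0] /=.
  by rewrite expr1n mulr1 expr0n subn_eq0 eqn_leq lin.
have -> : b^-1 ^+ n = b^-1 ^+ (n - i) * b^-1 ^+ i by rewrite -exprD subnK.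
by rewrite mulrA -exprMn divff // expr1n mul1r.
Qed.

End Twist.

(** * Restriction of scalars along a morphism of structure sheaves *)

Section RestrictionOfScalars.
Variables (k : fieldType) (X : topologicalType) (A B : algSheaf k X).
Variables (f : algHom A B) (M : modSheaf B).

(** A separate name for the same type, on which the action of [A] can be declared without clashing
    with that of [B]. *)
Definition rsc_sec (U : opens X) : Type := M U.

HB.instance Definition _ U := GRing.Zmodule.on (rsc_sec U).

Definition rsc_scale U (a : A U) (m : rsc_sec U) : rsc_sec U := f U a *: (m : M U).

Fact rsc_scaleA U (a b : A U) (m : rsc_sec U) :
  rsc_scale a (rsc_scale b m) = rsc_scale (a * b) m.
Proof. by rewrite /rsc_scale scalerA rmorphM. Qed.

Fact rsc_scale1 U : left_id 1 (@rsc_scale U).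
Proof. by move=> m; rewrite /rsc_scale rmorph1 scale1r. Qed.

Fact rsc_scaleDr U : right_distributive (@rsc_scale U) +%R.
Proof. by move=> a m m'; exact: scalerDr. Qed.

Fact rsc_scaleDl U (m : rsc_sec U) : {morph (@rsc_scale U)^~ m : a b / a + b}.
Proof. by move=> a b; rewrite /rsc_scale rmorphD scalerDl. Qed.

HB.instance Definition _ U := GRing.Zmodule_isLmodule.Build (A U) (rsc_sec U)
  (@rsc_scaleA U) (@rsc_scale1 U) (@rsc_scaleDr U) (@rsc_scaleDl U).

Definition rsc_mod (U : opens X) : lmodType (A U) := rsc_sec U.

Definition rsc_res (U V : opens X) (VU : V `<=` U) :
  {additive rsc_mod U -> rsc_mod V} := @mres k X B M U V VU.

Fact rsc_resZ (U V : opens X) (VU : V `<=` U) (a : A U) (m : rsc_mod U) :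
  rsc_res VU (a *: m) = ares VU a *: rsc_res VU m.
Proof.
rewrite -[a *: m]/(f U a *: (m : M U)) -[RHS]/(f V (ares VU a) *: mres VU (m : M U)).
by rewrite ahom_res -mresZ.
Qed.

Definition restrict_scalars : modSheaf A :=
  @ModSheaf k X A rsc_mod rsc_res rsc_resZ (@mres_id k X B M)
    (@mres_comp k X B M) (@modSheaf_glue k X B M).

End RestrictionOfScalars.

(** * Sections of a pullback *)

Section Converse.
Variables (k : closedFieldType) (C : ribbon k) (n : nat).

(* The restriction of L to P^1 is O(n), seen as a C-module through [rib_red]:
   it splits the unit [eta], which is therefore injective. *)
Lemma pullback_H0 (L : modSheaf C) (pi : algHom (O_P1 k) C) h :
  is_splitting pi -> is_pullback pi (twist k n) L -> dim_H0 L h -> (n.+1 <= h)%N.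
Proof.
move=> spi [eta univ].
pose P := restrict_scalars (rib_red C) (twist k n).
have uZ (U : opens (P1 k)) (a : O_P1 k U) (m : twist k n U) :
    (idfun (a *: m) : P U) = pi U a *: (m : P U).
  by rewrite -[RHS]/(rib_red C U (pi U a) *: (m : twist k n U)) spi.
pose u : modHom pi (twist k n) P :=
  @ModHom k (P1 k) (O_P1 k) C pi (twist k n) P (fun U => idfun) uZ
    (fun _ _ _ _ => erefl).
have [v vE _] := univ P u.
have X (i : 'I_n.+1) := cid (twist_monomial k (ltn_ord i : (i <= n)%N)).
apply: (@H0_lower _ _ _ _ _ (fun i => eta _ (projT1 (X i)))) => c c0.
have : v (oT _) (lincomb (scal C _) (fun i => eta _ (projT1 (X i))) c) = 0.
  by rewrite c0 raddf0.
rewrite /lincomb raddf_sum /=.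
under eq_bigr => i _ do rewrite mhomZ vE.
move=> s0.
have e0 : \sum_(i < n.+1) scal (O_P1 k) (oT _) (c 0 i) *: projT1 (X i) = 0.
  rewrite -[RHS]s0; apply: eq_bigr => i _.
  rewrite -[RHS]/(rib_red C _ (scal C _ (c 0 i)) *: projT1 (X i)).
  by rewrite ahom_scal.
have ev_sum (r : seq 'I_n.+1) (G : 'I_n.+1 -> twist k n (oT _)) a :
    @ev k n (oT (P1 k)) (\sum_(i <- r) G i) (Some a) =
    \sum_(i <- r) @ev k n (oT (P1 k)) (G i) (Some a).
  elim: r => [|i r IH]; first by rewrite !big_nil; exact: ev0.
  by rewrite !big_cons -IH; exact: evD.
(* A relation between the monomial sections, evaluated on the chart x0 <> 0, says that this
   polynomial vanishes at every point. *)
pose Q := \poly_(j < n.+1) c 0 (inord j).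
have Q0 : Q = 0.
  apply: (@poly_open_eq0 _ (chart0 k) (oT _)); first by exists None.
  move=> a _; rewrite horner_poly.
  have := congr1 (fun s => @ev k n (oT (P1 k)) s (Some a)) e0.
  rewrite /= ev_sum => e; transitivity (@ev k n (oT (P1 k)) 0 (Some a)); last exact: ev0.
  rewrite -e; apply: eq_bigr => i _; rewrite evTZ evO_scal // inord_val.
  by case: (X i) => /= x ->.
apply/rowP => i; rewrite mxE.
have := congr1 (fun q : {poly k} => q`_i) Q0.
by rewrite /= coef_poly ltn_ord inord_val coef0.
Qed.

End Converse.

(** * The equality case *)

Section Equality.
Variables (k : closedFieldType) (C : ribbon k).
Notation O := (O_P1 k).
Notation red := (rib_red C).
Notation D01 := (D01 k).
Notation D0 := (D0 k).
Notation D1 := (D1 k).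
Variables (F : ideal_frame C) (L : modSheaf C) (e0 : L D0) (e1 : L D1).
Variables (w : C D01) (kap : k) (n : nat).
Hypotheses (g0 : free_generator e0) (g1 : free_generator e1).
Hypotheses (wE : rs D01 e1 = w *: rs D01 e0) (kap0 : kap != 0).
Hypothesis redwE : forall a, a != 0 -> evO (red D01 w) (Some a) = kap * a ^ n%:Z.
Hypotheses (n_gt0 : (0 < n)%N) (pn : (if_p F + n%:Z < - 2%:Z)%R).
Variable s : nat -> L (oT (P1 k)).
Hypothesis sE : forall i, (i <= n)%N -> red D01 (gcrd g0 (s i)) = tc k ^+ i.

Let y0 : L D0 := rs D0 (s 0%N).
Let y1 : L D1 := rs D1 (s n).

(** The coordinate of s_0 reduces to t^0 = 1, so it is a unit and s_0 generates; dividing by it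
    normalizes [alpha 0] to 1. *)
Lemma lifts_D0 : free_generator y0 /\ exists alpha : nat -> C D0,
  [/\ forall i, rs D0 (s i) = alpha i *: y0, alpha 0%N = 1 &
      forall i, (i <= n)%N -> red D0 (alpha i) = zc (chart0 k) ^+ i].
Proof.
have ex i := cid (gen_ex0 g0 (rs D0 (s i))).
pose a i := projT1 (ex i).
have aE i : rs D0 (s i) = a i *: e0 by exact: projT2 (ex i).
have ra_red i : (i <= n)%N -> red D0 (a i) = zc (chart0 k) ^+ i.
  move=> lin; apply: (O_open_eq (@D010 k) (D01_neq0 k)).
  rewrite raXn; last exact: D010.
  rewrite -/(tc k) -sE // -red_ra -(crd_rs0 g0 (aE i)).
  by rewrite /gcrd rs_rs //; exact: D010.
have [c ac] : exists c, a 0%N * c = 1.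
  by apply: (@unit_lift _ _ _ _ 1); rewrite ra_red // expr0 mulr1.
split; first by rewrite /y0 aE; exact: gen_unit ac g0.
exists (fun i => a i * c); split=> // i.
  by rewrite /y0 !aE scalerA -mulrA [c * _]mulrC ac mulr1.
move=> lin; rewrite rmorphM ra_red //.
have := congr1 (red _) ac; rewrite rmorphM ra_red // expr0 mul1r rmorph1 => ->.
by rewrite mulr1.
Qed.

(** If b_i is the coordinate of s_i with respect to [e1], then red(b_i) kap t^n = t^i, so b_i
    reduces to kap^-1 t^(i-n). For i = n this is a constant unit, and dividing by b_n removes
    kap. *)
Lemma lifts_D1 : free_generator y1 /\ exists beta : nat -> C D1,
  [/\ forall i, rs D1 (s i) = beta i *: y1, beta n = 1 &
      forall i, (i <= n)%N -> red D1 (beta i) = zc (chart1 k) ^+ (n - i)].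
Proof.
have ex i := cid (gen_ex1 g1 (rs D1 (s i))).
pose b i := projT1 (ex i).
have bE i : rs D1 (s i) = b i *: e1 by exact: projT2 (ex i).
have rb i : (i <= n)%N -> red D1 (b i) = scal O D1 kap^-1 * zc (chart1 k) ^+ (n - i).
  move=> lin; apply: (O_open_eq (@D011 k) (D01_neq0 k)).
  rewrite raM ra_scal ?raXn; [|exact: D011|exact: D011].
  rewrite -/(uc k).
  have := sE lin; rewrite /gcrd -(rs_rs _ (@D011 k)) // (crd_rs1 g0 wE (bE i)).
  rewrite rmorphM red_ra => e; apply: laurent_ext => x x0.
  have Dx : oset D01 (Some x) by exact/D01_Some.
  have := congr1 (fun t : O D01 => evO t (Some x)) e.
  rewrite /= !evOM !evOX // redwE // evO_tc // evO_uc // evO_scal // => e'.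
  have kx : kap * x ^ n%:Z != 0 by rewrite mulf_neq0 // expf_neq0.
  apply: (mulIf kx); rewrite e' -exprnP.
  have -> : x ^+ n = x ^+ (n - i) * x ^+ i by rewrite -exprD subnK.
  rewrite exprVn; field; by rewrite kap0 expf_neq0.
have [c bc] : exists c, b n * c = 1.
  apply: (@unit_lift _ _ _ _ (scal O D1 kap)).
  by rewrite rb // subnn expr0 mulr1 -rmorphM mulVf // rmorph1.
split; first by rewrite /y1 bE; exact: gen_unit bc g1.
exists (fun i => b i * c); split=> // i.
  by rewrite /y1 !bE scalerA -mulrA [c * _]mulrC bc mulr1.
move=> lin; rewrite rmorphM rb //.
have cE : red D1 c = scal O D1 kap.
  have := congr1 (red _) bc; rewrite rmorphM rb // subnn expr0 mulr1 rmorph1 => h.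
  apply: (@inverse_uniq _ (scal O D1 kap^-1)) => //.
  by rewrite -rmorphM mulVf // rmorph1.
by rewrite cE mulrAC -rmorphM mulVf // rmorph1 mul1r.
Qed.

(** The morphism O(n) -> L takes x0^n to s_0 and x1^n to s_n. It is well defined because s_n = T^n
    s_0 and the splitting sends t to T; as s_0 and s_n are generators, the pullback criterion
    applies. *)
Lemma split_of_lifts : exists2 pi : algHom O C,
  is_splitting pi & is_pullback pi (twist k n) L.
Proof.
have [gy0 [alpha [aE a0 ra_]]] := lifts_D0.
have [gy1 [beta [bE bn rb_]]] := lifts_D1.
have ab i : (i <= n)%N -> ra D01 (alpha i) = ra D01 (beta i) * ra D01 (alpha n).
  move=> lin; apply: (gen_inj gy0 (@D010 k)).
  have e1' := congr1 (rs D01) (aE i); have e2 := congr1 (rs D01) (bE i).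
  have e3 := congr1 (rs D01) (aE n).
  move: e1' e2 e3; rewrite !rsZ /y1 !(rs_rs _ (@D010 k)) // !(rs_rs _ (@D011 k)) //.
  by move=> <- -> ->; rewrite scalerA.
have pw := alpha_power n_gt0 pn ra_ rb_ a0 ab.
have TU := alpha_beta_inverse n_gt0 pn ra_ rb_ a0 ab.
have r1 := red_alpha1 n_gt0 ra_.
have r2 := red_beta_last n_gt0 rb_.
pose pi := splitting r1 r2 TU; exists pi; first exact: splitting_is.
have [x0 [x0E gx0]] := twist_gen n (chart0 k).
have [x1 [x1E gx1]] := twist_gen n (chart1 k).
have [V a V0 V1 xE|eta [eta0 eta1]] := @hom_of_generators _ _ _ pi (twist k n) L
    x0 x1 y0 y1 gx0 gx1.
  have V01 : V `<=` D01 by rewrite D01_meet; exact: oIS.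
  have -> : a = ra V (tc k ^+ n).
    apply: (gen_inj gx0 V0); rewrite -xE -(rs_rs _ V01 (@D011 k)).
    by rewrite (twist_transition x0E x1E) rsZ rs_rs //; exact: D010.
  rewrite ahom_ra // rmorphXn splitting_tc -pw // -(rs_rs _ V01 (@D010 k)) -rsZ.
  have e3 := congr1 (rs D01) (aE n); rewrite rsZ in e3; rewrite -e3.
  by rewrite /y1 !rs_rs //; exact: D010.
by apply: (pullback_of_generators gx0 gx1 (eta := eta)); rewrite ?eta0 ?eta1.
Qed.

End Equality.

Theorem theorem2p3 (k : closedFieldType) (k_char0 : [pchar k]%R =i pred0)
    (C : ribbon k) (g n : nat) (L : modSheaf C)
    (C_genus : has_genus C (Posz g)) (L_line : line_bundle L)
    (L_deg : has_degree L (Posz (2 * n))) (n_bounds : (1 <= n <= g - 2)%N) :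
  exists h : nat, [/\ dim_H0 L h, (h <= n + 1)%N &
    h = (n + 1)%N <->
    hyperelliptic C /\
    exists2 pi : algHom (O_P1 k) C,
      is_splitting pi & is_pullback pi (twist k n) L].
Proof.
(* The degree is defined through an Euler characteristic, which already carries the dimension [h] of
   the global sections. *)
have [c [[h [h1 [H0 _ _]]] _] _] := L_deg.
have [F _] := ideal_frame_ex C.
have [e0 g0] := line_trivial (chart0 k) L_line.
have [e1 g1] := line_trivial (chart1 k) L_line.
have [w [winv [ww wE]]] := gen_change g0 g1.
have [kap [q [kap0 redwE]]] : exists c (m : int), c != 0 /\
    forall a, a != 0 -> evO (rib_red C (D01 k) w) (Some a) = c * a ^ m.
  by apply: (@laurent_unit _ _ (rib_red C _ winv)); rewrite -rmorphM ww rmorph1.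
have qn : q = n%:Z := twist_degree L_line g0 g1 wE ww kap0 redwE C_genus L_deg.
rewrite qn in redwE.
have pE := frame_degree F C_genus.
(* With p = -g - 1, the bound n <= g - 2 is exactly n + p < -2. *)
have pn2 : (if_p F + n%:Z < - 2%:Z)%R by rewrite pE; move: n_bounds; clear; lia.
have pn : (if_p F + n%:Z < 0)%R by move: pn2; clear; lia.
have [hn lifts] := H0_bound L_line g0 g1 wE ww kap0 redwE pn H0.
exists h; rewrite addn1; split=> //; split=> [/lifts[s sE]|[_ [pi spi pull]]].
  have n_gt0 : (0 < n)%N by case/andP: n_bounds.
  have [pi spi pull] := split_of_lifts g1 wE kap0 redwE n_gt0 pn2 sE.
  by split; [exists pi|exists pi].
by apply/eqP; rewrite eqn_leq hn (pullback_H0 spi pull H0).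
Qed.
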